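(* Let $n\ge1$ and let $\mathbb D^n$ be the unit polydisc in $\mathbb C^n$. The following are equivalent: (i) the corona theorem (i.e. the Corona Property) holds for $H^\infty(\mathbb D^n)$; (ii) the Hardy space $H^2(\mathbb D^n)$ satisfies the Convex Poisson Property; (iii) the Bergman space $A^2(\mathbb D^n)$ satisfies the Convex Poisson Property.
   Context: Let $\Omega=\mathbb D^n$. $H^\infty(\Omega)$ is the algebra of bounded holomorphic functions. $A^2(\Omega)$ is the space of holomorphic $f$ with $\|f\|^2=\int_\Omega|f|^2d\mu<\infty$, $\mu$ normalized Lebesgue measure on $\Omega$. $H^2(\Omega)$ is the Hardy space with norm $\|f\|^2=\int_{\mathbb T^n}|f|^2d\mu$ (boundary values on the distinguished boundary $\mathbb T^n$), $\mu$ normalized Haar measure on $\mathbb T^n$. For $\mathcal H$ either space, $k_a$ is the reproducing kernel at $a\in\Omega$, $\widetilde{k_a}=k_a/\sqrt{k_a(a)}$. For $M\ge1$, $\mathbf a=(a_1,\dots,a_M)\in\Omega^M$ and $\theta=(\theta_0,\dots,\theta_M)\in[0,1]^{M+1}$ with $\sum_m\theta_m=1$, put $$\|h\|_{\mathcal H^{\mathbf a,\theta}}^2=\int|h|^2\Big(\theta_0+\sum_{m=1}^M\theta_m|\widetilde{k_{a_m}}|^2\Big)d\mu .$$ Corona data: $N\ge1$, $c>0$, and $\varphi_1,\dots,\varphi_N\in H^\infty(\Omega)$ with $1\ge\max_\ell|\varphi_\ell(z)|^2\ge c^2>0$ for all $z\in\Omega$. Corona Property for $H^\infty(\Omega)$: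 for all corona data there are $C>0$ and $f_1,\dots,f_N\in H^\infty(\Omega)$ with $\max_\ell|f_\ell(z)|^2\le C^2$ and $\sum_\ell\varphi_\ell(z)f_\ell(z)=1$ for all $z\in\Omega$. Convex Poisson Property for $\mathcal H$: for all corona data there is $C>0$ such that for all $M\ge1$, all $\mathbf a=(a_1,\dots,a_M)\in\Omega^M$ and all $\theta=(\theta_0,\dots,\theta_M)\in[0,1]^{M+1}$ with $\sum_{m=0}^M\theta_m=1$ there are $f_1,\dots,f_N\in\mathcal H$ with $\sum_\ell\|f_\ell\|_{\mathcal H^{\mathbf a,\theta}}^2\le C^2$ and $\sum_\ell\varphi_\ell f_\ell=1$ on $\Omega$. *)

(* Defs.v *)
From HB Require Import structures.
From mathcomp Require Import all_boot all_order all_algebra.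
From mathcomp Require Import complex.
From mathcomp Require Import all_classical all_reals all_analysis measurable_realfun.

Set Implicit Arguments.
Unset Strict Implicit.
Unset Printing Implicit Defensive.

Import Order.TTheory GRing.Theory Num.Theory.
Import numFieldNormedType.Exports.

Local Open Scope classical_set_scope.
Local Open Scope ring_scope.
Local Open Scope complex_scope.

(* [R[i]] as a normed module over itself, so that [differentiable] below means
   complex differentiable. *)
HB.instance Definition _ (R : realType) := NormedModule.copy R[i] R[i]^o.

(* The real-valued modulus; [`|z|] lives in [R[i]]. *)
Notation cmod := ComplexField.Normc.normc.

Section ProductProbability.
Context d (T : measurableType d) (R : realType).

Definition tuple_cons n (x : T * n.-tuple T) : n.+1.-tuple T :=
  [tuple of x.1 :: x.2].

Lemma measurable_tuple_cons n : measurable_fun setT (@tuple_cons n).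
Proof. exact: (measurable_cons measurable_fst measurable_snd). Qed.

HB.instance Definition _ n := isMeasurableFun.Build _ _ _ _
  (@tuple_cons n) (@measurable_tuple_cons n).

Fixpoint prob_power (P : probability T R) (n : nat) :
    probability (n.-tuple T) R :=
  if n is m.+1
  then distribution (P \x prob_power P m)%E (@tuple_cons m)
  else dirac [tuple].

End ProductProbability.

Section Polydisc.
Context (R : realType) (n : nat).
Local Notation C := R[i].

Definition polydisc : set 'rV[C]_n :=
  [set z | forall i, cmod (z ord0 i) < 1].

(* Functions on the polydisc are represented by total functions on C^n; only
   their values on the polydisc are relevant. *)
Definition holomorphic (f : 'rV[C]_n -> C) : Prop :=
  forall z, polydisc z -> differentiable f z.

Definition bounded_holomorphic (f : 'rV[C]_n -> C) : Prop :=
  holomorphic f /\ exists B : R, forall z, polydisc z -> cmod (f z) <= B.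

Definition corona_data (N : nat) (c : R) (phi : 'I_N -> 'rV[C]_n -> C) : Prop :=
  [/\ (0 < N)%N, 0 < c, forall l, bounded_holomorphic (phi l) &
    forall z, polydisc z ->
      c ^+ 2 <= \big[Num.max/0]_(l < N) cmod (phi l z) ^+ 2 <= 1].

Definition corona_property : Prop :=
  forall (N : nat) (c : R) (phi : 'I_N -> 'rV[C]_n -> C),
    corona_data c phi ->
  exists (K : R) (f : 'I_N -> 'rV[C]_n -> C),
    [/\ 0 < K, forall l, bounded_holomorphic (f l),
      forall z, polydisc z ->
        \big[Num.max/0]_(l < N) cmod (f l z) ^+ 2 <= K ^+ 2 &
      forall z, polydisc z -> \sum_(l < N) phi l z * f l z = 1].

End Polydisc.

(* A space of functions on the polydisc whose inner product is
   <f, g> = \int[fs_mu]_(x in fs_dom) fs_trace f x * conj (fs_trace g x). *)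
Record function_space (R : realType) (n : nat) := FunctionSpace {
  fs_disp : measure_display ;
  fs_base : measurableType fs_disp ;
  fs_mu : {measure set fs_base -> \bar R} ;
  fs_dom : set fs_base ;
  fs_trace : ('rV[R[i]]_n -> R[i]) -> fs_base -> R[i] ;
  fs_mem : set ('rV[R[i]]_n -> R[i])
}.

Section ConvexPoisson.
Context (R : realType) (n : nat) (H : function_space R n).
Local Notation C := R[i].
Local Notation mu := (fs_mu H).
Local Notation D := (fs_dom (f := H)).
Local Notation tr := (fs_trace (f := H)).

Definition cintegral (F : fs_base H -> C) : C :=
  (\int[mu]_(x in D) complex.Re (F x)) +i* (\int[mu]_(x in D) complex.Im (F x)).

Definition inner (f g : 'rV[C]_n -> C) : C :=
  cintegral (fun x => tr f x * (tr g x)^*).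

Definition is_reproducing_kernel (a : 'rV[C]_n) (k : 'rV[C]_n -> C) : Prop :=
  fs_mem H k /\ forall f, fs_mem H f -> f a = inner f k.

(* The reproducing kernel at [a]; it is unique as a function on the polydisc. *)
Definition repro_kernel (a : 'rV[C]_n) : 'rV[C]_n -> C :=
  xget (fun=> 0) [set k | is_reproducing_kernel a k].

Definition normalized_kernel (a : 'rV[C]_n) : 'rV[C]_n -> C :=
  fun z => repro_kernel a z / sqrtC (repro_kernel a a).

Definition poisson_weight M (a : 'I_M -> 'rV[C]_n) (theta : 'I_M.+1 -> R)
    (x : fs_base H) : R :=
  theta ord0 + \sum_(m < M)
    theta (lift ord0 m) * cmod (tr (normalized_kernel (a m)) x) ^+ 2.

Definition sqnorm M (a : 'I_M -> 'rV[C]_n) (theta : 'I_M.+1 -> R)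
    (h : 'rV[C]_n -> C) : \bar R :=
  (\int[mu]_(x in D) (cmod (tr h x) ^+ 2 * poisson_weight a theta x)%:E)%E.

Definition convex_poisson_property : Prop :=
  forall (N : nat) (c : R) (phi : 'I_N -> 'rV[C]_n -> C),
    corona_data c phi ->
  exists K : R, 0 < K /\
    forall (M : nat) (a : 'I_M -> 'rV[C]_n) (theta : 'I_M.+1 -> R),
      (0 < M)%N ->
      (forall m, polydisc (a m)) ->
      (forall m, 0 <= theta m <= 1) ->
      \sum_(m < M.+1) theta m = 1 ->
    exists f : 'I_N -> 'rV[C]_n -> C,
      [/\ forall l, fs_mem H (f l),
        (\sum_(l < N) sqnorm a theta (f l) <= (K ^+ 2)%:E)%E &
        forall z, polydisc z -> \sum_(l < N) phi l z * f l z = 1].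

End ConvexPoisson.

Section Bergman.
Context (R : realType) (n : nat).
Local Notation C := R[i].
Local Notation plane := (measurableTypeR R * measurableTypeR R)%type.

Definition unit_disc : set plane :=
  [set p | cmod ((p.1 : R) +i* (p.2 : R)) < 1].

Lemma measurable_unit_disc : measurable unit_disc.
Proof.
pose q (p : plane) : R := (p.1 : R) ^+ 2 + (p.2 : R) ^+ 2.
have mq : measurable_fun setT q.
  by apply: measurable_funD; apply: measurable_funX;
    [exact: measurable_fst | exact: measurable_snd].
rewrite (_ : unit_disc = setT `&` q @^-1` `]-oo, 1[); first exact: mq.
have disc_q p : (cmod ((p.1 : R) +i* (p.2 : R)) < 1) = (q p < 1).
  by rewrite -[X in _ < X]sqrtr1 /= ltr_sqrt.
by rewrite setTI; apply/seteqP; split => p;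
  rewrite /unit_disc /= in_itv /= disc_q.
Qed.

(* Normalized area measure on the unit disc of R^2 = C. The last argument of
   [mnormalize] only matters for measures of total mass 0 or +oo. *)
Definition disc_prob : probability plane R :=
  mnormalize (mrestr (lebesgue_measure \x lebesgue_measure)%E
    measurable_unit_disc) (dirac point).

Definition disc_point (p : n.-tuple plane) : 'rV[C]_n :=
  \row_i (((tnth p i).1 : R) +i* ((tnth p i).2 : R)).

Definition bergman_dom : set (n.-tuple plane) :=
  [set p | polydisc (disc_point p)].

Definition bergman_mem : set ('rV[C]_n -> C) :=
  [set f | holomorphic f /\
    (\int[prob_power disc_prob n]_(p in bergman_dom)
      (cmod (f (disc_point p)) ^+ 2)%:E < +oo)%E].

Definition bergman_space : function_space R n :=
  FunctionSpace (prob_power disc_prob n) bergman_dom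
    (fun f p => f (disc_point p)) bergman_mem.

End Bergman.

Section Hardy.
Context (R : realType) (n : nat).
Local Notation C := R[i].
Local Notation line := (measurableTypeR R).

(* The torus T^n is parametrized by [0, 1]^n via t |-> exp(2 i pi t); the
   normalized Haar measure is the image of the uniform measure. *)
Definition angle_prob : probability line R := uniform_prob (@ltr01 R).

Definition torus_point (t : n.-tuple line) : 'rV[C]_n :=
  \row_i (cos (2 * pi * (tnth t i : R)) +i* sin (2 * pi * (tnth t i : R))).

Definition hardy_mem : set ('rV[C]_n -> C) :=
  [set f | holomorphic f /\
    (ereal_sup [set \int[prob_power angle_prob n]_t
      (cmod (f (r%:C *: torus_point t)) ^+ 2)%:E | r in `]0%R, 1%R[ ] < +oo)%E].

(* The radial limit, which exists for almost all [t] when [f] is in the Hardy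
   space; [lim] takes a default value elsewhere. *)
Definition boundary_value (f : 'rV[C]_n -> C) (t : n.-tuple line) : C :=
  lim (f (r%:C *: torus_point t) @[r --> (1 : R)^'-]).

Definition hardy_space : function_space R n :=
  FunctionSpace (prob_power angle_prob n) setT boundary_value hardy_mem.

End Hardy.

(* Main.v *)
(** Each weight [theta_0 + sum theta_m |k~_{a_m}|^2] has mass at most 1, so a bounded solution
    of the Bezout equation is a solution in every weighted norm.  Conversely, applying the
    reproducing formula to [f * k_a] gives [|f(a)|^2 <= int |f|^2 |k~_a|^2].  For finitely many
    points a minimax argument over the weights [theta] therefore turns the Convex Poisson
    Property into one solution [f] with [sum_l |f_l(a_m)|^2 <= C^2 + 1] at all these points, and
    an ultralimit over the finite subsets of the polydisc, holomorphic because of locally uniform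
    Taylor estimates, is a bounded solution.

    These arguments only use [space_axioms].  For the Bergman space they follow from mean values
    over discs, the kernel being a multiple of the function of least norm with value 1 at [a].
    For the Hardy space the trace has to be controlled.  On a disc, Cauchy's theorem gives
    [||f_s - f_r||^2 = ||f_s||^2 + ||f_r||^2 - 2 ||f_p||^2] for the dilates of [f], where
    [p^2 = r s]; hence [||f_s - f_r||^2 <= ||f_s||^2 - ||f_r||^2] for [r <= s] and the dilates
    converge in L^2 on the torus.  The Poisson kernel is dominated by the Hardy-Littlewood maximal
    function along the orbits of the rotations [t + s (1, ..., 1)], so radial limits exist almost
    everywhere; the Szego kernel reproduces by Cauchy's formula, and it is bounded. *)

Require Import Defs.
From HB Require Import structures.
From mathcomp Require Import all_boot all_order all_algebra.
From mathcomp Require Import complex.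
From mathcomp Require Import all_classical all_reals all_analysis.
From mathcomp Require Import measurable_realfun ring lra.

Set Implicit Arguments.
Unset Strict Implicit.
Unset Printing Implicit Defensive.

Import Order.TTheory GRing.Theory Num.Theory.
Import numFieldNormedType.Exports.

Local Open Scope classical_set_scope.
Local Open Scope ring_scope.
Local Open Scope complex_scope.

(** * Complex calculus on normed modules *)

(** Two features of the definitions shape the argument. The trace on the torus is a pointwise radial
    limit, so L^2 convergence of the dilates does not identify it: convergence as [r -> 1] has to be
    established at almost every [t], together with the measurability of the limit. For the same
    reason Hardy traces add and multiply only almost everywhere, and the abstract part asks for no
    more. Secondly, [theta] may vanish at some points, and the solution given for that [theta] may
    have infinite energy there. The minimax argument therefore uses strictly positive weights only;
    it loses an arbitrarily small excess, taken to be 1, hence [C^2 + 1].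

    The function theory rests on one statement, the invariance of circle integrals under linear
    homotopies of circles ([circle_homotopy]): it yields Cauchy's and Poisson's formulas, the Taylor
    estimate and the inner product of two dilates. In several variables it is applied to one
    coordinate at a time for local bounds and for the Szego kernel, and to the discs [z t], with [t]
    on the torus, for the trace. *)

Section ComplexModulus.
Variable R : realType.
Local Notation C := R[i].
Implicit Types z w : C.

Lemma normc_cmod z : `|z| = (cmod z)%:C.
Proof. by case: z. Qed.

Lemma cmod_ge0 z : 0 <= cmod z.
Proof. by case: z => a b; exact: sqrtr_ge0. Qed.

Lemma cmod0 : cmod (0 : C) = 0. Proof. exact: Normc.normc0. Qed.
Lemma cmod1 : cmod (1 : C) = 1. Proof. exact: Normc.normc1. Qed.

Lemma cmod_eq0 z : (cmod z == 0) = (z == 0).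
Proof.
by apply/eqP/eqP => [/Normc.eq0_normc //|->]; rewrite cmod0.
Qed.

Lemma cmod_gt0 z : (0 < cmod z) = (z != 0).
Proof. by rewrite lt_neqAle cmod_ge0 eq_sym cmod_eq0 andbT. Qed.

Lemma cmodD z w : cmod (z + w) <= cmod z + cmod w.
Proof. by have := ler_normD z w; rewrite !normc_cmod -rmorphD lecR. Qed.

Lemma cmodM z w : cmod (z * w) = cmod z * cmod w.
Proof. exact: Normc.normcM. Qed.

Lemma cmodN z : cmod (- z) = cmod z.
Proof. by have [] : (cmod (- z))%:C = (cmod z)%:C by rewrite -!normc_cmod normrN. Qed.

Lemma cmodV z : cmod z^-1 = (cmod z)^-1.
Proof. exact: Normc.normcV. Qed.

Lemma cmodX z k : cmod (z ^+ k) = cmod z ^+ k.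
Proof. by elim: k => [|k IH]; rewrite ?expr0 ?cmod1 // !exprS cmodM IH. Qed.

Lemma cmodBC z w : cmod (z - w) = cmod (w - z).
Proof. by rewrite -cmodN opprB. Qed.

Lemma cmodB z w : cmod (z - w) <= cmod z + cmod w.
Proof. by rewrite -(cmodN w); exact: cmodD. Qed.

Lemma cmodB_ge z w : cmod z - cmod w <= cmod (z - w).
Proof. by rewrite lerBlDr; apply: le_trans (cmodD _ _); rewrite subrK. Qed.

Lemma cmod_sqr z : cmod z ^+ 2 = complex.Re z ^+ 2 + complex.Im z ^+ 2.
Proof. by case: z => a b /=; rewrite sqr_sqrtr // addr_ge0 // sqr_ge0. Qed.

Lemma Re_le_cmod z : `|complex.Re z| <= cmod z.
Proof.
rewrite -[leLHS]sqrtr_sqr; case: z => a b /=.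
by apply: ler_wsqrtr; rewrite lerDl sqr_ge0.
Qed.

Lemma Im_le_cmod z : `|complex.Im z| <= cmod z.
Proof.
rewrite -[leLHS]sqrtr_sqr; case: z => a b /=.
by apply: ler_wsqrtr; rewrite lerDr sqr_ge0.
Qed.

Lemma cmod_conj z : cmod z^* = cmod z.
Proof. by case: z => a b /=; rewrite sqrrN. Qed.

Lemma cmod_real (x : R) : cmod x%:C = `|x|.
Proof. by rewrite /= expr0n /= addr0 sqrtr_sqr. Qed.

Lemma mul_conj_cmod z : z * z^* = (cmod z ^+ 2)%:C.
Proof.
rewrite cmod_sqr; case: z => a b; apply/eqP; rewrite eq_complex /=.
by apply/andP; split; apply/eqP; ring.
Qed.

Lemma cmod_le_ReIm z : cmod z <= `|complex.Re z| + `|complex.Im z|.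
Proof.
rewrite -[leRHS]ger0_norm ?addr_ge0 // -[leRHS]sqrtr_sqr; case: z => a b /=.
apply: ler_wsqrtr; rewrite sqrrD !real_normK ?num_real // lerD2r lerDl.
by rewrite mulrn_wge0 // mulr_ge0.
Qed.

Lemma cmod_small z : (forall e, 0 < e -> cmod z <= e) -> z = 0.
Proof.
move=> h; apply/eqP; rewrite -cmod_eq0 eq_le cmod_ge0 andbT.
by apply/ler_addgt0Pl => e e0; rewrite addr0; exact: h.
Qed.

End ComplexModulus.

Section ComplexTopology.
Variable R : realType.
Local Notation C := R[i].

Lemma cvg_cmodP (T : Type) (F : set_system T) {FF : Filter F} (f : T -> C) (l : C) :
  f @ F --> l <-> forall e : R, 0 < e -> \forall x \near F, cmod (l - f x) < e.
Proof.
split=> [/cvgrPdist_lt h e e0|h].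
  have e0' : 0 < e%:C by rewrite ltcR.
  by apply: filterS (h _ e0') => x; rewrite normc_cmod ltcR.
apply/cvgrPdist_lt => e; case: e => a b; rewrite ltcE /= => /andP[/eqP b0 a0].
by apply: filterS (h _ a0) => x; rewrite normc_cmod b0 ltcR.
Qed.

Lemma cvg_Re (T : Type) (F : set_system T) {FF : Filter F} (f : T -> C) (l : C) :
  f @ F --> l -> complex.Re (f x) @[x --> F] --> complex.Re l.
Proof.
move=> /cvg_cmodP h; apply/cvgrPdist_lt => e /h.
by apply: filterS => x; apply: le_lt_trans; rewrite -raddfB Re_le_cmod.
Qed.

Lemma cvg_Im (T : Type) (F : set_system T) {FF : Filter F} (f : T -> C) (l : C) :
  f @ F --> l -> complex.Im (f x) @[x --> F] --> complex.Im l.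
Proof.
move=> /cvg_cmodP h; apply/cvgrPdist_lt => e /h.
by apply: filterS => x; apply: le_lt_trans; rewrite -raddfB Im_le_cmod.
Qed.

Lemma cvg_complex (T : Type) (F : set_system T) {FF : Filter F} (f : T -> C) (l : C) :
  complex.Re (f x) @[x --> F] --> complex.Re l ->
  complex.Im (f x) @[x --> F] --> complex.Im l -> f @ F --> l.
Proof.
move=> /cvgrPdist_lt h /cvgrPdist_lt k; apply/cvg_cmodP => e e0.
have e2 : 0 < e / 2 by rewrite divr_gt0.
apply: filterS2 (h _ e2) (k _ e2) => x hx kx.
by rewrite (le_lt_trans (cmod_le_ReIm _)) // [ltRHS]splitr !raddfB /= ltrD.
Qed.

Lemma cvg_cmod (T : Type) (F : set_system T) {FF : Filter F} (f : T -> C) (l : C) :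
  f @ F --> l -> cmod (f x) @[x --> F] --> cmod l.
Proof.
move=> /cvg_cmodP h; apply/cvgrPdist_lt => e /h.
apply: filterS => x; apply: le_lt_trans; rewrite ler_norml cmodB_ge andbT.
by rewrite lerNl opprB cmodBC cmodB_ge.
Qed.

(** Norms of modules over [R[i]] take values in [R[i]]. They are nonnegative, hence real ([rnormE]),
    so the real part loses nothing and estimates can be made in [R]. *)
Definition rnorm (V : normedModType C) (v : V) : R := complex.Re `|v|.

Lemma rnormE (V : normedModType C) (v : V) : `|v| = (rnorm v)%:C.
Proof.
rewrite /rnorm; have := normr_ge0 v; set x := `|v|; case: x => a b.
by rewrite lecE /= => /andP[/eqP -> _].
Qed.

Lemma rnorm_ge0 (V : normedModType C) (v : V) : 0 <= rnorm v.
Proof. by have := normr_ge0 v; rewrite rnormE -[0]/(0%:C) lecR. Qed.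

Lemma rnormD (V : normedModType C) (u v : V) : rnorm (u + v) <= rnorm u + rnorm v.
Proof. by have := ler_normD u v; rewrite !rnormE -rmorphD /= lecR. Qed.

Lemma rnorm0 (V : normedModType C) : rnorm (0 : V) = 0.
Proof. by rewrite /rnorm normr0. Qed.

Lemma rnormZ (V : normedModType C) (l : C) (v : V) : rnorm (l *: v) = cmod l * rnorm v.
Proof.
have [//] : (rnorm (l *: v))%:C = (cmod l * rnorm v)%:C.
by rewrite rmorphM -!rnormE /= normrZ normc_cmod rnormE.
Qed.

Lemma near0_rnorm (V : normedModType C) (P : set V) :
  (\forall v \near nbhs (0 : V), P v) <->
  exists2 d : R, 0 < d & forall v, rnorm v < d -> P v.
Proof.
split=> [/nbhs_normP[e /= e0 h]|[d d0 h]].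
  have : 0 < e by [].
  case: e {e0} h => a b h; rewrite ltcE /= => /andP[/eqP b0 a0]; exists a => // v va.
  by apply: h; rewrite /ball_ /= sub0r normrN rnormE b0 ltcR.
apply/nbhs_normP; exists d%:C; first by rewrite /= ltcR.
by move=> v; rewrite /ball_ /= sub0r normrN rnormE ltcR; exact: h.
Qed.

(** Real constants, and any continuous linear [L] in place of the differential. Derivatives are
    produced in this form later: an ultralimit of linear maps is exhibited as [L], and uniqueness of
    the differential does the rest. *)
Lemma diff_epsP (V W : normedModType C) (f : V -> W) (x : V) :
  differentiable f x <->
  exists2 L : {linear V -> W}, continuous L &
   forall e : R, 0 < e -> exists2 d : R, 0 < d & forall v, rnorm v < d ->
     rnorm (f (v + x) - f x - L v) <= e * rnorm v.
Proof.
have oP (g : V -> W) : (forall eps : C, 0 < eps -> \forall x \near (0 : V), `|g x| <= eps * `|x|)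
  <-> forall e : R, 0 < e ->
   exists2 d : R, 0 < d & forall v, rnorm v < d -> rnorm (g v) <= e * rnorm v.
  split=> [h e e0|h].
    have e0' : 0 < e%:C by rewrite ltcR.
    have /near0_rnorm[d d0 k] := h _ e0'; exists d => // v /k /=.
    by rewrite !rnormE -rmorphM /= lecR.
  move=> e e0; move: e0 => /=; case: e => a b.
  rewrite ltcE /= => /andP[/eqP b0 a0].
  have [d d0 k] := h _ a0; apply/near0_rnorm; exists d => // v /k.
  by rewrite !rnormE b0 -[a +i* 0]/(a%:C) -[_%:C * _]rmorphM /= lecR.
split=> [/diff_locallyP[cd /eqaddoP/oP h]|[L cL h]].
  exists ('d f x : {linear V -> W}) => // e /h[d d0 k].
  exists d => // v /k; rewrite opprD addrA; exact.
have dE : f \o shift x = cst (f x) + L +o_ (0 : V) id.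
  apply/eqaddoP/oP => e /h[d d0 k].
  by exists d => // v /k; rewrite opprD addrA; exact.
have d_eq := diff_unique cL dE.
by apply/diff_locallyP; rewrite d_eq.
Qed.

Lemma linear_le_continuous (V W : normedModType C) (L : {linear V -> W}) (K : R) :
  (forall v, rnorm (L v) <= K * rnorm v) -> continuous L.
Proof.
move=> h; apply: bounded_linear_continuous; apply/ex_bound; exists `|K|%:C.
apply/near0_rnorm; exists 1 => // v v1; rewrite /= rnormE lecR.
apply: le_trans (h v) _; apply: le_trans (ler_norm _) _.
by rewrite normrM (ger0_norm (rnorm_ge0 _)) ler_piMr // ltW.
Qed.

Lemma rnorm_cmod (z : C) : rnorm z = cmod z.
Proof. by rewrite /rnorm normc_cmod. Qed.

(** In one variable the linear part is multiplication by a number, and it is this number that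
    Goursat's argument uses. *)
Definition cdiff (g : C -> C) (z : C) : Prop :=
  exists l : C, forall e : R, 0 < e -> exists2 d : R, 0 < d & forall w,
    cmod (w - z) < d -> cmod (g w - g z - l * (w - z)) <= e * cmod (w - z).

Lemma cdiffP (g : C -> C) (z : C) : differentiable g z <-> cdiff g z.
Proof.
split=> [/diff_epsP[L cL h]|[l h]].
  exists (L 1) => e /h[d d0 k]; exists d => // w wd.
  have := k (w - z); rewrite !rnorm_cmod subrK => /(_ wd).
  by rewrite [L 1 * _]mulrC -[_ * L 1]/(_ *: L 1) -linearZ /= /GRing.scale /= mulr1.
pose L : {linear C -> C} := ( *:%R l : {linear C -> C^o}).
apply/diff_epsP; exists L; first by move=> x; apply: continuousM;
  [exact: cst_continuous|exact: cvg_id].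
move=> e /h[d d0 k]; exists d => // v; rewrite !rnorm_cmod.
by have := k (v + z); rewrite addrK.
Qed.

Lemma coord_le_rnorm n (v : 'rV[C]_n) i : cmod (v ord0 i) <= rnorm v.
Proof.
rewrite -lecR -rnormE -normc_cmod [leRHS]mx_normE.
by rewrite -[leLHS]nngE num_le; apply: (le_bigmax _ _ (ord0, i)).
Qed.

Lemma rnorm_rV n (v : 'rV[C]_n) : rnorm v = 0 \/ exists i, rnorm v = cmod (v ord0 i).
Proof.
have [v0|/mx_norm_neq0[[j i] /= vE]] := eqVneq (mx_norm v) 0.
  by left; rewrite /rnorm [`|_|]v0.
by right; exists i; rewrite /rnorm [`|_|]vE (ord1 j) normc_cmod.
Qed.

Lemma rnorm_rV_le n (v : 'rV[C]_n) (d : R) : 0 <= d ->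
  (forall i, cmod (v ord0 i) <= d) -> rnorm v <= d.
Proof. by move=> d0 h; have [->//|[i ->]] := rnorm_rV v. Qed.

Lemma rnorm_rV_lt n (v : 'rV[C]_n) (d : R) : 0 < d ->
  (forall i, cmod (v ord0 i) < d) -> rnorm v < d.
Proof. by move=> d0 h; have [->//|[i ->]] := rnorm_rV v. Qed.

Lemma continuous_rV_eps n (f : 'rV[C]_n -> C) z : differentiable f z ->
  forall e : R, 0 < e -> exists2 d : R, 0 < d & forall w : 'rV[C]_n,
    (forall i, cmod (w ord0 i - z ord0 i) < d) -> cmod (f w - f z) < e.
Proof.
move=> /differentiable_continuous fz e e0.
have /cvg_cmodP/(_ _ e0) := fz.
move=> /nbhs_normP[[a b] /=]; rewrite ltcE /= => /andP[/eqP b0 a0] h.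
exists a => // w wz; rewrite cmodBC; apply: h => /=.
rewrite b0 rnormE ltcR; apply: rnorm_rV_lt => // i.
by rewrite !mxE cmodBC.
Qed.

Lemma continuous1_eps (g : C -> C) z : cdiff g z ->
  forall e : R, 0 < e -> exists2 d : R, 0 < d & forall w,
    cmod (w - z) < d -> cmod (g w - g z) < e.
Proof.
move=> /cdiffP/differentiable_continuous fz e e0.
have /cvg_cmodP/(_ _ e0) := fz.
move=> /nbhs_normP[[a b] /=]; rewrite ltcE /= => /andP[/eqP b0 a0] h.
exists a => // w wz; rewrite cmodBC; apply: h => /=.
by rewrite b0 normc_cmod ltcR cmodBC.
Qed.

Lemma cdiff_cst (c : C) z : cdiff (fun=> c) z.
Proof. by apply/cdiffP; exact: differentiable_cst. Qed.

Lemma cdiff_id z : cdiff (fun w => w) z.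
Proof.
exists 1 => e e0; exists 1 => // w _; rewrite mul1r subrr cmod0.
by rewrite mulr_ge0 ?cmod_ge0 // ltW.
Qed.

Lemma cdiffD (f g : C -> C) z : cdiff f z -> cdiff g z -> cdiff (fun w => f w + g w) z.
Proof. by move=> /cdiffP df /cdiffP dg; apply/cdiffP; exact: differentiableD. Qed.

Lemma cdiffN (f : C -> C) z : cdiff f z -> cdiff (fun w => - f w) z.
Proof. by move=> /cdiffP df; apply/cdiffP; exact: differentiableN. Qed.

Lemma cdiffB (f g : C -> C) z : cdiff f z -> cdiff g z -> cdiff (fun w => f w - g w) z.
Proof. by move=> df /cdiffN; exact: cdiffD. Qed.

Lemma cdiffM (f g : C -> C) z : cdiff f z -> cdiff g z -> cdiff (fun w => f w * g w) z.
Proof. by move=> /cdiffP df /cdiffP dg; apply/cdiffP; exact: differentiableM. Qed.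

Lemma cdiff_comp (f g : C -> C) z : cdiff f z -> cdiff g (f z) -> cdiff (fun w => g (f w)) z.
Proof. by move=> /cdiffP df /cdiffP dg; apply/cdiffP; exact: (differentiable_comp df dg). Qed.

Lemma cdiffV (g : C -> C) z : cdiff g z -> g z != 0 -> cdiff (fun w => (g w)^-1) z.
Proof. by move=> /cdiffP dg gz; apply/cdiffP; exact: (differentiableV dg gz). Qed.

Lemma cdiff_slice n (f : 'rV[C]_n -> C) (a h : 'rV[C]_n) (l : C) :
  differentiable f (a + l *: h) -> cdiff (fun m => f (a + m *: h)) l.
Proof.
move=> df; apply/cdiffP.
by apply: (@differentiable_comp _ _ _ _ (fun l : C => a + l *: h) f).
Qed.

(** Schwarz reflection: the two conjugations cancel, and the derivative is replaced by its
    conjugate. It makes the reflected factor in [slice_cross] holomorphic. *)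
Lemma cdiff_conj (g : C -> C) z : cdiff g z^* -> cdiff (fun w => (g w^*)^*) z.
Proof.
move=> [l h]; exists l^* => e /h[d d0 k]; exists d => // w.
rewrite -[w - z]conjcK -(cmod_conj (_^*)) conjcK rmorphB /= => /k.
by rewrite -[cmod (_ - _ - _)]cmod_conj !rmorphB rmorphM /= !rmorphB /= !conjcK.
Qed.

Definition rcont (u : R -> C) (t : R) : Prop :=
  forall e : R, 0 < e -> exists2 d : R, 0 < d & forall s, `|s - t| < d -> cmod (u s - u t) < e.

Lemma rcontP (u : R -> C) (t : R) : {for t, continuous u} <-> rcont u t.
Proof.
split=> [/cvg_cmodP h e /h /nbhs_normP[d /= d0 k]|h].
  by exists d => // s sd; rewrite cmodBC; apply: k; rewrite /= distrC.
apply/cvg_cmodP => e /h[d d0 k]; apply/nbhs_normP; exists d => //= s sd.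
by rewrite cmodBC; apply: k; rewrite distrC.
Qed.

Lemma rcont_cst (c : C) t : rcont (fun=> c) t.
Proof. by apply/rcontP; exact: cst_continuous. Qed.

Lemma rcontD (u v : R -> C) t : rcont u t -> rcont v t -> rcont (fun s => u s + v s) t.
Proof.
move=> cu cv e e0; have e2 : 0 < e / 2 by rewrite divr_gt0.
have [d d0 hd] := cu _ e2; have [d' d'0 hd'] := cv _ e2.
exists (Num.min d d') => [|s]; first by rewrite lt_min d0.
rewrite lt_min => /andP[/hd hu /hd' hv]; rewrite [ltRHS]splitr.
rewrite (_ : _ + _ - _ = (u s - u t) + (v s - v t)); last by ring.
exact: le_lt_trans (cmodD _ _) (ltrD hu hv).
Qed.

Lemma rcontB (u v : R -> C) t : rcont u t -> rcont v t -> rcont (fun s => u s - v s) t.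
Proof.
move=> cu cv; apply: rcontD => // e /cv[d d0 h]; exists d => // s /h.
by rewrite -opprD cmodN.
Qed.

Lemma rcontM (u v : R -> C) t : rcont u t -> rcont v t -> rcont (fun s => u s * v s) t.
Proof.
move=> /rcontP cu /rcontP cv; apply/rcontP.
exact: (@cvgM _ _ (nbhs t) _ u v _ _ cu cv).
Qed.

Lemma rcontV (u : R -> C) t : rcont u t -> u t != 0 -> rcont (fun s => (u s)^-1) t.
Proof. by move=> /rcontP cu ut; apply/rcontP; exact: (cvgV ut cu). Qed.

Lemma rcont_conj (u : R -> C) t : rcont u t -> rcont (fun s => (u s)^*) t.
Proof.
move=> h e /h[d d0 k]; exists d => // s /k.
by rewrite -rmorphB /= cmod_conj.
Qed.

Lemma rcont_comp (g : C -> C) (u : R -> C) t : cdiff g (u t) -> rcont u t ->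
  rcont (fun s => g (u s)) t.
Proof.
move=> dg cu e e0.
have [d d0 hd] := continuous1_eps dg e0; have [d' d'0 hd'] := cu _ d0.
by exists d' => // s /hd'/hd.
Qed.

End ComplexTopology.

(** * Complex integrals *)

Section ComplexIntegral.
Context d (T : measurableType d) (R : realType).
Variable mu : {measure set T -> \bar R}.
Local Notation C := R[i].
Local Notation Re := complex.Re.
Local Notation Im := complex.Im.
Implicit Types (D : set T) (F G : T -> C).

Definition cint D F : C :=
  (\int[mu]_(x in D) Re (F x)) +i* (\int[mu]_(x in D) Im (F x)).

Definition cmeas D F : Prop :=
  measurable_fun D (fun x => Re (F x)) /\ measurable_fun D (fun x => Im (F x)).

Definition cintegrable D F : Prop :=
  mu.-integrable D (fun x => (Re (F x))%:E) /\ mu.-integrable D (fun x => (Im (F x))%:E).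

Lemma eq_cint D F G : (forall x, D x -> F x = G x) -> cint D F = cint D G.
Proof.
move=> FG; rewrite /cint; congr (_ +i* _); apply: eq_Rintegral => x;
 by rewrite inE => /FG ->.
Qed.

Lemma eq_cintegrable D F G : measurable D -> (forall x, D x -> F x = G x) ->
  cintegrable D F -> cintegrable D G.
Proof.
move=> mD FG [mr mi]; split; [apply: eq_integrable mr|apply: eq_integrable mi] => //;
by move=> x; rewrite inE => /FG ->.
Qed.

Lemma cmeas_cst D (c : C) : cmeas D (fun=> c).
Proof. by split; apply: measurable_cst. Qed.

Lemma cmeasD D F G : cmeas D F -> cmeas D G -> cmeas D (fun x => F x + G x).
Proof.
move=> [fr fi] [gr gi]; split.
  by under eq_fun do rewrite raddfD /=; exact: measurable_funD.
by under eq_fun do rewrite raddfD /=; exact: measurable_funD.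
Qed.

Lemma cmeasN D F : cmeas D F -> cmeas D (fun x => - F x).
Proof.
move=> [fr fi]; split; under eq_fun do rewrite raddfN /=.
  exact: measurableT_comp.
exact: measurableT_comp.
Qed.

Lemma cmeasB D F G : cmeas D F -> cmeas D G -> cmeas D (fun x => F x - G x).
Proof. by move=> mF /cmeasN; exact: cmeasD. Qed.

Lemma cReM (z w : C) : Re (z * w) = Re z * Re w - Im z * Im w.
Proof. by case: z; case: w. Qed.

Lemma cImM (z w : C) : Im (z * w) = Re z * Im w + Im z * Re w.
Proof. by case: z; case: w. Qed.

Lemma Re_conj (z : C) : Re z^* = Re z. Proof. by case: z. Qed.
Lemma Im_conj (z : C) : Im z^* = - Im z. Proof. by case: z. Qed.

Lemma cmeasM D F G : cmeas D F -> cmeas D G -> cmeas D (fun x => F x * G x).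
Proof.
move=> [fr fi] [gr gi]; split.
  under eq_fun do rewrite cReM.
  by apply: measurable_funB; exact: measurable_funM.
under eq_fun do rewrite cImM.
by apply: measurable_funD; exact: measurable_funM.
Qed.

Lemma cmeas_conj D F : cmeas D F -> cmeas D (fun x => (F x)^*).
Proof.
move=> [fr fi]; split.
  by under eq_fun do rewrite Re_conj.
by under eq_fun do rewrite Im_conj; exact: measurableT_comp.
Qed.

Lemma cmeas_cmod2 D F : cmeas D F -> measurable_fun D (fun x => cmod (F x) ^+ 2).
Proof.
move=> [fr fi]; under eq_fun do rewrite cmod_sqr.
by apply: measurable_funD; exact: measurable_funX.
Qed.

Lemma cmeas_cmod D F : cmeas D F -> measurable_fun D (fun x => cmod (F x)).
Proof.
move=> /cmeas_cmod2 h; under eq_fun do rewrite -[cmod _]ger0_norm ?cmod_ge0 // -sqrtr_sqr.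
exact: (measurableT_comp (continuous_measurable_fun (@sqrt_continuous R)) h).
Qed.

Lemma cmeas_prod D I (r : seq I) (F : I -> T -> C) :
  (forall i, cmeas D (F i)) -> cmeas D (fun x => \prod_(i <- r) F i x).
Proof.
move=> h; elim: r => [|i r IH].
  by under eq_fun do rewrite big_nil; exact: cmeas_cst.
by under eq_fun do rewrite big_cons; exact: cmeasM.
Qed.

Lemma cintegrable_cmeas D F : cintegrable D F -> cmeas D F.
Proof. by move=> [/measurable_int/measurable_EFinP ? /measurable_int/measurable_EFinP]. Qed.

Lemma cintegrable_dom D F (g : T -> R) : measurable D -> cmeas D F ->
  mu.-integrable D (fun x => (g x)%:E) -> (forall x, D x -> cmod (F x) <= g x) ->
  cintegrable D F.
Proof.
move=> mD [mr mi] ig Fg; split.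
  apply: (le_integrable mD _ _ ig); first exact/measurable_EFinP.
  move=> x Dx; rewrite /= lee_fin (le_trans (Re_le_cmod _)) // (le_trans (Fg _ Dx)) //.
  exact: ler_norm.
apply: (le_integrable mD _ _ ig); first exact/measurable_EFinP.
move=> x Dx; rewrite /= lee_fin (le_trans (Im_le_cmod _)) // (le_trans (Fg _ Dx)) //.
exact: ler_norm.
Qed.

Lemma cintegrable_bounded D F (B : R) : measurable D -> (mu D < +oo)%E ->
  cmeas D F -> (forall x, D x -> cmod (F x) <= B) -> cintegrable D F.
Proof.
move=> mD fD mF FB; apply: (cintegrable_dom mD mF _ FB).
apply/integrableP; split; first exact: measurable_cst.
by rewrite /= integral_cst // lte_mul_pinfty.
Qed.

Lemma cintegrable_cmod D F : measurable D -> cintegrable D F ->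
  mu.-integrable D (fun x => (cmod (F x))%:E).
Proof.
move=> mD iF; have [ir ii] := iF; have mF := cintegrable_cmeas iF.
apply: (@le_integrable _ _ _ mu D mD _
   (fun x => (`|Re (F x)|%:E + `|Im (F x)|%:E)%E)).
- by apply/measurable_EFinP; exact: cmeas_cmod.
- move=> x Dx; rewrite -EFinD /= lee_fin ger0_norm ?cmod_ge0 //.
  by rewrite (le_trans (cmod_le_ReIm _)) // ler_norm.
by apply: integrableD => //; [exact: (integrable_norm ir)|exact: (integrable_norm ii)].
Qed.

Lemma cintegrableZ D F (c : C) : measurable D -> cintegrable D F ->
  cintegrable D (fun x => c * F x).
Proof.
move=> mD iF; have mF := cintegrable_cmeas iF.
apply: (@cintegrable_dom _ _ (fun x => cmod c * cmod (F x))) => //.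
- by apply: cmeasM => //; exact: cmeas_cst.
- by under eq_fun do rewrite EFinM; apply: integrableZl => //; exact: cintegrable_cmod.
- by move=> x _; rewrite cmodM.
Qed.

Lemma cintegrableN D F : measurable D -> cintegrable D F ->
  cintegrable D (fun x => - F x).
Proof.
move=> mD /(cintegrableZ (-1) mD); apply: eq_cintegrable => // x _.
by rewrite mulN1r.
Qed.

Lemma cintD D F G : measurable D -> cintegrable D F -> cintegrable D G ->
  cint D (fun x => F x + G x) = cint D F + cint D G.
Proof.
move=> mD [fr fi] [gr gi]; rewrite /cint; apply/eqP; rewrite eq_complex /=.
rewrite -!RintegralD //; apply/andP; split; apply/eqP/eq_Rintegral => x _.
  by rewrite raddfD.
by rewrite raddfD.
Qed.

Lemma cintZ D F (c : C) : measurable D -> cintegrable D F ->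
  cint D (fun x => c * F x) = c * cint D F.
Proof.
move=> mD [fr fi]; case: c => a b; rewrite /cint; apply/eqP; rewrite eq_complex /=.
rewrite -!RintegralZl //.
have i1 (r : R) : mu.-integrable D (EFin \o (fun x => r * Re (F x))).
  by rewrite /comp; under eq_fun do rewrite EFinM; exact: integrableZl.
have i2 (r : R) : mu.-integrable D (EFin \o (fun x => r * Im (F x))).
  by rewrite /comp; under eq_fun do rewrite EFinM; exact: integrableZl.
rewrite -RintegralD // -RintegralB //.
by apply/andP; split; apply/eqP/eq_Rintegral => x _; case: (F x).
Qed.

Lemma cintN D F : measurable D -> cintegrable D F ->
  cint D (fun x => - F x) = - cint D F.
Proof.
move=> mD iF; rewrite -mulN1r -cintZ //; apply: eq_cint => x _.
by rewrite mulN1r.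
Qed.

Lemma cintB D F G : measurable D -> cintegrable D F -> cintegrable D G ->
  cint D (fun x => F x - G x) = cint D F - cint D G.
Proof. by move=> mD iF iG; rewrite cintD ?cintN //; exact: cintegrableN. Qed.

Lemma cint_conj D F : measurable D -> cintegrable D F ->
  cint D (fun x => (F x)^*) = (cint D F)^*.
Proof.
move=> mD [fr fi]; rewrite /cint /=; congr (_ +i* _).
  by apply: eq_Rintegral => x _; rewrite Re_conj.
rewrite -mulN1r -RintegralZl //; apply: eq_Rintegral => x _.
by rewrite Im_conj mulN1r.
Qed.

Lemma cint_real D (f : T -> R) : cint D (fun x => (f x)%:C) = (\int[mu]_(x in D) f x)%:C.
Proof. by rewrite /cint /= /Rintegral integral0. Qed.

(** A unimodular constant [w] turns the integral into its modulus; only the real part of [w * F]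
    then contributes, and it is at most the modulus of [F]. *)
Lemma le_cmod_cint_R D F : measurable D -> cintegrable D F ->
  cmod (cint D F) <= \int[mu]_(x in D) cmod (F x).
Proof.
move=> mD iF; set I := cint D F.
have [I0|I0] := eqVneq (cmod I) 0.
  by rewrite I0; apply: Rintegral_ge0 => x _; exact: cmod_ge0.
pose w : C := (cmod I)^-1%:C * I^*.
have wI : w * I = (cmod I)%:C.
  rewrite /w -mulrA [_ * I]mulrC mul_conj_cmod -rmorphM /= expr2 mulrA mulVf //.
  by rewrite mul1r.
have w1 : cmod w = 1.
  by rewrite cmodM cmod_conj cmod_real ger0_norm ?invr_ge0 ?cmod_ge0 // mulVf.
have [iwr _] := cintegrableZ w mD iF.
have E : cint D (fun x => w * F x) = (cmod I)%:C by rewrite cintZ.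
rewrite -[leLHS]/(complex.Re (cmod I)%:C) -E {E}.
apply: le_Rintegral => //; first exact: cintegrable_cmod.
by move=> x _; rewrite -[leRHS]mul1r -w1 -cmodM (le_trans (ler_norm _)) // Re_le_cmod.
Qed.

Lemma le_cmod_cint D F : measurable D -> cintegrable D F ->
  ((cmod (cint D F))%:E <= \int[mu]_(x in D) (cmod (F x))%:E)%E.
Proof.
move=> mD iF; have iN := cintegrable_cmod mD iF.
have fN : (\int[mu]_(x in D) (cmod (F x))%:E)%E \is a fin_num.
  by have := integrable_fin_num mD iN.
by rewrite -[leRHS]fineK // lee_fin; exact: le_cmod_cint_R.
Qed.

Lemma cint_cst D (c : C) : measurable D -> mu D = 1%E -> cint D (fun=> c) = c.
Proof.
by move=> mD D1; rewrite /cint !Rintegral_cst // D1 !mulr1; case: c.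
Qed.

End ComplexIntegral.

(** * Cauchy's theorem *)

Lemma itv_dist (R : realDomainType) (u l x y : R) :
  u <= x <= u + l -> u <= y <= u + l -> `|x - y| <= l.
Proof. rewrite ler_norml; lra. Qed.

Section Bisection.
Variable R : realType.
Implicit Types (s t l p q : R).

(** Goursat's bisection for an arbitrary function of squares. If [mu 0 0 1] were positive, some
    quarter would carry at least a quarter of it at every stage, so [mu >= mu 0 0 1 * l^2] along
    nested squares; this contradicts the smallness hypothesis at their common point. *)
Lemma square_bisection (mu : R -> R -> R -> R) :
  (forall s t l, 0 < l -> 0 <= s -> 0 <= t -> s + l <= 1 -> t + l <= 1 ->
    mu s t l <= mu s t (l / 2) + mu (s + l / 2) t (l / 2) +
      mu s (t + l / 2) (l / 2) + mu (s + l / 2) (t + l / 2) (l / 2)) ->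
  (forall p q e, 0 <= p <= 1 -> 0 <= q <= 1 -> 0 < e ->
    exists2 d : R, 0 < d & forall s t l, 0 < l < d ->
      0 <= s -> 0 <= t -> s + l <= 1 -> t + l <= 1 ->
      s <= p <= s + l -> t <= q <= t + l -> mu s t l <= e * l ^+ 2) ->
  mu 0 0 1 <= 0.
Proof.
move=> split4 small; rewrite leNgt; apply/negP => m0.
pose l k : R := 2^-1 ^+ k.
have l0 k : 0 < l k by rewrite exprn_gt0 // invr_gt0.
have lS k : l k.+1 = l k / 2 by rewrite /l exprSr.
(* Take the first quarter that carries its share [mu 0 0 1 * h ^+ 2]; if three fail, subadditivity
   leaves it to the fourth. *)
pose step k (x : R * R) : R * R :=
  let: (s, t) := x in let h := l k.+1 in let m := mu 0 0 1 * (h ^+ 2) in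
  if m <= mu s t h then (s, t) else if m <= mu (s + h) t h then (s + h, t)
  else if m <= mu s (t + h) h then (s, t + h) else (s + h, t + h).
pose x := fix x k := if k is k'.+1 then step k' (x k') else (0, 0) : R * R.
have xS k : x k.+1 = step k (x k) by [].
have inv k : [/\ 0 <= (x k).1, 0 <= (x k).2, (x k).1 + l k <= 1, (x k).2 + l k <= 1 &
     mu 0 0 1 * (l k ^+ 2) <= mu (x k).1 (x k).2 (l k)].
  elim: k => [|k [a b c d e]].
    by rewrite /= /l expr0 !add0r expr1n mulr1.
  rewrite xS /step; case: (x k) a b c d e => s t /= a b c d e.
  have := split4 _ _ _ (l0 k) a b c d; rewrite -lS.
  have := l0 k.+1; have := lS k; set h := l k.+1; set m := mu 0 0 1 * h ^+ 2 => hE h0 sp.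
  have e4 : 4 * m <= mu s t (l k) by apply: le_trans e; rewrite /m hE; lra.
  case: ifPn => [?|]; first by split => //=; lra.
  rewrite -ltNge => ?; case: ifPn => [?|]; first by split => //=; lra.
  rewrite -ltNge => ?; case: ifPn => [?|]; first by split => //=; lra.
  by rewrite -ltNge => ?; split => /=; lra.
have nest k : (x k).1 <= (x k.+1).1 /\ (x k.+1).1 + l k.+1 <= (x k).1 + l k /\
     (x k).2 <= (x k.+1).2 /\ (x k.+1).2 + l k.+1 <= (x k).2 + l k.
  have := l0 k.+1; have := lS k; rewrite xS /step; case: (x k) => s t /= hE h0.
  by do ![case: ifPn => _] => /=; lra.
have lim (y : nat -> R) : (forall k, y k <= y k.+1 /\ y k.+1 + l k.+1 <= y k + l k) ->
    exists p, forall k, y k <= p <= y k + l k.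
  move=> ny.
  have up k j : y k <= y (k + j)%N.
    by elim: j => [|j IH]; rewrite ?addn0 // addnS (le_trans IH) //; have [] := ny (k + j)%N.
  have dn k j : y (k + j)%N + l (k + j)%N <= y k + l k.
    elim: j => [|j IH]; rewrite ?addn0 // addnS (le_trans _ IH) //.
    by have [] := ny (k + j)%N.
  have cross j k : y j <= y k + l k.
    have [jk|/ltnW kj] := leqP j k.
      by rewrite (le_trans (up j (k - j)%N)) // subnKC // lerDl ltW.
    by rewrite (le_trans _ (dn k (j - k)%N)) // subnKC // lerDl ltW.
  have ne : [set y k | k in [set: nat]] !=set0 by exists (y 0%N); exists 0%N.
  exists (sup [set y k | k in [set: nat]]) => k; apply/andP; split.
    apply: ub_le_sup; last by exists k.
    by exists (y k + l k) => _ [j _ <-].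
  by apply: ge_sup => // _ [j _ <-].
have [p hp] := lim (fun k => (x k).1) (fun k => let: conj a (conj b _) := nest k in conj a b).
have [q hq] := lim (fun k => (x k).2) (fun k => let: conj _ (conj _ c) := nest k in c).
have p01 : 0 <= p <= 1 by have := hp 0%N; rewrite /= /l expr0 add0r.
have q01 : 0 <= q <= 1 by have := hq 0%N; rewrite /= /l expr0 add0r.
(* Half of [mu 0 0 1], so that the upper bound on a small square is strictly below the lower bound
   from [inv]. *)
have e0 : 0 < mu 0 0 1 / 2 by rewrite divr_gt0.
have [d d0 hd] := small p q _ p01 q01 e0.
have [k lk] : exists k, l k < d.
  have : l @ \oo --> (0 : R).
    by apply: cvg_expr; rewrite ger0_norm ?invr_ge0 // invf_lt1 // ltr1n.
  move=> /cvgrPdist_lt/(_ _ d0)[k _ /(_ k (leqnn k))] /=.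
  by rewrite sub0r normrN gtr0_norm // => ?; exists k.
have [a b c f g] := inv k.
have := hd (x k).1 (x k).2 (l k); rewrite l0 lk => /(_ isT a b c f (hp k) (hq k)).
have := exprn_gt0 2 (l0 k); nra.
Qed.

End Bisection.

(** * Complex integrals over segments and the fundamental theorem of calculus *)

Section CurveIntegral.
Variable R : realType.
Local Notation C := R[i].
Local Notation Re := complex.Re.
Local Notation Im := complex.Im.
Implicit Types (a b c : R) (u v : R -> C).

Definition seg_int a b u : C := cint lebesgue_measure `[a, b] u.

Definition seg_cont a b u : Prop := forall t, a <= t <= b -> rcont u t.

Lemma seg_cont_Re a b u : seg_cont a b u ->
  {within `[a, b], continuous (fun t => Re (u t))}.
Proof.
move=> h; apply: continuous_in_subspaceT => t; rewrite inE /= in_itv /= => /h/rcontP.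
exact: cvg_Re.
Qed.

Lemma seg_cont_Im a b u : seg_cont a b u ->
  {within `[a, b], continuous (fun t => Im (u t))}.
Proof.
move=> h; apply: continuous_in_subspaceT => t; rewrite inE /= in_itv /= => /h/rcontP.
exact: cvg_Im.
Qed.

Lemma seg_cintegrable a b u : seg_cont a b u ->
  cintegrable lebesgue_measure `[a, b] u.
Proof.
by move=> h; split; apply: continuous_compact_integrable;
 [exact: segment_compact|exact: seg_cont_Re|exact: segment_compact|exact: seg_cont_Im].
Qed.

Lemma seg_intB a b u v : seg_cont a b u -> seg_cont a b v ->
  seg_int a b (fun t => u t - v t) = seg_int a b u - seg_int a b v.
Proof. by move=> hu hv; apply: cintB => //; exact: seg_cintegrable. Qed.

Lemma seg_intZ a b (k : C) u : seg_cont a b u ->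
  seg_int a b (fun t => k * u t) = k * seg_int a b u.
Proof. by move=> hu; apply: cintZ => //; exact: seg_cintegrable. Qed.

Lemma eq_seg_int a b u v : (forall t, a <= t <= b -> u t = v t) ->
  seg_int a b u = seg_int a b v.
Proof. by move=> h; apply: eq_cint => t /=; rewrite in_itv; exact: h. Qed.

Lemma seg_int_split a b c u : a <= b -> b <= c -> seg_cont a c u ->
  seg_int a c u = seg_int a b u + seg_int b c u.
Proof.
move=> ab bc h; have [ir ii] := seg_cintegrable h.
have E (f : R -> R) : lebesgue_measure.-integrable `[a, c] (EFin \o f) ->
    \int[lebesgue_measure]_(x in `[a, c]) f x =
    \int[lebesgue_measure]_(x in `[a, b]) f x + \int[lebesgue_measure]_(x in `[b, c]) f x.
  move=> iF; apply/eqP; rewrite addrC -subr_eq; apply/eqP.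
  rewrite Rintegral_itvB ?bnd_simp // Rintegral_itv_obnd_cbnd //.
  by apply: integrableS iF => //; apply: subset_itv; rewrite ?bnd_simp.
by rewrite /seg_int /cint !E.
Qed.

Lemma seg_int_le a b u (B : R) : a <= b -> seg_cont a b u ->
  (forall t, a <= t <= b -> cmod (u t) <= B) -> cmod (seg_int a b u) <= B * (b - a).
Proof.
move=> ab h uB; have iu := seg_cintegrable h.
have mI : measurable (`[a, b] : set (measurableTypeR R)) by [].
have := le_cmod_cint_R mI iu; move=> /le_trans; apply.
have <- : \int[lebesgue_measure]_(x in `[a, b]) B = B * (b - a).
  by rewrite Rintegral_cst //= lebesgue_measure_itv /= lte_fin; case: ltgtP ab => // -> _;
    rewrite subrr.
apply: le_Rintegral => //; first exact: cintegrable_cmod.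
  by apply: continuous_compact_integrable;
    [exact: segment_compact|exact/continuous_subspaceT/cst_continuous].
Qed.

Definition cder (U : R -> C) (x : R) (l : C) : Prop :=
  is_derive x 1 (fun t => Re (U t)) (Re l) /\ is_derive x 1 (fun t => Im (U t)) (Im l).

Lemma cder_continuous U x l : cder U x l -> rcont U x.
Proof.
move=> [[dr _] [di _]]; apply/rcontP; apply: (@cvg_complex R R (nbhs x) _).
  have /derivable1_diffP/differentiable_continuous cr := dr; exact: cr.
have /derivable1_diffP/differentiable_continuous ci := di; exact: ci.
Qed.

Lemma cder_eq U x l l' : l = l' -> cder U x l -> cder U x l'.
Proof. by move=> ->. Qed.

Lemma cder_cst (c : C) x : cder (fun=> c) x 0.
Proof. by split; exact: is_derive_cst. Qed.

Lemma cder_id x : cder (fun t => t%:C) x 1.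
Proof. by split; [exact: is_derive_id|exact: is_derive_cst]. Qed.

Lemma cderD U V x l m : cder U x l -> cder V x m -> cder (fun t => U t + V t) x (l + m).
Proof.
move=> [a b] [c d]; split; rewrite raddfD.
  by under eq_fun do rewrite raddfD; exact: is_deriveD.
by under eq_fun do rewrite raddfD; exact: is_deriveD.
Qed.

Lemma cderM U V x l m : cder U x l -> cder V x m ->
  cder (fun t => U t * V t) x (l * V x + U x * m).
Proof.
move=> [a b] [c d]; split.
  rewrite (_ : (fun _ => _) = (fun t => Re (U t)) * (fun t => Re (V t)) - (fun t => Im (U t))
    * (fun t => Im (V t))); last first.
    by apply/funext => t; rewrite cReM.
  apply: (is_derive_eq (is_deriveB (is_deriveM a c) (is_deriveM b d))).
  by clear; move: (U x) (V x) l m => [? ?] [? ?] [? ?] [? ?]; rewrite /GRing.scale /=; ring.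
rewrite (_ : (fun _ => _) = (fun t => Re (U t)) * (fun t => Im (V t)) + (fun t => Im (U t))
  * (fun t => Re (V t))); last first.
  by apply/funext => t; rewrite cImM.
apply: (is_derive_eq (is_deriveD (is_deriveM a d) (is_deriveM b c))).
by clear; move: (U x) (V x) l m => [? ?] [? ?] [? ?] [? ?]; rewrite /GRing.scale /=; ring.
Qed.

Lemma seg_int_ftc a b U u : a < b -> (forall t, a <= t <= b -> cder U t (u t)) ->
  seg_cont a b u -> seg_int a b u = U b - U a.
Proof.
move=> ab dU cu.
have ftc (f g : R -> R) : {within `[a, b], continuous g} ->
    (forall t, a <= t <= b -> is_derive t 1 f (g t)) ->
    \int[lebesgue_measure]_(x in `[a, b]) g x = f b - f a.
  move=> cg df; rewrite /Rintegral (@continuous_FTC2 _ g f a b) //.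
    split.
    - by move=> t; rewrite in_itv /= => /andP[? ?]; have [] := df t ltac:(lra).
    - by apply: cvg_at_right_filter; have [d _] := df a ltac:(lra);
        move/derivable1_diffP/differentiable_continuous : d.
    - by apply: cvg_at_left_filter; have [d _] := df b ltac:(lra);
        move/derivable1_diffP/differentiable_continuous : d.
  move=> t; rewrite in_itv /= => /andP[? ?]; rewrite derive1E.
  by have [_] := df t ltac:(lra).
have E1 := ftc _ _ (seg_cont_Re cu) (fun t h => (dU t h).1).
have E2 := ftc _ _ (seg_cont_Im cu) (fun t h => (dU t h).2).
by rewrite /seg_int /cint E1 E2 -!raddfB; case: (U b - U a).
Qed.

End CurveIntegral.

(** * Goursat's theorem on the image of a square *)

Section Goursat.
Variable R : realType.
Local Notation C := R[i].
Variables (F : C -> C) (H Hs Ht : R -> R -> C) (L : R).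
Hypothesis L0 : 0 < L.
Hypothesis dHs : forall s t, cder (H ^~ t) s (Hs s t).
Hypothesis dHt : forall s t, cder (H s) t (Ht s t).
Hypothesis cHs : forall s t, rcont (Hs ^~ t) s.
Hypothesis cHt : forall s t, rcont (Ht s) t.
Hypothesis bHs : forall s t, 0 <= s <= 1 -> 0 <= t <= 1 -> cmod (Hs s t) <= L.
Hypothesis bHt : forall s t, 0 <= s <= 1 -> 0 <= t <= 1 -> cmod (Ht s t) <= L.
Hypothesis lipH : forall s t s' t', 0 <= s <= 1 -> 0 <= t <= 1 ->
  0 <= s' <= 1 -> 0 <= t' <= 1 -> cmod (H s t - H s' t') <= L * (`|s - s'| + `|t - t'|).
Hypothesis dF : forall s t, 0 <= s <= 1 -> 0 <= t <= 1 -> cdiff F (H s t).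

Let hor G (t a b : R) := seg_int a b (fun s => G (H s t) * Hs s t).
Let ver G (s a b : R) := seg_int a b (fun t => G (H s t) * Ht s t).
(** The contour integral of [G] over the image under [H] of the boundary of the square with lower
    corner [(s, t)] and side [l], run counterclockwise in the parameters. *)
Let bd G s t l := ver G (s + l) t (t + l) - ver G s t (t + l) -
  hor G (t + l) s (s + l) + hor G t s (s + l).

Lemma hor_cont G t a b : (forall s, a <= s <= b -> cdiff G (H s t)) ->
  seg_cont a b (fun s => G (H s t) * Hs s t).
Proof.
move=> h s /h dG; apply: rcontM; last exact: cHs.
apply: (rcont_comp (u := H ^~ t)) => //.
exact: cder_continuous (dHs _ _).
Qed.

Lemma ver_cont G s a b : (forall t, a <= t <= b -> cdiff G (H s t)) ->
  seg_cont a b (fun t => G (H s t) * Ht s t).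
Proof.
move=> h t /h dG; apply: rcontM; last exact: cHt.
apply: (rcont_comp (u := H s)) => //.
exact: cder_continuous (dHt _ _).
Qed.

Lemma bd_split s t l : 0 < l -> 0 <= s -> 0 <= t -> s + l <= 1 -> t + l <= 1 ->
  bd F s t l = bd F s t (l / 2) + bd F (s + l / 2) t (l / 2) +
     bd F s (t + l / 2) (l / 2) + bd F (s + l / 2) (t + l / 2) (l / 2).
Proof.
move=> l0 s0 t0 s1 t1; rewrite /bd.
have E x : x + l / 2 + l / 2 = x + l by rewrite -addrA -splitr.
rewrite !E.
have V x : 0 <= x <= 1 -> ver F x t (t + l) =
    ver F x t (t + l / 2) + ver F x (t + l / 2) (t + l).
  move=> x01; apply: seg_int_split; [lra|lra|].
  by apply: ver_cont => y ?; apply: dF => //; lra.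
have W x : 0 <= x <= 1 -> hor F x s (s + l) =
    hor F x s (s + l / 2) + hor F x (s + l / 2) (s + l).
  move=> x01; apply: seg_int_split; [lra|lra|].
  by apply: hor_cont => y ?; apply: dF => //; lra.
rewrite (V s ltac:(lra)) (V (s + l) ltac:(lra)) (W t ltac:(lra)) (W (t + l) ltac:(lra)).
by ring.
Qed.

(** [P] is a primitive of the affine integrand, so every edge contributes a difference of values of
    [P] at corners and the four differences cancel. *)
Lemma bd_affine (al be z0 : C) s t l : 0 < l ->
  bd (fun z => al + be * (z - z0)) s t l = 0.
Proof.
move=> l0; pose P z := al * z + be / 2 * ((z - z0) * (z - z0)).
have dP (u : R -> C) (x : R) (m : C) : cder u x m ->
    cder (fun t => P (u t)) x ((al + be * (u x - z0)) * m).
  move=> du; have d1 := cderM (cder_cst al x) du.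
  have d2 := cderD du (cder_cst (- z0) x).
  have d3 := cderM (cder_cst (be / 2) x) (cderM d2 d2).
  by apply: cder_eq (cderD d1 d3); field.
have aff (c : C) z : cdiff (fun z => c + be * (z - z0)) z.
  by apply: cdiffD; [exact: cdiff_cst|apply: cdiffM;
    [exact: cdiff_cst|apply: cdiffB; [exact: cdiff_id|exact: cdiff_cst]]].
have dA := aff al.
have V x : ver (fun z => al + be * (z - z0)) x t (t + l) = P (H x (t + l)) - P (H x t).
  rewrite /ver (seg_int_ftc (U := fun t => P (H x t))) //; first by lra.
    by move=> y _; exact: dP.
  exact: (ver_cont (G := fun z => al + be * (z - z0))).
have W x : hor (fun z => al + be * (z - z0)) x s (s + l) = P (H (s + l) x) - P (H s x).
  rewrite /hor (seg_int_ftc (U := fun s => P (H s x))) //; first by lra.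
    by move=> y _; apply: (dP (H ^~ x)).
  exact: (hor_cont (G := fun z => al + be * (z - z0))).
by rewrite /bd !V !W; ring.
Qed.

(** Replacing [F] by its first-order approximation [A] at [H p q] leaves a remainder [E] of size
    [o(|z - z0|)], and the affine part integrates to 0. *)
Lemma bd_small p q e : 0 <= p <= 1 -> 0 <= q <= 1 -> 0 < e ->
    exists2 d : R, 0 < d & forall s t l, 0 < l < d ->
      0 <= s -> 0 <= t -> s + l <= 1 -> t + l <= 1 ->
      s <= p <= s + l -> t <= q <= t + l -> cmod (bd F s t l) <= e * l ^+ 2.
Proof.
move=> p01 q01 e0; have [be hbe] := dF p01 q01.
(* On each of the four edges the remainder is at most [e' * (2 L l)], the speed at most [L] and the
   parameter length [l]: in total [8 L^2 e' l^2]. *)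
have e'0 : 0 < e / (8 * L ^+ 2) by rewrite divr_gt0 // mulr_gt0 // exprn_gt0.
have [d d0 hd] := hbe _ e'0.
exists (d / (2 * L)); first by rewrite divr_gt0 // mulr_gt0.
move=> s t l /andP[l0 ld] s0 t0 s1 t1 ps qt.
have [le0 hl] : 0 <= l /\ forall x : R, x <= x <= x + l /\ x <= x + l <= x + l.
  by split=> [|x]; [exact: ltW|rewrite !lexx lerDl ltW].
have [[ss ss'] [tt tt']] := (hl s, hl t).
have s01 x : s <= x <= s + l -> 0 <= x <= 1.
  by case/andP=> sx xs; rewrite (le_trans s0 sx) (le_trans xs s1).
have t01 x : t <= x <= t + l -> 0 <= x <= 1.
  by case/andP=> tx xt; rewrite (le_trans t0 tx) (le_trans xt t1).
pose z0 := H p q; pose A z := F z0 + be * (z - z0); pose E z := F z - A z.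
have aff (c : C) z : cdiff (fun z => c + be * (z - z0)) z.
  by apply: cdiffD; [exact: cdiff_cst|apply: cdiffM;
    [exact: cdiff_cst|apply: cdiffB; [exact: cdiff_id|exact: cdiff_cst]]].
have dA : forall z, cdiff A z := aff (F z0).
have dE z : cdiff F z -> cdiff E z by move=> dFz; exact: cdiffB.
have bE x y : s <= x <= s + l -> t <= y <= t + l ->
    cmod (E (H x y)) <= e / (4 * L) * l.
  move=> hx hy; have zz : cmod (H x y - z0) <= L * (2 * l).
    apply: le_trans (lipH (s01 _ hx) (t01 _ hy) p01 q01) _.
    rewrite ler_wpM2l ?(ltW L0) // mulrDl mul1r lerD //;
      [exact: itv_dist hx ps|exact: itv_dist hy qt].
  have zd : cmod (H x y - z0) < d.
    apply: le_lt_trans zz _; move: ld;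
      by rewrite ltr_pdivlMr ?mulr_gt0 // mulrCA [L * _]mulrC mulrA [2 * l * _]mulrC.
  have := hd _ zd; rewrite /E /A opprD addrA => /le_trans; apply.
  apply: le_trans (ler_wpM2l (ltW e'0) zz) _.
  by rewrite le_eqVlt; apply/orP; left; apply/eqP; field; rewrite gt_eqF.
have bound : e / (4 * L) * l * L * l = e * l ^+ 2 / 4 by field; rewrite gt_eqF.
have bV x : s <= x <= s + l -> cmod (ver E x t (t + l)) <= e * l ^+ 2 / 4.
  move=> hx; rewrite -bound; apply: le_trans (seg_int_le (B := e / (4 * L) * l * L) _ _ _) _;
    first by rewrite lerDl.
  - by apply: ver_cont => y hy; apply: dE; apply: dF; [exact: s01|exact: t01].
  - move=> y hy; rewrite cmodM ler_pM ?cmod_ge0 ?bE //; apply: bHt; [exact: s01|exact: t01].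
  - by rewrite addrAC subrr add0r.
have bH x : t <= x <= t + l -> cmod (hor E x s (s + l)) <= e * l ^+ 2 / 4.
  move=> hx; rewrite -bound; apply: le_trans (seg_int_le (B := e / (4 * L) * l * L) _ _ _) _;
    first by rewrite lerDl.
  - by apply: hor_cont => y hy; apply: dE; apply: dF; [exact: s01|exact: t01].
  - move=> y hy; rewrite cmodM ler_pM ?cmod_ge0 ?bE //; apply: bHs; [exact: s01|exact: t01].
  - by rewrite addrAC subrr add0r.
have -> : bd F s t l = bd E s t l.
  suff : bd E s t l = bd F s t l - bd A s t l by rewrite bd_affine // subr0.
  have V x : s <= x <= s + l -> ver E x t (t + l) = ver F x t (t + l) - ver A x t (t + l).
    move=> hx; rewrite /ver -seg_intB.
    - by apply: eq_seg_int => y _; rewrite /E mulrBl.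
    - by apply: ver_cont => y hy; apply: dF; [exact: s01|exact: t01].
    - by apply: ver_cont => y ?; exact: dA.
  have W x : t <= x <= t + l -> hor E x s (s + l) = hor F x s (s + l) - hor A x s (s + l).
    move=> hx; rewrite /hor -seg_intB.
    - by apply: eq_seg_int => y _; rewrite /E mulrBl.
    - by apply: hor_cont => y hy; apply: dF; [exact: s01|exact: t01].
    - by apply: hor_cont => y ?; exact: dA.
  rewrite /bd (V s ss) (V (s + l) ss') (W t tt) (W (t + l) tt').
  by ring.
rewrite (_ : e * l ^+ 2 = e * l ^+ 2 / 4 + e * l ^+ 2 / 4 + e * l ^+ 2 / 4 + e * l ^+ 2 / 4);
  last by field.
rewrite /bd.
apply: le_trans (cmodD _ _) _; apply: lerD; last exact: bH.
apply: le_trans (cmodB _ _) _; apply: lerD; last exact: bH.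
apply: le_trans (cmodB _ _) _; apply: lerD; exact: bV.
Qed.

(** The bisection takes place in the parameter square and integrates along its edges, so only first
    partial derivatives of [H] enter. *)
Lemma goursat_homotopy :
  seg_int 0 1 (fun t => F (H 1 t) * Ht 1 t) - seg_int 0 1 (fun t => F (H 0 t) * Ht 0 t) =
  seg_int 0 1 (fun s => F (H s 1) * Hs s 1) - seg_int 0 1 (fun s => F (H s 0) * Hs s 0).
Proof.
have : cmod (bd F 0 0 1) <= 0.
  apply: (square_bisection (mu := fun s t l => cmod (bd F s t l))).
    move=> s t l l0 s0 t0 s1 t1; rewrite bd_split //.
    by do 3 (apply: le_trans (cmodD _ _) _; rewrite lerD2r).
  exact: bd_small.
rewrite le_eqVlt ltNge cmod_ge0 orbF cmod_eq0 /bd /ver /hor !add0r => /eqP h.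
by apply/eqP; rewrite -subr_eq0 -h; apply/eqP; ring.
Qed.

End Goursat.

Section Expi.
Variable R : realType.
Local Notation C := R[i].
Implicit Types (s t : R).

(** The point [exp(2 i pi t)]; the period is 1, in agreement with [torus_point]. *)
Definition expi t : C := cos (2 * pi * t) +i* sin (2 * pi * t).

Lemma expiD s t : expi (s + t) = expi s * expi t.
Proof.
rewrite /expi mulrDr cosD sinD; apply/eqP; rewrite eq_complex /=.
by apply/andP; split; apply/eqP; ring.
Qed.

Lemma expi0 : expi 0 = 1.
Proof. by rewrite /expi mulr0 cos0 sin0. Qed.

Lemma expi1 : expi 1 = 1.
Proof. by rewrite /expi mulr1 mulrC mulr_natr cos2pi sin2pi. Qed.

Lemma expiS t : expi (t + 1) = expi t.
Proof. by rewrite expiD expi1 mulr1. Qed.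

Lemma cmod_expi t : cmod (expi t) = 1.
Proof. by rewrite /= cos2Dsin2 sqrtr1. Qed.

Lemma expi_neq0 t : expi t != 0.
Proof. by rewrite -cmod_eq0 cmod_expi oner_eq0. Qed.

Lemma expi_conj t : (expi t)^* = (expi t)^-1.
Proof.
have e0 := expi_neq0 t; apply: (mulfI e0).
by rewrite mul_conj_cmod cmod_expi expr1n divff.
Qed.

Lemma cder_expi t : cder expi t ((2 * pi)%:C * 'i * expi t).
Proof.
have d : is_derive t 1 (fun t : R => 2 * pi * t) (2 * pi).
  have := @is_deriveZ R R _ (@id R) (2 * pi) t 1 1 (is_derive_id _ _).
  by rewrite /GRing.scale /= mulr1.
have E : (2 * pi)%:C * 'i * expi t =
   (- sin (2 * pi * t) * (2 * pi)) +i* (cos (2 * pi * t) * (2 * pi)).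
  by apply/eqP; rewrite eq_complex /=; apply/andP; split; apply/eqP; ring.
rewrite E; split => /=.
  have := @is_derive1_comp R cos (fun t : R => 2 * pi * t) t _ _ (is_derive_cos _) d.
  by rewrite /comp.
have := @is_derive1_comp R sin (fun t : R => 2 * pi * t) t _ _ (is_derive_sin _) d.
by rewrite /comp.
Qed.

Lemma rcont_expi t : rcont expi t.
Proof. exact: cder_continuous (cder_expi t). Qed.

Lemma cmod_circle (r t : R) : 0 <= r -> cmod (r%:C * expi t) = r.
Proof. by move=> r0; rewrite cmodM cmod_expi mulr1 cmod_real ger0_norm. Qed.

Lemma rcont_circle (c : C) t : rcont (fun t => c * expi t) t.
Proof. by apply: rcontM; [exact: rcont_cst|exact: rcont_expi]. Qed.

Lemma expi_lip s t : cmod (expi s - expi t) <= 2 * pi * `|s - t|.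
Proof.
wlog st : s t / t < s.
  move=> h; case: (ltgtP s t) => [st|st|->]; last by rewrite !subrr normr0 mulr0 cmod0.
    by rewrite cmodBC distrC; exact: h.
  exact: h.
have p0 : 0 <= 2 * pi :> R by rewrite mulr_ge0 // pi_ge0.
rewrite gtr0_norm ?subr_gt0 //.
have c x : rcont (fun t => (2 * pi)%:C * 'i * expi t) x.
  by exact: rcont_circle.
rewrite -(seg_int_ftc (u := fun t => (2 * pi)%:C * 'i * expi t) st).
- apply: seg_int_le; first exact: ltW.
  + by move=> x _; exact: c.
  + move=> x _; rewrite !cmodM cmod_expi cmod_real ger0_norm //= expr0n expr1n add0r sqrtr1.
    by rewrite !mulr1.
- by move=> x _; exact: cder_expi.
- by move=> x _; exact: c.
Qed.

End Expi.

Section Cauchy.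
Variable R : realType.
Local Notation C := R[i].

(** The linear homotopy from the circle of centre [c0] and radius [r0] to that of centre [c0 + c1]
    and radius [r0 + r1]. Its sides at [t = 0] and [t = 1] coincide because [expi] has period 1. The
    factor [2 pi i] of [dz] cancels, which leaves the radius times [expi t]. *)
Lemma circle_homotopy (F : C -> C) (c0 c1 : C) (r0 r1 : R) :
  (forall s t : R, 0 <= s <= 1 -> 0 <= t <= 1 ->
     cdiff F (c0 + s%:C * c1 + (r0 + s * r1)%:C * expi t)) ->
  seg_int 0 1 (fun t => F (c0 + c1 + (r0 + r1)%:C * expi t) * ((r0 + r1)%:C * expi t)) =
  seg_int 0 1 (fun t => F (c0 + r0%:C * expi t) * (r0%:C * expi t)).
Proof.
move=> dF.
pose k : C := (2 * pi)%:C * 'i.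
pose H (s t : R) : C := (c0 + s%:C * c1) + (r0%:C + s%:C * r1%:C) * expi t.
pose Hs (s t : R) : C := c1 + r1%:C * expi t.
pose Ht (s t : R) : C := (r0%:C + s%:C * r1%:C) * (k * expi t).
have rE (s : R) : (r0%:C + s%:C * r1%:C : C) = (r0 + s * r1)%:C by rewrite rmorphD rmorphM.
have dF' s t : 0 <= s <= 1 -> 0 <= t <= 1 -> cdiff F (H s t) by rewrite /H rE; exact: dF.
(* One crude constant for both partial derivatives and for the Lipschitz bound; the summand 1 makes
   it positive. *)
pose L : R := 1 + cmod c1 + (`|r0| + `|r1|) * (1 + 2 * pi).
have p0 : 0 <= 2 * pi :> R by rewrite mulr_ge0 // pi_ge0.
have L0 : 0 < L by rewrite ltr_wpDr ?mulr_ge0 ?addr_ge0 ?cmod_ge0 // ltr_wpDr ?cmod_ge0.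
have dHs s t : cder (H ^~ t) s (Hs s t).
  have d1 := cderM (cder_id s) (cder_cst c1 s).
  have d2 := cderM (cder_id s) (cder_cst r1%:C s).
  have d3 := cderM (cderD (cder_cst r0%:C s) d2) (cder_cst (expi t) s).
  by apply: cder_eq (cderD (cderD (cder_cst c0 s) d1) d3); rewrite /Hs; ring.
have dHt s t : cder (H s) t (Ht s t).
  have d3 := cderM (cder_cst (r0%:C + s%:C * r1%:C) t) (cder_expi t).
  by apply: cder_eq (cderD (cder_cst (c0 + s%:C * c1) t) d3); rewrite /Ht /k; ring.
have cHs s t : rcont (Hs ^~ t) s by exact: rcont_cst.
have cHt s t : rcont (Ht s) t.
  by apply: rcontM; [exact: rcont_cst|exact: rcont_circle].
have ck : cmod k = 2 * pi.
  by rewrite /k cmodM cmod_real ger0_norm //= expr0n expr1n add0r sqrtr1 mulr1.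
have n0 : 0 <= `|r0| by []. have n1 : 0 <= `|r1| by [].
have nc := cmod_ge0 c1.
have bHs s t : 0 <= s <= 1 -> 0 <= t <= 1 -> cmod (Hs s t) <= L.
  move=> _ _; apply: le_trans (cmodD _ _) _; rewrite cmodM cmod_expi cmod_real mulr1 /L; nra.
have bR s : 0 <= s <= 1 -> cmod (r0%:C + s%:C * r1%:C : C) <= `|r0| + `|r1|.
  move=> s01; apply: le_trans (cmodD _ _) _; rewrite cmodM !cmod_real lerD2l.
  by rewrite ger0_norm; nra.
have bHt s t : 0 <= s <= 1 -> 0 <= t <= 1 -> cmod (Ht s t) <= L.
  move=> s01 _; rewrite cmodM cmodM cmod_expi mulr1 ck.
  by apply: le_trans (ler_wpM2r p0 (bR _ s01)) _; rewrite /L; nra.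
have lipH s t s' t' : 0 <= s <= 1 -> 0 <= t <= 1 -> 0 <= s' <= 1 -> 0 <= t' <= 1 ->
   cmod (H s t - H s' t') <= L * (`|s - s'| + `|t - t'|).
  move=> s01 _ _ _.
  have -> : H s t - H s' t' = (s - s')%:C * Hs s t' +
      (r0%:C + s%:C * r1%:C) * (expi t - expi t') by rewrite /H /Hs rmorphB /=; ring.
  apply: le_trans (cmodD _ _) _; rewrite !cmodM mulrDr lerD //.
    rewrite cmod_real mulrC ler_wpM2r //.
    by apply: le_trans (cmodD _ _) _; rewrite cmodM cmod_expi cmod_real mulr1 /L; nra.
  apply: le_trans (ler_pM _ _ (bR _ s01) (expi_lip _ _)) _; rewrite ?cmod_ge0 //.
  by rewrite mulrA ler_wpM2r // /L; nra.
have := goursat_homotopy L0 dHs dHt cHs cHt bHs bHt lipH dF'.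
have -> : seg_int 0 1 (fun s => F (H s 1) * Hs s 1) = seg_int 0 1 (fun s => F (H s 0) * Hs s 0).
  by apply: eq_seg_int => s _; rewrite /H /Hs expi0 expi1.
rewrite subrr => /eqP; rewrite subr_eq0 => /eqP E.
have k0 : k != 0 by rewrite -cmod_eq0 ck mulf_eq0 pnatr_eq0 /= gt_eqF // pi_gt0.
have iF (s : R) : 0 <= s <= 1 -> seg_cont 0 1 (fun t => F (H s t) * ((r0 + s * r1)%:C * expi t)).
  move=> s01 t t01; apply: rcontM; last first.
    by exact: rcont_circle.
  apply: (rcont_comp (u := H s)); first exact: dF'.
  exact: cder_continuous (dHt s t).
have sE s : 0 <= s <= 1 -> seg_int 0 1 (fun t => F (H s t) * Ht s t) =
   k * seg_int 0 1 (fun t => F (H s t) * ((r0 + s * r1)%:C * expi t)).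
  move=> s01; rewrite -seg_intZ; last exact: iF.
  by apply: eq_seg_int => t _; rewrite /Ht rE; ring.
move: E; rewrite !sE ?lexx ?ler01 // => /(mulfI k0).
rewrite mul1r mul0r addr0 => E2.
transitivity (seg_int 0 1 (fun t => F (H 1 t) * ((r0 + r1)%:C * expi t))).
  by apply: eq_seg_int => t _; rewrite /H rE !mul1r.
by rewrite E2; apply: eq_seg_int => t _; rewrite /H !mul0r !addr0.
Qed.

(** [F z / (z - a)] is holomorphic between a small circle about [a] and the given circle about [b],
    so the two integrals agree; the one over the small circle is a mean of [F] near [a]. *)
Lemma cauchy_circle (F : C -> C) (a b : C) (r : R) :
  cmod (a - b) < r -> (forall z, cmod (z - b) <= r -> cdiff F z) ->
  F a = seg_int 0 1 (fun t => F (b + r%:C * expi t) *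
           (r%:C * expi t / (b + r%:C * expi t - a))).
Proof.
move=> ab dF; apply/esym/eqP; rewrite -subr_eq0; apply/eqP/cmod_small => e e0.
have da : cdiff F a by apply: dF; exact: ltW.
have [d d0 hd] := continuous1_eps da e0.
(* [d] comes from continuity of [F] at [a]; the second bound keeps the disc of radius [h] about [a]
   inside the given disc. *)
pose h := Num.min (d / 2) (r - cmod (a - b)).
have h0 : 0 < h by rewrite lt_min divr_gt0 //= subr_gt0.
have hd2 : h < d by rewrite gt_min; apply/orP; left; rewrite ltr_pdivrMr //; lra.
have hr : h + cmod (a - b) <= r.
  by have : h <= r - cmod (a - b); [rewrite ge_min lexx orbT|lra].
have n0 := cmod_ge0 (a - b).
pose G z := F z * (z - a)^-1.
have dG (s t : R) : 0 <= s <= 1 -> 0 <= t <= 1 ->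
   cdiff G (a + s%:C * (b - a) + (h + s * (r - h))%:C * expi t).
  move=> s01 _; set R' := h + s * (r - h).
  (* At time [s] the centre is at distance [s * cmod (a - b)] from [a], less than the radius [R']:
     the pole stays strictly inside. *)
  have R0 : s * cmod (a - b) < R' by rewrite /R'; nra.
  have R'0 : 0 <= R' by apply: le_trans (ltW R0); rewrite mulr_ge0 //; lra.
  have cR : cmod (R'%:C * expi t) = R' by rewrite cmod_circle.
  apply: cdiffM.
    apply: dF; set w := R'%:C * _ in cR *.
    rewrite (_ : _ - b = (1 - s)%:C * (a - b) + w); last by rewrite rmorphB /=; ring.
    apply: le_trans (cmodD _ _) _; rewrite cR cmodM cmod_real ger0_norm; last by lra.
    rewrite /R'; nra.
  apply: cdiffV; first by apply: cdiffB; [exact: cdiff_id|exact: cdiff_cst].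
  rewrite -cmod_gt0; set w := R'%:C * _ in cR *.
  rewrite (_ : _ - a = w - s%:C * (a - b)); last by ring.
  apply: lt_le_trans (cmodB_ge _ _); rewrite cR cmodM cmod_real ger0_norm; lra.
have := @circle_homotopy G a (b - a) h (r - h) dG.
have -> : a + (b - a) = b by ring.
have -> : h + (r - h) = r by ring.
have -> : seg_int 0 1 (fun t => G (b + r%:C * expi t) * (r%:C * expi t)) =
   seg_int 0 1 (fun t => F (b + r%:C * expi t) * (r%:C * expi t / (b + r%:C * expi t - a))).
  by apply: eq_seg_int => t _; rewrite /G; ring.
move=> ->.
have ch t : cmod (h%:C * expi t) = h by rewrite cmod_circle // ltW.
have -> : seg_int 0 1 (fun t => G (a + h%:C * expi t) * (h%:C * expi t)) =
   seg_int 0 1 (fun t => F (a + h%:C * expi t)).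
  apply: eq_seg_int => t _; rewrite /G addrAC subrr add0r -mulrA mulVf ?mulr1 //.
  by rewrite -cmod_gt0 ch.
have cF : seg_cont 0 1 (fun t => F (a + h%:C * expi t)).
  move=> t _; apply: (rcont_comp (u := fun t => a + h%:C * expi t)).
    apply: dF; rewrite (_ : _ - b = (a - b) + h%:C * expi t); last by ring.
    by apply: le_trans (cmodD _ _) _; rewrite ch addrC.
  by apply: rcontD; [exact: rcont_cst|exact: rcont_circle].
have -> : F a = seg_int 0 1 (fun=> F a).
  by rewrite /seg_int cint_cst //= lebesgue_measure_itv /= lte_fin ltr01 sube0.
have cFa : seg_cont 0 1 (fun=> F a) by move=> t _; exact: rcont_cst.
rewrite -seg_intB //.
have -> : e = e * (1 - 0) by rewrite subr0 mulr1.
apply: seg_int_le => //; first by move=> t t01; apply: rcontB; [exact: cF|exact: rcont_cst].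
by move=> t _; apply/ltW/hd; rewrite addrAC subrr add0r ch.
Qed.

Lemma circle_rcont (F : C -> C) (b : C) (r : R) t : 0 <= r ->
  (forall z, cmod (z - b) <= r -> cdiff F z) -> rcont (fun t => F (b + r%:C * expi t)) t.
Proof.
move=> r0 dF; apply: (rcont_comp (u := fun t => b + r%:C * expi t)).
  by apply: dF; rewrite addrAC subrr add0r cmodM cmod_expi cmod_real mulr1 ger0_norm.
by apply: rcontD; [exact: rcont_cst|exact: rcont_circle].
Qed.

(** Cauchy's formula at [b + h] and at [b], with the kernel identity [w / (w - h) - 1 - h / w = h^2
    / (w (w - h))]. The factor 2 comes from [|w - h| >= r / 2]. *)
Lemma cauchy_taylor (F : C -> C) (b : C) (r B : R) : 0 < r ->
  (forall z, cmod (z - b) <= r -> cdiff F z) ->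
  (forall z, cmod (z - b) <= r -> cmod (F z) <= B) ->
  exists2 l : C, cmod l <= B / r & forall h, cmod h <= r / 2 ->
    cmod (F (b + h) - F b - l * h) <= 2 * B / r ^+ 2 * cmod h ^+ 2.
Proof.
move=> r0 dF bF; have r0' := ltW r0.
have ce t : cmod (r%:C * expi t) = r by rewrite cmod_circle // ltW.
have ne t : r%:C * expi t != 0 by rewrite -cmod_gt0 ce.
have cE t : rcont (fun t => r%:C * expi t) t.
  by exact: rcont_circle.
have cF t : rcont (fun t => F (b + r%:C * expi t)) t by exact: circle_rcont.
have bF' t : cmod (F (b + r%:C * expi t)) <= B.
  by apply: bF; rewrite addrAC subrr add0r ce.
have B0 : 0 <= B by apply: le_trans (bF' 0); exact: cmod_ge0.
have cl t : rcont (fun t => F (b + r%:C * expi t) * (r%:C * expi t)^-1) t.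
  by apply: rcontM => //; exact: rcontV.
exists (seg_int 0 1 (fun t => F (b + r%:C * expi t) * (r%:C * expi t)^-1)).
  rewrite -[leRHS]mulr1 -[X in _ * X](subr0 1); apply: seg_int_le => // t _.
  by rewrite cmodM cmodV ce ler_wpM2r // invr_ge0.
move=> h hr; have h0 := cmod_ge0 h.
have nh t : r / 2 <= cmod (r%:C * expi t - h).
  by apply: le_trans (cmodB_ge _ _); rewrite ce; lra.
have neh t : r%:C * expi t - h != 0.
  by rewrite -cmod_gt0; apply: lt_le_trans (nh t); rewrite divr_gt0.
have E1 := @cauchy_circle F (b + h) b r.
rewrite {}E1 => //; last by rewrite addrAC subrr add0r; lra.
have E2 := @cauchy_circle F b b r.
rewrite {1}E2 => //; last by rewrite subrr cmod0.
have c1 t : rcont (fun t => F (b + r%:C * expi t)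
  * (r%:C * expi t / (b + r%:C * expi t - (b + h)))) t.
  apply: rcontM => //; apply: rcontM => //; apply: rcontV.
    apply: rcontB; last exact: rcont_cst.
    by apply: rcontD => //; exact: rcont_cst.
  by rewrite (_ : _ - _ = r%:C * expi t - h) //; ring.
have c2 t : rcont (fun t => F (b + r%:C * expi t) * (r%:C * expi t / (b + r%:C * expi t - b))) t.
  apply: rcontM => //; apply: rcontM => //; apply: rcontV.
    apply: rcontB; last exact: rcont_cst.
    by apply: rcontD => //; exact: rcont_cst.
  by rewrite (_ : _ - _ = r%:C * expi t) //; ring.
have c3 t : rcont (fun t => h * (F (b + r%:C * expi t) * (r%:C * expi t)^-1)) t.
  by apply: rcontM => //; exact: rcont_cst.
rewrite [_ * h]mulrC -seg_intZ // -seg_intB // -seg_intB //; last first.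
  by move=> t _; apply: rcontB.
rewrite -[leRHS]mulr1 -[X in _ * X](subr0 1); apply: seg_int_le => //.
  by move=> t _; apply: rcontB => //; apply: rcontB.
move=> t _.
have -> : F (b + r%:C * expi t) * (r%:C * expi t / (b + r%:C * expi t - (b + h))) -
   F (b + r%:C * expi t) * (r%:C * expi t / (b + r%:C * expi t - b)) -
   h * (F (b + r%:C * expi t) * (r%:C * expi t)^-1) =
   F (b + r%:C * expi t) * (h * h) * ((r%:C * expi t)^-1 * (r%:C * expi t - h)^-1).
  have -> : b + r%:C * expi t - (b + h) = r%:C * expi t - h by ring.
  have -> : b + r%:C * expi t - b = r%:C * expi t by ring.
  by move: (ne t) (neh t); set w := r%:C * expi t => w0 wh; field; rewrite ?w0 ?wh.
rewrite !cmodM !cmodV ce -expr2.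
have -> : 2 * B / r ^+ 2 * cmod h ^+ 2 = B * cmod h ^+ 2 * (r^-1 * (r / 2)^-1).
  by field; rewrite gt_eqF.
apply: ler_pM; rewrite ?mulr_ge0 ?invr_ge0 ?exprn_ge0 ?cmod_ge0 //.
  by rewrite ler_wpM2r // exprn_ge0.
rewrite ler_wpM2l ?invr_ge0 // lef_pV2 // posrE ?divr_gt0 //.
by apply: lt_le_trans (nh t); rewrite divr_gt0.
Qed.

(** Cauchy's formula for [G z = F z / (r^2 - conj(a) z)], which has no pole in the closed disc. On
    the circle [r^2 - conj(a) z = z conj(z - a)], so the Cauchy kernel times this denominator's
    inverse is [1 / |z - a|^2]. *)
Lemma poisson_circle (F : C -> C) (a : C) (r : R) :
  cmod a < r -> (forall z, cmod z <= r -> cdiff F z) ->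
  F a = seg_int 0 1 (fun t => ((r ^+ 2 - cmod a ^+ 2) / cmod (r%:C * expi t - a) ^+ 2)%:C *
     F (r%:C * expi t)).
Proof.
move=> ar dF; have a0 := cmod_ge0 a.
have r0 : 0 < r by apply: le_lt_trans ar.
have nz z : cmod z <= r -> (r ^+ 2)%:C - a^* * z != 0.
  move=> zr; rewrite -cmod_gt0; apply: lt_le_trans (cmodB_ge _ _).
  rewrite cmod_real cmodM cmod_conj ger0_norm ?exprn_ge0 ?ltW // subr_gt0.
  by have := cmod_ge0 z; nra.
pose G z := F z * ((r ^+ 2)%:C - a^* * z)^-1.
have dG z : cmod (z - 0) <= r -> cdiff G z.
  rewrite subr0 => zr; apply: cdiffM; first exact: dF.
  apply: cdiffV; last exact: nz.
  apply: cdiffB; first exact: cdiff_cst.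
  by apply: cdiffM; [exact: cdiff_cst|exact: cdiff_id].
have ar' : cmod (a - 0) < r by rewrite subr0.
have aE : (r ^+ 2)%:C - a^* * a = (r ^+ 2 - cmod a ^+ 2)%:C.
  by rewrite mulrC mul_conj_cmod rmorphB.
have := cauchy_circle ar' dG; rewrite {1}/G aE => E.
have d0 : (r ^+ 2 - cmod a ^+ 2)%:C != 0 :> C by rewrite -aE; apply: nz; exact: ltW.
have -> : F a = (r ^+ 2 - cmod a ^+ 2)%:C * (F a * ((r ^+ 2 - cmod a ^+ 2)%:C)^-1).
  by rewrite mulrCA divff // mulr1.
have ce t : cmod (r%:C * expi t) = r by rewrite cmod_circle // ltW.
have ea t : r%:C * expi t - a != 0.
  by rewrite -cmod_gt0; apply: lt_le_trans (cmodB_ge _ _); rewrite ce subr_gt0.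
rewrite E -seg_intZ.
  apply: eq_seg_int => t _; rewrite /G !add0r.
  have nE : r%:C * expi t != 0 by rewrite -cmod_gt0 ce.
  pose v : C := (r%:C * expi t - a)^*.
  have v0 : v != 0 by rewrite -cmod_gt0 cmod_conj cmod_gt0.
  have -> : (r ^+ 2)%:C - a^* * (r%:C * expi t) = r%:C * expi t * v.
    by rewrite /v rmorphB /= mulrBr mul_conj_cmod ce [_ * a^*]mulrC.
  have -> : ((r ^+ 2 - cmod a ^+ 2) / cmod (r%:C * expi t - a) ^+ 2)%:C =
     (r ^+ 2 - cmod a ^+ 2)%:C * ((r%:C * expi t - a) * v)^-1.
    by rewrite mul_conj_cmod rmorphM /= fmorphV.
  clearbody v; move: (ea t) nE; set w := r%:C * expi t => wa w0; clearbody w.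
  by field; rewrite ?wa ?w0 ?v0.
move=> t _; apply: rcontM.
  by apply: (circle_rcont (F := G)) => //; exact: ltW.
have cE : rcont (fun t => r%:C * expi t) t.
  by exact: rcont_circle.
apply: rcontM => //; apply: rcontV; last by rewrite add0r.
apply: rcontB; last exact: rcont_cst.
by apply: rcontD => //; exact: rcont_cst.
Qed.

End Cauchy.

(** * Limits of holomorphic functions *)

Section ComplexLimits.
Variables (R : realType) (T : Type).
Local Notation C := R[i].
Implicit Types (F : set_system T) (u v : T -> C).

Definition ccvg F u (l : C) : Prop :=
  forall e : R, 0 < e -> \forall x \near F, cmod (u x - l) < e.

Lemma ccvgP F {FF : Filter F} u l : u @ F --> l <-> ccvg F u l.
Proof.
split=> [/cvg_cmodP h e /h|h]; first by apply: filterS => x; rewrite cmodBC.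
by apply/cvg_cmodP => e /h; apply: filterS => x; rewrite cmodBC.
Qed.

Lemma ccvg_cst F {FF : Filter F} (c : C) : ccvg F (fun=> c) c.
Proof. by move=> e e0; apply: nearW => x; rewrite subrr cmod0. Qed.

Lemma ccvgD F {FF : Filter F} u v l m : ccvg F u l -> ccvg F v m ->
  ccvg F (fun x => u x + v x) (l + m).
Proof.
move=> hu hv e e0; have e2 : 0 < e / 2 by rewrite divr_gt0.
apply: filterS2 (hu _ e2) (hv _ e2) => x ux vx; rewrite [ltRHS]splitr.
rewrite (_ : _ + _ - _ = (u x - l) + (v x - m)); last by ring.
exact: le_lt_trans (cmodD _ _) (ltrD ux vx).
Qed.

Lemma ccvgM F {FF : Filter F} u v l m : ccvg F u l -> ccvg F v m ->
  ccvg F (fun x => u x * v x) (l * m).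
Proof.
move=> /ccvgP cu /ccvgP cv; apply/ccvgP.
exact: (@cvgM _ _ F _ u v _ _ cu cv).
Qed.

Lemma ccvgN F {FF : Filter F} u l : ccvg F u l -> ccvg F (fun x => - u x) (- l).
Proof. by move=> h e /h; apply: filterS => x; rewrite -opprD cmodN. Qed.

Lemma ccvgB F {FF : Filter F} u v l m : ccvg F u l -> ccvg F v m ->
  ccvg F (fun x => u x - v x) (l - m).
Proof. by move=> hu /ccvgN; exact: ccvgD. Qed.

Lemma ccvg_sum F {FF : Filter F} I (r : seq I) (u : I -> T -> C) (l : I -> C) :
  (forall i, ccvg F (u i) (l i)) ->
  ccvg F (fun x => \sum_(i <- r) u i x) (\sum_(i <- r) l i).
Proof.
move=> h; elim: r => [|i r IH].
  by under [X in ccvg _ X]eq_fun do rewrite big_nil; rewrite big_nil; exact: ccvg_cst.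
by under [X in ccvg _ X]eq_fun do rewrite big_cons; rewrite big_cons; exact: ccvgD.
Qed.

Lemma ccvg_le F {FF : ProperFilter F} u l (B : R) : ccvg F u l ->
  (\forall x \near F, cmod (u x) <= B) -> cmod l <= B.
Proof.
move=> h hB; apply/ler_addgt0Pl => e /h h'.
have [x [uB ux]] := filter_ex (filterI hB h').
have := cmodB (u x) (u x - l); rewrite subKr => /le_trans; apply.
by rewrite addrC lerD // ltW.
Qed.

Lemma ccvg_unique F {FF : ProperFilter F} u l m : ccvg F u l -> ccvg F u m -> l = m.
Proof.
move=> hl hm; have h : ccvg F (fun x => u x - u x) (l - m) by exact: ccvgB.
have k : cmod (l - m) <= 0.
  by apply: (ccvg_le h); apply: nearW => x; rewrite subrr cmod0.
by apply/eqP; rewrite -subr_eq0 -cmod_eq0 eq_le k cmod_ge0.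
Qed.

(** Real and imaginary parts push the ultrafilter into a compact segment, where a cluster point of
    an ultrafilter is a limit. *)
Lemma ultra_ccvg F u (B : R) : UltraFilter F -> (forall x, cmod (u x) <= B) ->
  exists l, ccvg F u l.
Proof.
move=> UF uB.
have PF := @ultra_proper _ _ UF.
have bnd (w : T -> R) : (forall x, `|w x| <= B) -> exists l : R, w @ F --> l.
  move=> wB; have wF : (w @ F) `[- B, B]%classic.
    by apply: nearW => x; rewrite /= in_itv /= -ler_norml.
  have [l [_ cl]] := @segment_compact R (- B) B (w @ F) _ wF.
  exists l => A nA; have [//|nFA] := in_ultra_setVsetC (w @^-1` A) UF.
  by have [x [? ?]] := cl (~` A) A nFA nA.
have [a ha] := bnd (fun x => complex.Re (u x)) (fun x => le_trans (Re_le_cmod _) (uB x)).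
have [b hb] := bnd (fun x => complex.Im (u x)) (fun x => le_trans (Im_le_cmod _) (uB x)).
by exists (a +i* b); apply/(@ccvgP F); apply: (@cvg_complex R T F).
Qed.

End ComplexLimits.

Section HolomorphicTaylor.
Variables (R : realType) (n : nat).
Local Notation C := R[i].
Implicit Types (f : 'rV[C]_n -> C) (z v : 'rV[C]_n).

(* Second-order Taylor estimate, with constants depending only on a local bound of [f]. *)
Lemma holomorphic_taylor f z (d B : R) : 0 < d ->
  (forall w, rnorm (w - z) <= d -> differentiable f w /\ cmod (f w) <= B) ->
  exists L : {linear 'rV[C]_n -> C}, forall v,
    cmod (L v) <= B / d * rnorm v /\
    (rnorm v <= d / 2 -> cmod (f (z + v) - f z - L v) <= 2 * B / d ^+ 2 * rnorm v ^+ 2).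
Proof.
move=> d0 h.
have dz : differentiable f z by apply: (h z _).1; rewrite subrr rnorm0 ltW.
have [L cL hL] := (diff_epsP f z).1 dz.
have B0 : 0 <= B.
  by apply: le_trans (cmod_ge0 _) (h z _).2; rewrite subrr rnorm0 ltW.
exists L => v; have [v0|v0] := eqVneq v 0.
  rewrite v0 linear0 addr0 subrr subr0 cmod0 rnorm0.
  by rewrite expr0n !mulr0.
have m0 : 0 < rnorm v by rewrite -ltcR -rnormE normr_gt0.
(* On the complex line through [z] in the direction [v] the hypotheses hold on a disc of radius
   [d / rnorm v]. *)
pose g l := f (z + l *: v).
have gP (l : C) : cmod (l - 0) <= d / rnorm v -> cdiff g l /\ cmod (g l) <= B.
  rewrite subr0 ler_pdivlMr // => ld.
  have /h[dw bw] : rnorm (z + l *: v - z) <= d by rewrite addrAC subrr add0r rnormZ.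
  by split=> //; exact: cdiff_slice.
have dm : 0 < d / rnorm v by rewrite divr_gt0.
have [l bl hl] := cauchy_taylor dm (fun l h => (gP l h).1) (fun l h => (gP l h).2).
(* Both numbers are the derivative of the slice at 0. They are compared at a real increment [x] in
   the range of both expansions and so small that the quadratic error is at most [e / 2 * x]. *)
have lL : l = L v.
  apply/eqP; rewrite -subr_eq0; apply/eqP/cmod_small => e e0.
  have e1 : 0 < e / (2 * rnorm v) by rewrite divr_gt0 // mulr_gt0.
  have [d1 d10 k] := hL _ e1.
  pose K : R := 2 * B / (d / rnorm v) ^+ 2 + 1.
  have K0 : 0 < K.
    by rewrite ltr_wpDl //; apply: divr_ge0; [exact: mulr_ge0|apply: exprn_ge0; exact: ltW].
  pose x : R := Num.min (d1 / (2 * rnorm v)) (Num.min (d / rnorm v / 2) (e / (2 * K))).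
  have x0 : 0 < x.
    rewrite !lt_min; apply/and3P; split; rewrite divr_gt0 // ?mulr_gt0 //.
  have x1 : x <= d1 / (2 * rnorm v) by rewrite ge_min lexx.
  have x2 : x <= d / rnorm v / 2 by rewrite !ge_min lexx orbT.
  have x3 : x <= e / (2 * K) by rewrite !ge_min lexx !orbT.
  have cx : cmod x%:C = x by rewrite cmod_real gtr0_norm.
  have := hl x%:C; rewrite cx => /(_ x2); rewrite add0r /g scale0r addr0 => k1.
  have xd : rnorm (x%:C *: v) < d1.
    rewrite rnormZ cx; apply: le_lt_trans (ler_wpM2r (ltW m0) x1) _.
    rewrite invfM mulrA mulfVK ?gt_eqF //; lra.
  have := k _ xd; rewrite rnorm_cmod rnormZ cx linearZ /= [_ + z]addrC => k2.
  have : cmod ((l - L v) * x%:C) <= e * x.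
    have -> : (l - L v) * x%:C = (f (z + x%:C *: v) - f z - x%:C * L v) -
       (f (z + x%:C *: v) - f z - l * x%:C) by ring.
    apply: le_trans (cmodB _ _) _.
    have -> : e * x = e / (2 * rnorm v) * (x * rnorm v) + e / 2 * x by field; rewrite gt_eqF.
    apply: lerD; first exact: k2.
    apply: le_trans k1 _; move: x3; rewrite ler_pdivlMr ?mulr_gt0 // /K.
    set k' := 2 * B / _; rewrite expr2 => x3; nra.
  by rewrite cmodM cx ler_pM2r.
split.
  by move: bl; rewrite lL invfM invrK mulrA.
move=> vd; have := hl 1; rewrite cmod1 add0r /g scale1r scale0r addr0 mulr1 lL.
have -> : 2 * B / (d / rnorm v) ^+ 2 * 1 ^+ 2 = 2 * B / d ^+ 2 * rnorm v ^+ 2.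
  by field; rewrite ?gt_eqF.
by apply; rewrite mulrAC ler_pdivlMr // mul1r.
Qed.

End HolomorphicTaylor.

(** * Ultralimits of locally bounded families *)

Section Ultralimit.
Variables (R : realType) (n : nat) (I : Type) (U : set_system I).
Hypothesis UU : UltraFilter U.
Local Notation C := R[i].

Lemma polydisc_rnorm (z : 'rV[C]_n) : polydisc z -> rnorm z < 1.
Proof. exact: rnorm_rV_lt. Qed.

Lemma rnorm_polydisc (z : 'rV[C]_n) : rnorm z < 1 -> polydisc z.
Proof. by move=> h i; apply: le_lt_trans h; exact: coord_le_rnorm. Qed.

(** Replaces Montel's theorem. The constants of the Taylor estimate do not depend on [i], so the
    estimate passes to the limit together with the linear parts [L i], and the limit of the latter
    is the differential. *)
Lemma ultralimit_holomorphic (F : I -> 'rV[C]_n -> C) :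
  (forall i, holomorphic (F i)) ->
  (forall r : R, r < 1 -> exists B, forall i z, rnorm z <= r -> cmod (F i z) <= B) ->
  exists2 f, holomorphic f & forall z, polydisc z -> ccvg U (F ^~ z) (f z).
Proof.
move=> hF bF; have PU := @ultra_proper _ _ UU.
have ex z : exists l, polydisc z -> ccvg U (F ^~ z) l.
  have [zD|] := pselect (polydisc z); last by move=> nz; exists 0.
  have [B hB] := bF _ (polydisc_rnorm zD).
  by have [l hl] := ultra_ccvg UU (fun i => hB i z (lexx _)); exists l.
have [f hf] := choice ex; exists f => // z zD.
have zn := polydisc_rnorm zD.
(* Half the distance to the boundary, so that the uniform bound is available on the ball of radius
   [d] about [z]. *)
pose d := (1 - rnorm z) / 2; have d0 : 0 < d by rewrite divr_gt0 // subr_gt0.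
have [B hB] := bF (rnorm z + d) ltac:(by rewrite /d; lra).
have near w : rnorm (w - z) <= d -> rnorm w <= rnorm z + d.
  by move=> wd; rewrite -[w](subrK z) addrC; apply: le_trans (rnormD _ _) _; rewrite lerD2l.
have inD w : rnorm (w - z) <= d -> polydisc w.
  by move=> /near wd; apply: rnorm_polydisc; rewrite /d in wd *; lra.
have T i := @holomorphic_taylor R n (F i) z d B d0
  (fun w wd => conj (hF i w (inD _ wd)) (hB i w (near _ wd))).
have [L hL] := choice T.
have exL v : exists l, ccvg U (fun i => L i v) l.
  exact: (ultra_ccvg UU (fun i => (hL i v).1)).
have [l hl] := choice exL.
have l_lin : linear l.
  move=> c u v; apply: (ccvg_unique (hl _)).
  have h : ccvg U (fun i => c * L i u + L i v) (c * l u + l v).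
    by apply: ccvgD; [apply: ccvgM; [exact: ccvg_cst|exact: hl]|exact: hl].
  by move=> e /h; apply: filterS => i; rewrite linearP.
pose lL : {linear 'rV[C]_n -> C} := HB.pack l (GRing.isLinear.Build _ _ _ _ l l_lin).
have lB v : cmod (l v) <= B / d * rnorm v.
  by apply: ccvg_le (hl v) _; apply: nearW => i; exact: (hL i v).1.
have [i0 _] := filter_ex (filterT : U setT).
have B0 : 0 <= B by apply: le_trans (cmod_ge0 _) (hB i0 z _); rewrite lerDl ltW.
apply/diff_epsP; exists lL.
  by apply: (@linear_le_continuous _ _ _ _ (B / d)) => v; rewrite rnorm_cmod; exact: lB.
(* The first bound is the range of the Taylor estimate, the second turns its quadratic right-hand
   side into [e * rnorm v]. *)
move=> e e0; exists (Num.min (d / 2) (e / (2 * B / d ^+ 2 + 1))).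
  rewrite lt_min divr_gt0 //= divr_gt0 // ltr_wpDl //.
  by apply: divr_ge0; [exact: mulr_ge0|apply: exprn_ge0; exact: ltW].
move=> v; rewrite lt_min rnorm_cmod => /andP[/ltW v1 /ltW v2].
have v0 := rnorm_ge0 v.
have zv : polydisc (z + v) by apply: inD; rewrite addrAC subrr add0r; lra.
apply: le_trans (_ : 2 * B / d ^+ 2 * rnorm v ^+ 2 <= _).
  rewrite [v + z]addrC.
  have h : ccvg U (fun i => F i (z + v) - F i z - L i v) (f (z + v) - f z - l v).
    by apply: ccvgB; [apply: ccvgB; exact: hf|exact: hl].
  apply: (ccvg_le h).
  by apply: nearW => i; exact: (hL i v).2.
have K0 : 0 <= 2 * B / d ^+ 2 by apply: divr_ge0; [exact: mulr_ge0|apply: exprn_ge0; exact: ltW].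
move: v2; rewrite ler_pdivlMr; last by lra.
move: K0; set k' := 2 * B / _; rewrite expr2 => K0 v2; nra.
Qed.

End Ultralimit.

(** * Square-integrable functions *)

Section SquareIntegrable.
Context d (T : measurableType d) (R : realType) (mu : {measure set T -> \bar R}).
Variables (D : set T) (mD : measurable D).
Local Notation C := R[i].
Implicit Types u v w : T -> C.

Definition sqint u : Prop :=
  cmeas D u /\ (\int[mu]_(x in D) (cmod (u x) ^+ 2)%:E < +oo)%E.

(** For traces of a function space this unfolds to [inner]. *)
Definition iprod u v : C := cint mu D (fun x => u x * (v x)^*).

Definition normsq u : R := \int[mu]_(x in D) (cmod (u x) ^+ 2).

Lemma normsq_ge0 u : 0 <= normsq u.
Proof. by apply: Rintegral_ge0 => x _; rewrite exprn_ge0 ?cmod_ge0. Qed.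

Lemma sqint_integrable u : sqint u -> mu.-integrable D (fun x => (cmod (u x) ^+ 2)%:E).
Proof.
move=> [mu2 fu]; apply/integrableP; split.
  by apply/measurable_EFinP; exact: cmeas_cmod2.
by under eq_integral do rewrite abse_EFin ger0_norm ?exprn_ge0 ?cmod_ge0 //.
Qed.

Lemma normsqE u : sqint u -> (\int[mu]_(x in D) (cmod (u x) ^+ 2)%:E = (normsq u)%:E)%E.
Proof.
move=> [_ fu]; rewrite /normsq /Rintegral fineK // ge0_fin_numE //.
by apply: integral_ge0 => x _; rewrite lee_fin exprn_ge0 ?cmod_ge0.
Qed.

Lemma sqint_dom u (g : T -> R) : cmeas D u -> mu.-integrable D (EFin \o g) ->
  (forall x, D x -> cmod (u x) ^+ 2 <= g x) -> sqint u.
Proof.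
move=> mu2 ig ug; split=> //; have mg := measurable_int _ ig.
have /integrableP[_ fg] := ig; apply: le_lt_trans fg; apply: ge0_le_integral => //.
- by move=> x _; rewrite lee_fin exprn_ge0 ?cmod_ge0.
- by apply/measurable_EFinP; exact: cmeas_cmod2.
- exact: (measurableT_comp (@abse_measurable R setT) mg).
by move=> x Dx /=; rewrite lee_fin; apply: le_trans (ug _ Dx) (ler_norm _).
Qed.

Lemma cintegrable_iprod u v : sqint u -> sqint v -> cintegrable mu D (fun x => u x * (v x)^*).
Proof.
move=> hu hv; have [mu2 _] := hu; have [mv2 _] := hv.
apply: (@cintegrable_dom _ _ _ _ _ _ (fun x => cmod (u x) ^+ 2 + cmod (v x) ^+ 2)) => //.
- by apply: cmeasM => //; exact: cmeas_conj.
- by under eq_fun do rewrite EFinD; apply: integrableD => //; exact: sqint_integrable.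
- move=> x _; rewrite cmodM cmod_conj; have := cmod_ge0 (u x); have := cmod_ge0 (v x).
  by set a := cmod _; set b := cmod _ => a0 b0; nra.
Qed.

Lemma cmod2_lin (x y c : C) : cmod (x + c * y) ^+ 2 =
  cmod x ^+ 2 + 2 * complex.Re (c * (y * x^*)) + cmod c ^+ 2 * cmod y ^+ 2.
Proof. by case: x => a b; case: y => e f; case: c => g h; rewrite !cmod_sqr /=; ring. Qed.

Lemma sqint_lin u v (c : C) : sqint u -> sqint v -> sqint (fun x => u x + c * v x).
Proof.
move=> hu hv; have [mu2 _] := hu; have [mv2 _] := hv.
apply: (@sqint_dom _ (fun x => 2 * cmod (u x) ^+ 2 + 2 * cmod c ^+ 2 * cmod (v x) ^+ 2)).
- by apply: cmeasD => //; apply: cmeasM => //; exact: cmeas_cst.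
- rewrite /comp; under eq_fun do rewrite EFinD !EFinM.
  apply: integrableD => //.
    by apply: integrableZl => //; exact: sqint_integrable.
  by under eq_fun do rewrite -EFinM; apply: integrableZl => //; exact: sqint_integrable.
move=> x _; have := cmodD (u x) (c * v x); rewrite cmodM.
have := cmod_ge0 (u x + c * v x); move: (cmod (u x + _)) (cmod (u x)) (cmod c) (cmod (v x))
  => s a b e s0 h.
have : s ^+ 2 <= (a + b * e) ^+ 2 by rewrite ler_pXn2r // nnegrE // (le_trans s0).
have := sqr_ge0 (a - b * e); rewrite -!mulrA; nra.
Qed.

Lemma sqintD u v : sqint u -> sqint v -> sqint (fun x => u x + v x).
Proof.
by move=> hu hv; have := sqint_lin 1 hu hv; under eq_fun do rewrite mul1r.
Qed.

Lemma sqintB u v : sqint u -> sqint v -> sqint (fun x => u x - v x).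
Proof.
by move=> hu hv; have := sqint_lin (-1) hu hv; under eq_fun do rewrite mulN1r.
Qed.

Lemma normsq_lin u v (c : C) : sqint u -> sqint v ->
  normsq (fun x => u x + c * v x) = normsq u + 2 * complex.Re (c * iprod v u) + cmod c ^+ 2
    * normsq v.
Proof.
move=> hu hv; have iuv := cintegrable_iprod hv hu.
have [ir _] := cintegrableZ c mD iuv.
have iu := sqint_integrable hu; have iv := sqint_integrable hv.
rewrite -(cintZ _ mD iuv) /normsq /cint /=.
have i2 : mu.-integrable D (EFin \o (fun x => 2 * complex.Re (c * (v x * (u x)^*)))).
  by rewrite /comp; under eq_fun do rewrite EFinM; exact: integrableZl.
have i3 : mu.-integrable D (EFin \o (fun x => cmod c ^+ 2 * cmod (v x) ^+ 2)).
  by rewrite /comp; under eq_fun do rewrite EFinM; exact: integrableZl.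
have i12 : mu.-integrable D
    (EFin \o (fun x => cmod (u x) ^+ 2 + 2 * complex.Re (c * (v x * (u x)^*)))).
  by rewrite /comp; under eq_fun do rewrite EFinD; exact: integrableD.
rewrite -RintegralZl // -RintegralZl // -RintegralD // -RintegralD //.
by apply: eq_Rintegral => x _; rewrite cmod2_lin.
Qed.

(** The parallelogram law with the nonnegative square norm of [u - c v] dropped. *)
Lemma normsq_lin_le u v (c : C) : sqint u -> sqint v ->
  normsq (fun x => u x + c * v x) <= 2 * normsq u + 2 * cmod c ^+ 2 * normsq v.
Proof.
move=> hu hv; have := normsq_ge0 (fun x => u x + - c * v x).
rewrite !normsq_lin // cmodN mulNr raddfN /=; lra.
Qed.

Lemma parallelogram u v : sqint u -> sqint v ->
  normsq (fun x => u x + v x) + normsq (fun x => u x - v x) = 2 * normsq u + 2 * normsq v.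
Proof.
move=> hu hv; have := normsq_lin 1 hu hv; have := normsq_lin (-1) hu hv.
under eq_fun do rewrite mulN1r.
under [X in _ -> normsq X = _ -> _]eq_fun do rewrite mul1r.
by move=> -> ->; rewrite cmodN !cmod1 mul1r mulN1r raddfN; ring.
Qed.

(** The Cauchy-Schwarz inequality in arithmetic-geometric form. Every use chooses its own [x], which
    avoids square roots and division by a norm that may vanish. *)
Lemma iprod_bound u v (x : R) : sqint u -> sqint v -> 0 < x ->
  cmod (iprod u v) <= (x * normsq u + normsq v / x) / 2.
Proof.
move=> hu hv x0; apply: le_trans (le_cmod_cint_R mD (cintegrable_iprod hu hv)) _.
have iR (k : R) w : sqint w -> mu.-integrable D (EFin \o (fun t => k * cmod (w t) ^+ 2)).
  move=> hw; rewrite /comp; under eq_fun do rewrite EFinM.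
  by apply: integrableZl => //; exact: sqint_integrable.
have -> : (x * normsq u + normsq v / x) / 2 =
   \int[mu]_(t in D) ((x / 2) * cmod (u t) ^+ 2 + (2 * x)^-1 * cmod (v t) ^+ 2).
  rewrite RintegralD //; [|exact: iR|exact: iR].
  rewrite !RintegralZl //; [|exact: sqint_integrable|exact: sqint_integrable].
  by rewrite /normsq; field; rewrite gt_eqF.
apply: le_Rintegral => //.
- by apply: cintegrable_cmod => //; exact: cintegrable_iprod.
- rewrite /comp; under eq_fun do rewrite EFinD.
  by apply: integrableD => //; [exact: iR|exact: iR].
move=> t _; rewrite cmodM cmod_conj; set a := cmod (u t); set b := cmod (v t).
have -> : x / 2 * a ^+ 2 + (2 * x)^-1 * b ^+ 2 = a * b + (x * a - b) ^+ 2 / (2 * x).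
  by field; rewrite gt_eqF.
by rewrite lerDl divr_ge0 ?sqr_ge0 // mulr_ge0 // ltW.
Qed.

Lemma iprodZDl u v w (c : C) : sqint u -> sqint v -> sqint w ->
  iprod (fun x => u x + c * v x) w = iprod u w + c * iprod v w.
Proof.
move=> hu hv hw; rewrite /iprod -cintZ //; last exact: cintegrable_iprod.
rewrite -cintD //; [|exact: cintegrable_iprod|by apply: cintegrableZ => //;
  exact: cintegrable_iprod].
by apply: eq_cint => x _; ring.
Qed.

Lemma iprodZr u v (c : C) : sqint u -> sqint v -> iprod u (fun x => c * v x) = c^* * iprod u v.
Proof.
move=> hu hv; rewrite /iprod -cintZ //; last exact: cintegrable_iprod.
by apply: eq_cint => x _; rewrite rmorphM /= mulrCA.
Qed.

Lemma iprodC u v : sqint u -> sqint v -> iprod u v = (iprod v u)^*.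
Proof.
move=> hu hv; rewrite /iprod -cint_conj //; last exact: cintegrable_iprod.
by apply: eq_cint => x _; rewrite rmorphM /= conjcK mulrC.
Qed.

Lemma iprod_self u : iprod u u = (normsq u)%:C.
Proof. by rewrite /iprod -cint_real; apply: eq_cint => x _; exact: mul_conj_cmod. Qed.

(** With [z = <v, u>], moving [u] by [- t conj(z) v] changes the square norm by
    [- 2 t |z|^2 + t^2 |z|^2 N]. For [t = 1 / (N + 1)] this is negative unless [z = 0]; the summand
    1 covers [N = 0]. *)
Lemma iprod_minimal u v : sqint u -> sqint v ->
  (forall c : C, normsq u <= normsq (fun x => u x + c * v x)) -> iprod v u = 0.
Proof.
move=> hu hv h; apply/eqP; rewrite -cmod_eq0; apply/eqP.
set z := iprod v u; set s := cmod z; set N := normsq v; have N0 : 0 <= N := normsq_ge0 v.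
have key (t : R) : 0 <= t -> 2 * t * s ^+ 2 <= t ^+ 2 * s ^+ 2 * N.
  move=> t0; have := h (- (t%:C * z^*)); rewrite normsq_lin // -/z -/N.
  have -> : - (t%:C * z^*) * z = (- (t * s ^+ 2))%:C.
    by rewrite mulNr -mulrA [z^* * z]mulrC mul_conj_cmod -/s -rmorphM -rmorphN.
  rewrite cmodN cmodM cmod_real cmod_conj -/s (ger0_norm t0) exprMn /=; lra.
have s0 : 0 <= s := cmod_ge0 z.
have N1 : 0 < N + 1 by rewrite ltr_wpDl.
have := key (N + 1)^-1 (ltW _); rewrite invr_gt0 => /(_ N1) k.
have : s ^+ 2 <= 0.
  have e : s ^+ 2 * ((N + 2) / (N + 1) ^+ 2) <= 0.
    have -> : s ^+ 2 * ((N + 2) / (N + 1) ^+ 2) = 2 * (N + 1)^-1 * s ^+ 2 - (N + 1)^-1 ^+ 2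
      * s ^+ 2 * N.
      by field; rewrite gt_eqF.
    lra.
  by move: e; rewrite pmulr_lle0 // divr_gt0 ?exprn_gt0 // ltr_wpDl.
by rewrite le_eqVlt ltNge sqr_ge0 orbF sqrf_eq0 => /eqP.
Qed.

(** Fatou's lemma in the form in which an L^2 bound passes to an almost everywhere limit. *)
Lemma fatou_sq (F : nat -> T -> C) u (B : R) : (forall i, cmeas D (F i)) -> cmeas D u ->
  {ae mu, forall x, D x -> ccvg \oo (F ^~ x) (u x)} ->
  (\forall i \near \oo, (\int[mu]_(x in D) (cmod (F i x) ^+ 2)%:E <= B%:E)%E) ->
  (\int[mu]_(x in D) (cmod (u x) ^+ 2)%:E <= B%:E)%E.
Proof.
move=> mF mu2 Fu FB.
pose f i x : \bar R := (cmod (F i x) ^+ 2)%:E.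
have mf i : measurable_fun D (f i) by apply/measurable_EFinP; exact: cmeas_cmod2.
have f0 i x : D x -> (0 <= f i x)%E by move=> _; rewrite lee_fin exprn_ge0 ?cmod_ge0.
have uE : {ae mu, forall x, D x -> (cmod (u x) ^+ 2)%:E = limn_einf (f ^~ x)}.
  apply: filterS Fu => x h /h /ccvgP/cvg_cmod hx.
  suff fx : f ^~ x @ \oo --> (cmod (u x) ^+ 2)%:E by rewrite (cvg_limn_einf_sup fx).1.
  apply: cvg_EFin; first exact: nearW.
  by rewrite expr2; exact: (cvgM hx hx).
have e0 x : D x -> (0 <= limn_einf (f ^~ x))%E.
  move=> Dx; rewrite limn_einf_lim; apply: lime_ge; first exact: is_cvg_einfs.
  by apply: nearW => n; apply: le_ereal_inf_tmp => _ [m _ <-]; exact: f0.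
rewrite (@ge0_ae_eq_integral _ _ _ mu D _ (fun x => limn_einf (f ^~ x))) //; last 3 first.
- by apply/measurable_EFinP; exact: cmeas_cmod2.
- apply: (measurableT_comp (@oppe_measurable R setT)); apply: measurable_fun_limn_esup => i.
  exact: (measurableT_comp (@oppe_measurable R setT) (mf i)).
- by move=> x _; rewrite lee_fin exprn_ge0 ?cmod_ge0.
apply: le_trans (fatou mu mD mf f0) _.
have [N _ hN] := FB.
rewrite limn_einf_lim; apply: lime_le; first exact: is_cvg_einfs.
apply: nearW => n; apply: (@le_trans _ _ (\int[mu]_(x in D) f (maxn n N) x)%E).
  by apply: ereal_inf_lbound; exists (maxn n N) => //=; exact: leq_maxl.
by apply: hN => /=; exact: leq_maxr.
Qed.

End SquareIntegrable.

(** * Minimax *)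

Section Minimax.
Variables (R : realType) (m : nat).
Local Notation N := (m.+1%:R : R).

(** Where the excess over [c] is not 0, [x] is the excess plus [c]. Summed over the coordinates this
    evaluates the linear functional with coefficients [p v] at [v] itself. *)
Lemma excess_mul (x c : R) :
  Num.max (x - c) 0 * x = Num.max (x - c) 0 ^+ 2 + Num.max (x - c) 0 * c.
Proof. by rewrite maxEge; case: ifP => _; ring. Qed.

(** With the excess [p] at [x] and the increment [h = s (y - x)], the new squared excess is at most
    [(p + h)^2]; the term [h^2] of the expansion is the error. *)
Lemma excess_step (x y c s B : R) : 0 <= s -> `|y - x| <= B ->
  Num.max (x + s * (y - x) - c) 0 ^+ 2 <= Num.max (x - c) 0 ^+ 2 +
    2 * s * (Num.max (x - c) 0 * y - Num.max (x - c) 0 * x) + s ^+ 2 * B ^+ 2.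
Proof.
move=> s0 yB; have hB : (s * (y - x)) ^+ 2 <= s ^+ 2 * B ^+ 2.
  rewrite exprMn ler_wpM2l ?exprn_ge0 // -real_normK ?num_real //.
  by rewrite lerXn2r ?nnegrE ?(le_trans _ yB).
set p := Num.max (x - c) 0; set h := s * (y - x) in hB *.
have xp : x - c <= p by rewrite le_max lexx.
apply: (@le_trans _ _ ((p + h) ^+ 2)); last first.
  have -> : 2 * s * (p * y - p * x) = 2 * p * h by rewrite /h; ring.
  by move: p h {xp} hB => p h; lra.
rewrite maxEge; case: ifP => h0; last by rewrite expr0n sqr_ge0.
have le : x + h - c <= p + h by rewrite addrAC lerD2r.
by rewrite lerXn2r ?nnegrE // (le_trans h0 le).
Qed.

(** [p^2 <= d + 1] gives [p <= d + 2], so [x] is at most [c + d + 2]. *)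
Lemma dist_le_excess (x y c d b : R) : 0 <= x -> 0 <= y -> y <= b -> 0 <= c -> 0 <= d ->
  Num.max (x - c) 0 ^+ 2 <= d + 1 -> `|y - x| <= b + c + d + 2.
Proof.
have : x - c <= Num.max (x - c) 0 by rewrite le_max lexx.
move: (Num.max _ _) => p xp x0 y0 yb c0 d0 pd; have : p <= d + 2 by nra.
rewrite ler_norml; lra.
Qed.

(* The distance of the convex set [V] to the orthant [v_i <= c], slightly beyond [K], is
   shown to vanish: weights proportional to the excess over [c] give a descent direction. *)
Lemma minimax (V : set ('I_m.+1 -> R)) (K : R) : 0 < K ->
  (forall v, V v -> forall i, 0 <= v i) ->
  (forall u v (s : R), V u -> V v -> 0 <= s <= 1 ->
     V (fun i => u i + s * (v i - u i))) ->
  (forall th : 'I_m.+1 -> R, (forall i, 0 < th i) -> \sum_i th i = 1 ->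
     exists2 v, V v & \sum_i th i * v i <= K) ->
  forall e : R, 0 < e -> exists2 v, V v & forall i, v i <= K + e.
Proof.
move=> K0 V0 Vc Vth e e0.
have N0 : 0 < N by rewrite ltr0n.
(* Half of [e] is spent on the orthant, the other half on a squared distance below [(e / 2)^2]. *)
pose c := K + e / 2; have c0 : 0 < c by rewrite addr_gt0 // divr_gt0.
pose p (v : 'I_m.+1 -> R) i := Num.max (v i - c) 0.
pose D v := \sum_i p v i ^+ 2.
have p0 v i : 0 <= p v i by rewrite le_max lexx orbT.
have D0 v : 0 <= D v by apply: sumr_ge0 => i _; exact: exprn_ge0.
have pD v i : p v i ^+ 2 <= D v.
  by rewrite /D (bigD1 i) //= lerDl; apply: sumr_ge0 => j _; exact: exprn_ge0.
have [v0 Vv0 _] : exists2 v, V v & \sum_i N^-1 * v i <= K.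
  apply: Vth => [i|]; first by rewrite invr_gt0.
  by rewrite sumr_const card_ord -[_ *+ _]mulr_natr mulVf // gt_eqF.
pose E := [set D v | v in V].
have E0 : E !=set0 by exists (D v0), v0.
have lbE : has_lbound E by exists 0 => _ [v _ <-].
have infE : has_inf E by split.
pose d := inf E.
have d0 : 0 <= d by apply: lb_le_inf => // _ [v _ <-].
have [dz|dn0] := eqVneq d 0.
  have e2 : 0 < (e / 2) ^+ 2 by rewrite exprn_gt0 // divr_gt0.
  have [_ [v Vv <-]] := inf_adherent e2 infE; rewrite -/d dz add0r => Dv.
  exists v => // i; have := le_lt_trans (pD v i) Dv.
  have : v i - c <= p v i by rewrite le_max lexx.
  rewrite /c; have := p0 v i; move: (p v i) => x; nra.
have dpos : 0 < d by rewrite lt_neqAle eq_sym dn0.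
(* The share of uniform weight that makes all weights positive; it is chosen so that
   [c * (1 - eta) = K]. *)
pose eta := e / (2 * c).
have eta0 : 0 < eta by rewrite divr_gt0 // mulr_gt0.
have etaE : c * (1 - eta) = K.
  have h : c * eta = e / 2 by rewrite /eta; field; rewrite gt_eqF.
  by rewrite mulrBr mulr1 h /c; ring.
have eta1 : 0 < 1 - eta by rewrite -(pmulr_rgt0 _ c0) etaE.
(* Every weight will be at least [eta / N], so the competitor [v'] has coordinates at most
   [K * N / eta]; [B] then bounds the length of the step in each coordinate. *)
pose B := K * N / eta + c + d + 2.
have B0 : 0 < B by rewrite !addr_gt0 // divr_gt0 // mulr_gt0.
have NB : 0 < N * B ^+ 2 by rewrite mulr_gt0 // exprn_gt0.
(* The step length: the second-order terms add up to at most [N * s^2 * B^2 <= s * d]. *)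
pose s := Num.min 1 (d / (N * B ^+ 2)).
have s0 : 0 < s by rewrite lt_min ltr01 divr_gt0.
have s1 : s <= 1 by rewrite ge_min lexx.
have sd : s * (N * B ^+ 2) <= d by rewrite -ler_pdivlMr // ge_min lexx orbT.
have dl0 : 0 < Num.min 1 (s * d) by rewrite lt_min ltr01 mulr_gt0.
have [_ [v Vv <-]] := inf_adherent dl0 infE; rewrite -/d => Dv.
have dD : d <= D v by apply: ge_inf => //; exists v.
have Dv1 : D v <= d + 1 by apply: ltW; apply: lt_le_trans Dv _; rewrite lerD2l ge_min lexx.
pose S := \sum_i p v i.
have S0 : 0 < S.
  rewrite lt_neqAle sumr_ge0 // andbT eq_sym; apply/eqP => /psumr_eq0P pz.
  suff : D v = 0 by lra.
  by rewrite /D big1 // => i _; rewrite pz ?expr0n.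
(* The gradient of the squared distance at [v], normalized and mixed with uniform weights. *)
pose th i := (1 - eta) * (p v i / S) + eta / N.
have th0 i : 0 < th i.
  apply: ltr_wpDl; last exact: divr_gt0.
  by apply: mulr_ge0; [exact: ltW|apply: divr_ge0 => //; exact: ltW].
have th1 : \sum_i th i = 1.
  rewrite /th big_split /= -mulr_sumr -mulr_suml divff ?gt_eqF // mulr1.
  rewrite sumr_const card_ord -[_ *+ _]mulr_natr mulfVK ?gt_eqF //; lra.
have [v' Vv' thv'] := Vth th th0 th1.
have v'0 := V0 _ Vv'.
have v'B i : v' i <= K * N / eta.
  rewrite ler_pdivlMr // -ler_pdivrMr // -mulrA mulrC.
  apply: le_trans thv'; rewrite (bigD1 i) //= -[leLHS]addr0 lerD //.
    rewrite ler_wpM2r // /th lerDr; apply: mulr_ge0; first exact: ltW.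
    by apply: divr_ge0 => //; exact: ltW.
  by apply: sumr_ge0 => j _; rewrite mulr_ge0 // ltW.
have pv' : \sum_i p v i * v' i <= S * c.
  have : (1 - eta) / S * \sum_i p v i * v' i <= K.
    apply: le_trans thv'; rewrite mulr_sumr; apply: ler_sum => i _.
    rewrite mulrA ler_wpM2r // /th.
    have : 0 <= eta / N by rewrite divr_ge0 // ltW.
    have -> : (1 - eta) / S * p v i = (1 - eta) * (p v i / S) by ring.
    by rewrite lerDl.
  by rewrite mulrAC ler_pdivrMr // -etaE [c * _]mulrC -mulrA ler_pM2l // mulrC.
have pv : \sum_i p v i * v i = D v + S * c.
  rewrite /D /S mulr_suml -big_split /=; apply: eq_bigr => i _.
  exact: excess_mul.
have vB i : `|v' i - v i| <= B.
  apply: (dist_le_excess (V0 _ Vv i) (v'0 i) (v'B i) (ltW c0) d0).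
  exact: le_trans (pD v i) Dv1.
have s01 : 0 <= s <= 1 by rewrite (ltW s0) s1.
have dD' : d <= D (fun i => v i + s * (v' i - v i)) by apply: ge_inf => //;
  exists (fun i => v i + s * (v' i - v i)) => //; exact: Vc.
have : D (fun i => v i + s * (v' i - v i)) <=
   \sum_i (p v i ^+ 2 + 2 * s * (p v i * v' i - p v i * v i) + s ^+ 2 * B ^+ 2).
  apply: ler_sum => i _.
  exact: excess_step (ltW s0) (vB i).
rewrite !big_split /= -mulr_sumr sumrB pv sumr_const card_ord.
rewrite -[s ^+ 2 * B ^+ 2 *+ _]mulr_natr -/(D v) => k; exfalso.
have Ds : D v < d + s * d by apply: lt_le_trans Dv _; rewrite lerD2l ge_min lexx orbT.
have Y : s ^+ 2 * B ^+ 2 * N <= s * d.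
  have -> : s ^+ 2 * B ^+ 2 * N = s * (s * (N * B ^+ 2)) by ring.
  by rewrite ler_pM2l.
have X : 2 * s * (\sum_(i < m.+1) p v i * v' i - (D v + S * c)) <= - (2 * s * D v).
  rewrite -mulrN ler_pM2l ?mulr_gt0 //; clear -pv'; lra.
have Z : s * d <= s * D v by rewrite ler_pM2l.
(* The new point has [D] at most [D v - 2 s D v + s d], which is below [d] because
   [d <= D v < d + s d]; but [d] is the infimum. *)
clear -k dD' Ds Y X Z; lra.
Qed.

End Minimax.

(** * The equivalence for an abstract function space *)

Section SpaceAxioms.
Variables (R : realType) (n : nat) (H : function_space R n).
Local Notation C := R[i].
Local Notation mu := (fs_mu H).
Local Notation D := (fs_dom (f := H)).
Local Notation tr := (fs_trace (f := H)).
Local Notation mem := (fs_mem H).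

(* [sa_mul] puts [f * k_a] into the space as soon as its trace is square-integrable, so that
   the reproducing formula can be applied to it. *)
Record space_axioms : Prop := SpaceAxioms {
  sa_mD : measurable D ;
  sa_le1 : (mu D <= 1)%E ;
  sa_meas : forall f, mem f -> cmeas D (tr f) ;
  sa_hol : forall f, mem f -> holomorphic f ;
  sa_bdd : forall f (B : R), holomorphic f -> (forall z, polydisc z -> cmod (f z) <= B) ->
    mem f /\ {ae mu, forall x, D x -> cmod (tr f x) <= B} ;
  sa_lin : forall f g (c : C), mem f -> mem g -> mem (fun z => f z + c * g z) /\
    {ae mu, forall x, D x -> tr (fun z => f z + c * g z) x = tr f x + c * tr g x} ;
  sa_fin : forall f, mem f -> (\int[mu]_(x in D) (cmod (tr f x) ^+ 2)%:E < +oo)%E ;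
  sa_loc : forall r : R, r < 1 -> exists K : R, forall f z, mem f -> rnorm z <= r ->
    ((cmod (f z) ^+ 2)%:E <= K%:E * \int[mu]_(x in D) (cmod (tr f x) ^+ 2)%:E)%E ;
  sa_ker : forall a, polydisc a -> exists k, is_reproducing_kernel H a k ;
  sa_mul : forall a k f, polydisc a -> is_reproducing_kernel H a k -> mem f ->
    (\int[mu]_(x in D) ((cmod (tr f x) * cmod (tr k x)) ^+ 2)%:E < +oo)%E ->
    mem (fun z => f z * k z) /\
    {ae mu, forall x, D x -> tr (fun z => f z * k z) x = tr f x * tr k x}
}.

Hypothesis SA : space_axioms.
Let mD := sa_mD SA.

Lemma holomorphic_cst (c : C) : @holomorphic R n (fun=> c).
Proof. by move=> z _; exact: differentiable_cst. Qed.

Lemma mem_cst (c : C) : mem (fun=> c).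
Proof. by have [] := sa_bdd SA (holomorphic_cst c) (fun z _ => lexx (cmod c)). Qed.

(** The constant 0 is bounded by 0, so [sa_bdd] forces its trace to vanish almost everywhere. *)
Lemma trace0 : {ae mu, forall x, D x -> tr (fun=> 0) x = 0}.
Proof.
have [_] := sa_bdd SA (@holomorphic_cst 0) (fun z _ => lexx (cmod 0)).
apply: filterS => x h /h; rewrite cmod0 => c0; apply/eqP.
by rewrite -cmod_eq0 eq_le c0 cmod_ge0.
Qed.

Lemma mem_scale (c : C) f : mem f -> mem (fun z => c * f z) /\
  {ae mu, forall x, D x -> tr (fun z => c * f z) x = c * tr f x}.
Proof.
move=> mf; have [] := sa_lin SA c (mem_cst 0) mf.
rewrite (_ : (fun z => 0 + c * f z) = (fun z => c * f z)); last by apply/funext => z; rewrite add0r.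
move=> mcf h; split=> //; apply: filterS2 h trace0 => x h h0 Dx.
by rewrite h // h0 // add0r.
Qed.

Lemma mem_sqint f : mem f -> sqint mu D (tr f).
Proof. by move=> mf; split; [exact: sa_meas|exact: sa_fin]. Qed.

Lemma meas_tr2 f : mem f -> measurable_fun D (fun x => (cmod (tr f x) ^+ 2)%:E).
Proof. by move=> /(sa_meas SA) h; apply/measurable_EFinP; exact: cmeas_cmod2. Qed.

Definition nrm2 f : R := normsq mu D (tr f).

Lemma nrm2E f : mem f -> (\int[mu]_(x in D) (cmod (tr f x) ^+ 2)%:E = (nrm2 f)%:E)%E.
Proof. by move=> /mem_sqint/normsqE. Qed.

Lemma nrm2_ge0 f : 0 <= nrm2 f.
Proof. exact: normsq_ge0. Qed.

Lemma inner_self f : inner H f f = (nrm2 f)%:C.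
Proof. exact: iprod_self. Qed.

Lemma inner_bound f g (x : R) : mem f -> mem g -> 0 < x ->
  cmod (inner H f g) <= (x * nrm2 f + nrm2 g / x) / 2.
Proof. by move=> /mem_sqint mf /mem_sqint mg; exact: (iprod_bound mD mf mg). Qed.

Section Kernel.
Variables (a : 'rV[C]_n) (aD : polydisc a).

Lemma repro_kernelP : is_reproducing_kernel H a (repro_kernel H a).
Proof. by apply: xgetPex; exact: sa_ker. Qed.

Let k := repro_kernel H a.
Let mk : mem k := repro_kernelP.1.

Lemma kernel_diag : k a = (nrm2 k)%:C.
Proof. by rewrite (repro_kernelP.2 _ mk) inner_self. Qed.

(** The reproducing formula for the constant 1 gives [1 = <1, k>], which is impossible for a kernel
    of norm 0. *)
Lemma nrm2_kernel_gt0 : 0 < nrm2 k.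
Proof.
rewrite lt_neqAle nrm2_ge0 andbT eq_sym; apply/eqP => k0.
have m1 := mem_cst 1.
pose x : R := (1 + nrm2 (fun=> 1))^-1.
have n1 := nrm2_ge0 (fun=> 1).
have x0 : 0 < x by rewrite invr_gt0 ltr_wpDr.
have := inner_bound m1 mk x0; rewrite -(repro_kernelP.2 _ m1) cmod1 k0 mul0r addr0.
rewrite /x [_^-1 * _]mulrC ler_pdivlMr // mul1r ler_pdivlMr; lra.
Qed.

Lemma normalized_kernelP : mem (normalized_kernel H a) /\
  {ae mu, forall x, D x -> cmod (tr (normalized_kernel H a) x) ^+ 2 =
      cmod (tr k x) ^+ 2 / nrm2 k}.
Proof.
pose s := sqrtC (k a).
have s2 : cmod s ^+ 2 = nrm2 k.
  rewrite -cmodX (_ : s ^+ 2 = k a); last by rewrite /s sqrtCK.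
  by rewrite kernel_diag cmod_real ger0_norm ?nrm2_ge0.
have [h1 h2] := mem_scale s^-1 mk.
have E : normalized_kernel H a = (fun z => s^-1 * k z).
  by apply/funext => z; rewrite /normalized_kernel mulrC.
rewrite E; split=> //; apply: filterS h2 => x h /h ->.
by rewrite cmodM cmodV exprMn exprVn s2 mulrC.
Qed.

Lemma normalized_kernel_int :
  (\int[mu]_(x in D) (cmod (tr (normalized_kernel H a) x) ^+ 2)%:E = 1)%E.
Proof.
have [m1 ae1] := normalized_kernelP; have k0 := nrm2_kernel_gt0.
transitivity (\int[mu]_(x in D) ((nrm2 k)^-1%:E * (cmod (tr k x) ^+ 2)%:E))%E.
  apply: ge0_ae_eq_integral => //.
  - exact: meas_tr2.
  - by apply: measurable_funeM; exact: meas_tr2.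
  - by move=> x _; rewrite lee_fin exprn_ge0 ?cmod_ge0.
  - by move=> x _; rewrite lee_fin mulr_ge0 ?invr_ge0 ?exprn_ge0 ?cmod_ge0 ?nrm2_ge0.
  - by apply: filterS ae1 => x h /h ->; rewrite -EFinM mulrC.
rewrite ge0_integralZl //; last 3 first.
- exact: meas_tr2.
- by move=> x _; rewrite lee_fin exprn_ge0 ?cmod_ge0.
- by rewrite lee_fin invr_ge0 nrm2_ge0.
by rewrite nrm2E // -EFinM mulVf // gt_eqF.
Qed.

(** [f(a) k(a) = <f k, k>] and [k(a) = |k|^2], so [|f(a)|^2 |k|^2 <= |f k|^2] by Cauchy-Schwarz. If
    the right-hand side of the claim is infinite there is nothing to prove; otherwise [sa_mul] puts
    [f k] into the space. *)
Lemma eval_le_weighted f : mem f ->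
  ((cmod (f a) ^+ 2)%:E <=
   \int[mu]_(x in D) (cmod (tr f x) ^+ 2 * cmod (tr (normalized_kernel H a) x) ^+ 2)%:E)%E.
Proof.
move=> mf; have [m1 ae1] := normalized_kernelP; have k0 := nrm2_kernel_gt0.
have mF := cmeas_cmod2 (sa_meas SA mf); have mK := cmeas_cmod2 (sa_meas SA mk).
have mK1 := cmeas_cmod2 (sa_meas SA m1).
pose A := (\int[mu]_(x in D) ((cmod (tr f x) * cmod (tr k x)) ^+ 2)%:E)%E.
have mFK : measurable_fun D (fun x => ((cmod (tr f x) * cmod (tr k x)) ^+ 2)%:E).
  by under eq_fun do rewrite exprMn; apply/measurable_EFinP; exact: measurable_funM.
have FK0 x : (0 <= ((cmod (tr f x) * cmod (tr k x)) ^+ 2)%:E :> \bar R)%E.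
  by rewrite lee_fin exprn_ge0 // mulr_ge0 ?cmod_ge0.
have -> : (\int[mu]_(x in D) (cmod (tr f x) ^+ 2 * cmod (tr (normalized_kernel H a) x) ^+ 2)%:E =
   (nrm2 k)^-1%:E * A)%E.
  rewrite -ge0_integralZl // ?lee_fin ?invr_ge0 ?nrm2_ge0 //.
  apply: ge0_ae_eq_integral => //.
  - by apply/measurable_EFinP; exact: measurable_funM.
  - exact: measurable_funeM.
  - by move=> x _; rewrite lee_fin mulr_ge0 ?exprn_ge0 ?cmod_ge0.
  - by move=> x _; rewrite mule_ge0 // lee_fin invr_ge0 nrm2_ge0.
  - by apply: filterS ae1 => x h /h ->; rewrite -EFinM exprMn; congr _%:E; ring.
have [AI|] := eqVneq A +oo%E.
  by rewrite AI gt0_muley ?leey // lte_fin invr_gt0.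
rewrite -ltey => Afin.
have [mfk aefk] := sa_mul SA aD repro_kernelP mf Afin.
have A0 : (0 <= A)%E by exact: integral_ge0.
have AE : A = (fine A)%:E by rewrite fineK // ge0_fin_numE.
have fE : f a * k a = inner H (fun z => f z * k z) k := repro_kernelP.2 _ mfk.
set y := cmod (f a).
have [y0|y0] := eqVneq y 0.
  by rewrite y0 expr0n /= mule_ge0 // lee_fin invr_ge0 nrm2_ge0.
have {}y0 : 0 < y by rewrite lt_neqAle eq_sym y0 cmod_ge0.
have iA : mu.-integrable D (fun x => ((cmod (tr f x) * cmod (tr k x)) ^+ 2)%:E).
  apply/integrableP; split => //; under eq_integral do rewrite gee0_abs //.
  exact: Afin.
have nE : nrm2 (fun z => f z * k z) = fine A.
  apply: EFin_inj; rewrite -nrm2E // -AE; apply: ge0_ae_eq_integral => //.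
  - exact: meas_tr2.
  - by move=> x _; rewrite lee_fin exprn_ge0 ?cmod_ge0.
  - by apply: filterS aefk => x h /h ->; rewrite cmodM.
(* With [x = 1 / y] the inequality reads [y |k|^2 <= (A / y + |k|^2 y) / 2], that is
   [|k|^2 y <= A / y]. *)
have yi : 0 < y^-1 by rewrite invr_gt0.
have := inner_bound mfk mk yi; rewrite -fE cmodM kernel_diag cmod_real gtr0_norm // nE invrK -/y.
move=> h; have h2 : nrm2 k * y <= y^-1 * fine A by rewrite [leLHS]mulrC; lra.
have : y * (nrm2 k * y) <= y * (y^-1 * fine A) by rewrite ler_pM2l.
rewrite mulVKf ?gt_eqF // => h3.
rewrite AE -EFinM lee_fin /= mulrC ler_pdivlMr // expr2 -mulrA [y * nrm2 k]mulrC.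
exact: h3.
Qed.

End Kernel.
End SpaceAxioms.

Section FiniteSetFilter.
Variable T : choiceType.

(* Cofinal sets of finite sequences, ordered by inclusion of their supports. *)
Definition finite_sets_filter : set_system (seq T) :=
  [set A | exists s0 : seq T, forall s : seq T, {subset s0 <= s} -> A s].

Lemma finite_sets_filter_proper : ProperFilter finite_sets_filter.
Proof.
split; first by move=> [s0 /(_ s0 (fun=> id))].
split; first by exists [::].
- move=> A B [s hs] [t ht]; exists (s ++ t) => u stu; split.
    by apply: hs => x xs; apply: stu; rewrite mem_cat xs.
  by apply: ht => x xs; apply: stu; rewrite mem_cat xs orbT.
- by move=> A B AB [s hs]; exists s => t /hs/AB.
Qed.

End FiniteSetFilter.

(** * Corona Property and Convex Poisson Property under the axioms *)

Section CoronaEquivalence.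
Variables (R : realType) (n : nat) (H : function_space R n).
Hypothesis SA : space_axioms H.
Local Notation C := R[i].
Local Notation mu := (fs_mu H).
Local Notation D := (fs_dom (f := H)).
Local Notation tr := (fs_trace (f := H)).
Local Notation mem := (fs_mem H).
Let mD := sa_mD SA.

Section Weights.
Variables (M : nat) (a : 'I_M -> 'rV[C]_n) (aD : forall m, polydisc (a m)).

(** Index [ord0] carries the constant weight of [theta_0], so that [poisson_weight] becomes one sum
    over ['I_M.+1], the index set of the minimax argument. *)
Definition weight (i : 'I_M.+1) (x : fs_base H) : R :=
  if unlift ord0 i is Some m then cmod (tr (normalized_kernel H (a m)) x) ^+ 2 else 1.

Lemma weight_ge0 i x : 0 <= weight i x.
Proof. by rewrite /weight; case: unlift => [m|//]; rewrite exprn_ge0 ?cmod_ge0. Qed.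

Lemma weight_meas i : measurable_fun D (weight i).
Proof.
rewrite /weight; case: unlift => [m|]; last exact: measurable_cst.
exact: (cmeas_cmod2 (sa_meas SA (normalized_kernelP SA (aD m)).1)).
Qed.

Lemma poisson_weightE th x : poisson_weight a th x = \sum_i th i * weight i x.
Proof.
rewrite big_ord_recl /= /weight unlift_none mulr1 /poisson_weight; congr (_ + _).
by apply: eq_bigr => m _; rewrite liftK.
Qed.

Lemma weight_int i : (\int[mu]_(x in D) (weight i x)%:E <= 1)%E.
Proof.
rewrite /weight; case: unlift => [m|].
  by rewrite (normalized_kernel_int SA (aD m)).
by rewrite integral_cst // mul1e; exact: sa_le1.
Qed.

(** Linearity in [theta], stated in the extended reals because single terms may be infinite. *)
Lemma sqnormE th f : (forall i, 0 <= th i) -> mem f ->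
  (sqnorm H a th f = \sum_i (th i)%:E * \int[mu]_(x in D) (cmod (tr f x) ^+ 2 * weight i x)%:E)%E.
Proof.
move=> th0 mf; have mF := cmeas_cmod2 (sa_meas SA mf).
have mW i : measurable_fun D (fun x => (cmod (tr f x) ^+ 2 * weight i x)%:E).
  by apply/measurable_EFinP; apply: measurable_funM => //; exact: weight_meas.
have W0 i x : (0 <= (cmod (tr f x) ^+ 2 * weight i x)%:E :> \bar R)%E.
  by rewrite lee_fin mulr_ge0 ?weight_ge0 ?exprn_ge0 ?cmod_ge0.
rewrite /sqnorm.
transitivity (\int[mu]_(x in D) \sum_i ((th i)%:E * (cmod (tr f x) ^+ 2 * weight i x)%:E))%E.
  apply: eq_integral => x _; rewrite poisson_weightE mulr_sumr.
  by rewrite -sumEFin; apply: eq_bigr => i _; rewrite -EFinM mulrCA.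
rewrite ge0_integral_sum //.
- by apply: eq_bigr => i _; rewrite ge0_integralZl // lee_fin.
- by move=> i; exact: measurable_funeM.
- by move=> i x _; rewrite mule_ge0 // lee_fin.
Qed.

End Weights.

Lemma corona_convex_poisson : corona_property R n -> convex_poisson_property H.
Proof.
move=> cor N c phi dphi; have [K [f [K0 bf fK fE]]] := cor N c phi dphi.
have N0 : (0 < N)%N by have [] := dphi.
(* There are [N] functions of square norm at most [K^2]; [N <= N^2] keeps a square root out of the
   constant. *)
exists (K * N%:R); split; first by rewrite mulr_gt0 // ltr0n.
move=> M a th _ aD th01 th1; exists f.
have fl l z : polydisc z -> cmod (f l z) <= K.
  move=> zD; rewrite -ler_sqr ?nnegrE ?cmod_ge0 ?(ltW K0) //.
  by apply: le_trans (fK z zD); exact: (le_bigmax_cond _ (fun l => cmod (f l z) ^+ 2)).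
have hol l : holomorphic (f l) by have [] := bf l.
have mf l : mem (f l) := (sa_bdd SA (hol l) (fl l)).1.
have th0 i : 0 <= th i by have /andP[] := th01 i.
split=> //.
have bound l : (sqnorm H a th (f l) <= (K ^+ 2)%:E)%E.
  rewrite (sqnormE aD th0 (mf l)).
  apply: (@le_trans _ _ (\sum_i (th i)%:E * (K ^+ 2)%:E)%E).
    apply: lee_sum => i _; apply: lee_wpmul2l; first by rewrite lee_fin.
    have mW := weight_meas aD i; have W0 := weight_ge0 a i.
    apply: (@le_trans _ _ (\int[mu]_(x in D) ((K ^+ 2)%:E * (weight a i x)%:E))%E).
      apply: ae_ge0_le_integral => //.
      - by move=> x _; rewrite lee_fin mulr_ge0 ?exprn_ge0 ?cmod_ge0.
      - apply/measurable_EFinP; apply: measurable_funM => //.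
        exact: (cmeas_cmod2 (sa_meas SA (mf l))).
      - by move=> x _; rewrite lee_fin mulr_ge0 ?exprn_ge0 // ltW.
      - by apply: measurable_funeM; exact/measurable_EFinP.
      - have := (sa_bdd SA (hol l) (fl l)).2; apply: filterS => x h /h ?.
        by rewrite -EFinM lee_fin ler_wpM2r // ler_sqr ?nnegrE ?cmod_ge0 // ltW.
    rewrite ge0_integralZl //.
    - rewrite -[leRHS]mule1; apply: lee_wpmul2l; last exact: weight_int.
      by rewrite lee_fin exprn_ge0 // ltW.
    - exact/measurable_EFinP.
    - by move=> x _; rewrite lee_fin.
    - by rewrite lee_fin exprn_ge0 // ltW.
  under eq_bigr do rewrite -EFinM.
  by rewrite sumEFin -mulr_suml th1 mul1r.
apply: (@le_trans _ _ (\sum_(l < N) (K ^+ 2)%:E)%E).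
  by apply: lee_sum => l _; exact: bound.
rewrite sumEFin lee_fin sumr_const card_ord -[_ *+ _]mulr_natr exprMn.
rewrite ler_wpM2l ?exprn_ge0 ?(ltW K0) // expr2 ler_peMr // ?ler0n // ler1n //.
Qed.

Section FromConvexPoisson.
Variables (N : nat) (phi : 'I_N -> 'rV[C]_n -> C) (K : R).
Hypothesis K0 : 0 < K.

Definition solution (f : 'I_N -> 'rV[C]_n -> C) : Prop :=
  (forall l, mem (f l)) /\ forall z, polydisc z -> \sum_(l < N) phi l z * f l z = 1.

Hypothesis cpp : forall (M : nat) (a : 'I_M -> 'rV[C]_n) (theta : 'I_M.+1 -> R),
      (0 < M)%N -> (forall m, polydisc (a m)) -> (forall m, 0 <= theta m <= 1) ->
      \sum_(m < M.+1) theta m = 1 ->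
    exists2 f, solution f & (\sum_(l < N) sqnorm H a theta (f l) <= (K ^+ 2)%:E)%E.

(** The convex combination [(1 - s) f + s g], shaped so that [sa_lin] applies twice. *)
Definition mix (s : R) (f g : 'I_N -> 'rV[C]_n -> C) (l : 'I_N) (z : 'rV[C]_n) : C :=
  f l z + s%:C * (g l z + (-1) * f l z).

(** Extended real, since the Convex Poisson Property bounds only combinations with weights
    [theta]. *)
Definition energy M (a : 'I_M -> 'rV[C]_n) (f : 'I_N -> 'rV[C]_n -> C) (i : 'I_M.+1) : \bar R :=
  (\sum_(l < N) \int[mu]_(x in D) (cmod (tr (f l) x) ^+ 2 * weight a i x)%:E)%E.

Lemma energy_ge0 M (a : 'I_M -> 'rV[C]_n) f i : (0 <= energy a f i)%E.
Proof.
apply: sume_ge0 => l _; apply: integral_ge0 => x _.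
by rewrite lee_fin mulr_ge0 ?weight_ge0 ?exprn_ge0 ?cmod_ge0.
Qed.

(** Convexity of the squared modulus, integrated; the pointwise inequality holds where the trace is
    linear, that is almost everywhere. Real upper bounds [u] and [v] stand for the energies, which
    may be infinite. *)
Lemma energy_convex M (a : 'I_M -> 'rV[C]_n) (aD : forall m, polydisc (a m))
   f g (s : R) i (u v : R) :
  solution f -> solution g -> 0 <= s <= 1 ->
  (energy a f i <= u%:E)%E -> (energy a g i <= v%:E)%E ->
  solution (mix s f g) /\
  (energy a (mix s f g) i <= (u + s * (v - u))%:E)%E.
Proof.
move=> [mf f1] [mg g1] /andP[s0 s1] fu gv.
have L1 l := sa_lin SA (-1) (mg l) (mf l).
have L2 l := sa_lin SA s%:C (mf l) (L1 l).1.
split.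
  split=> [l|z zD]; first exact: (L2 l).1.
  transitivity (\sum_(l < N) (phi l z * f l z + s%:C * (phi l z * g l z - phi l z * f l z))).
    by apply: eq_bigr => l _; rewrite /mix; ring.
  by rewrite big_split /= -mulr_sumr sumrB f1 // g1 // subrr mulr0 addr0.
have mW h : (forall l, mem (h l)) -> forall l, measurable_fun D
    (fun x => (cmod (tr (h l) x) ^+ 2 * weight a i x)%:E).
  move=> mh l; apply/measurable_EFinP; apply: measurable_funM; last exact: weight_meas.
  exact: (cmeas_cmod2 (sa_meas SA (mh l))).
have W0 h (x : fs_base H) : (0 <= (cmod (tr h x) ^+ 2 * weight a i x)%:E :> \bar R)%E.
  by rewrite lee_fin mulr_ge0 ?weight_ge0 ?exprn_ge0 ?cmod_ge0.
have s1' : 0 <= 1 - s by rewrite subr_ge0.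
have -> : ((u + s * (v - u))%:E = (1 - s)%:E * u%:E + s%:E * v%:E)%E.
  by rewrite -!EFinM -EFinD; congr _%:E; ring.
apply: (@le_trans _ _ ((1 - s)%:E * energy a f i + s%:E * energy a g i)%E); last first.
  by apply: leeD; apply: lee_wpmul2l; rewrite ?lee_fin.
rewrite /energy !ge0_sume_distrr;
  [|by move=> l _; exact: integral_ge0|by move=> l _; exact: integral_ge0].
rewrite -big_split /=; apply: lee_sum => l _.
rewrite -!ge0_integralZl ?lee_fin //; [|exact: mW|exact: mW].
rewrite -ge0_integralD //; first last.
- by apply: measurable_funeM; exact: mW.
- by move=> x _; apply: mule_ge0 => //; rewrite lee_fin.
- by apply: measurable_funeM; exact: mW.
- by move=> x _; apply: mule_ge0 => //; rewrite lee_fin.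
apply: ae_ge0_le_integral => //.
- exact: (mW _ (mix s f g) (fun l => (L2 l).1)).
- by move=> x _; apply: adde_ge0; apply: mule_ge0 => //; rewrite lee_fin.
- by apply: emeasurable_funD; apply: measurable_funeM; exact: mW.
apply: filterS2 (L1 l).2 (L2 l).2 => x h1 h2 Dx; rewrite h2 // h1 //.
rewrite -!EFinM -EFinD lee_fin !mulrA -mulrDl ler_wpM2r ?weight_ge0 //.
set p := tr (f l) x; set q := tr (g l) x.
have -> : p + s%:C * (q + -1 * p) = (1 - s)%:C * p + s%:C * q by rewrite rmorphB /=; ring.
apply: (@le_trans _ _ (((1 - s) * cmod p + s * cmod q) ^+ 2)).
  rewrite ler_sqr ?nnegrE ?cmod_ge0 ?addr_ge0 ?mulr_ge0 ?cmod_ge0 //.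
  by apply: le_trans (cmodD _ _) _; rewrite !cmodM !cmod_real !ger0_norm.
have := cmod_ge0 p; have := cmod_ge0 q; set x1 := cmod p; set x2 := cmod q => _ _.
rewrite -subr_ge0 (_ : _ - _ = s * (1 - s) * (x1 - x2) ^+ 2); last by ring.
by rewrite mulr_ge0 ?sqr_ge0 // mulr_ge0.
Qed.

(** [minimax] for the real vectors that dominate some energy vector. They form a convex set because
    the energy is a convex function of the solution, and solutions with an infinite energy are left
    out. *)
Lemma uniform_energy M (a : 'I_M -> 'rV[C]_n) : (0 < M)%N -> (forall m, polydisc (a m)) ->
  exists2 f, solution f & forall i, (energy a f i <= (K ^+ 2 + 1)%:E)%E.
Proof.
move=> M0 aD.
pose V : set ('I_M.+1 -> R) := [set v | (forall i, 0 <= v i) /\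
  exists2 f, solution f & forall i, (energy a f i <= (v i)%:E)%E].
have [||||v [_ [f sf fv]] vK] := @minimax R M V (K ^+ 2) _ _ _ _ 1 ltr01.
- exact: exprn_gt0.
- by move=> v [].
- move=> u v s [u0 [f sf fu]] [v0 [g sg gv]] s01; split.
    by move=> i; have := u0 i; have := v0 i; move: s01 => /andP[? ?] ? ?; nra.
  exists (mix s f g).
    exact: (energy_convex aD sf sg s01 (fu ord0) (gv ord0)).1.
  by move=> i; exact: (energy_convex aD sf sg s01 (fu i) (gv i)).2.
- move=> th th0 th1.
  have thle i : 0 <= th i <= 1.
    rewrite ltW //= -th1 (bigD1 i) //= lerDl; apply: sumr_ge0 => j _; exact: ltW.
  have [f sf fK] := cpp M0 aD thle th1.
  have sE : (\sum_(l < N) sqnorm H a th (f l) = \sum_i (th i)%:E * energy a f i)%E.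
    under eq_bigr do rewrite (sqnormE aD (fun i => ltW (th0 i)) (sf.1 _)).
    rewrite exchange_big /=; apply: eq_bigr => i _; rewrite ge0_sume_distrr // => l _.
    by apply: integral_ge0 => x _; rewrite lee_fin mulr_ge0 ?weight_ge0 ?exprn_ge0 ?cmod_ge0.
  rewrite sE in fK.
  (* All weights are positive, so one infinite energy would make the weighted sum infinite. *)
  have fin i : energy a f i \is a fin_num.
    rewrite ge0_fin_numE ?energy_ge0 // ltey; apply/eqP => eI.
    move: fK; rewrite (bigD1 i) //= eI gt0_muley ?lte_fin // addye ?leye_eq //.
    rewrite -ltNye; apply: lt_le_trans (ltNyr 0) _; apply: sume_ge0 => j _.
    by rewrite mule_ge0 ?energy_ge0 // lee_fin ltW.
  exists (fun i => fine (energy a f i)).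
    split=> [i|]; first by apply: fine_ge0; exact: energy_ge0.
    by exists f => // i; rewrite fineK.
  rewrite -lee_fin -sumEFin; apply: le_trans fK.
  by apply: lee_sum => i _; rewrite EFinM fineK.
- by exists f => // i; apply: le_trans (fv i) _; rewrite lee_fin.
Qed.

Lemma polydisc0 : polydisc (0 : 'rV[C]_n).
Proof. by move=> i; rewrite mxE cmod0. Qed.

(** The energy at [ord0] is the plain norm, needed for local bounds; the energy at the index of [z]
    bounds the value at [z] by [eval_le_weighted]. *)
Lemma solution_on_finite_set (s : seq 'rV[C]_n) : exists2 f, solution f &
  forall l, (\int[mu]_(x in D) (cmod (tr (f l) x) ^+ 2)%:E <= (K ^+ 2 + 1)%:E)%E /\
    forall z, z \in s -> polydisc z -> cmod (f l z) ^+ 2 <= K ^+ 2 + 1.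
Proof.
(* Points outside the polydisc are sent to 0, and nothing is claimed about them. The extra index,
   where [nth] returns its default 0, keeps the number of points positive when [s] is empty. *)
pose b (z : 'rV[C]_n) := if `[< polydisc z >] then z else 0.
have bD z : polydisc (b z) by rewrite /b; case: asboolP => // _; exact: polydisc0.
pose a (m : 'I_(size s).+1) := b (nth 0 s m).
have [f sf fE] := @uniform_energy _ a isT (fun m => bD _).
exists f => // l.
have e1 i : (\int[mu]_(x in D) (cmod (tr (f l) x) ^+ 2 * weight a i x)%:E <= (K ^+ 2 + 1)%:E)%E.
  apply: le_trans (fE i); rewrite /energy (bigD1 l) //= leeDl //.
  apply: sume_ge0 => j _; apply: integral_ge0 => x _.
  by rewrite lee_fin mulr_ge0 ?weight_ge0 ?exprn_ge0 ?cmod_ge0.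
split.
  apply: le_trans (e1 ord0); rewrite le_eqVlt; apply/orP; left; apply/eqP.
  by apply: eq_integral => x _; rewrite /weight unlift_none mulr1.
move=> z zs zD; have := zs; rewrite -index_mem => ls.
pose m : 'I_(size s).+1 := Ordinal (ltnW ls : (index z s < (size s).+1)%N).
have am : a m = z by rewrite /a /= nth_index // /b; case: asboolP.
rewrite -lee_fin -am; apply: le_trans (eval_le_weighted SA (bD _) (sf.1 l)) _.
apply: le_trans (e1 (lift ord0 m)); rewrite le_eqVlt; apply/orP; left; apply/eqP.
by apply: eq_integral => x _; rewrite /weight liftK.
Qed.

(** The norm bound gives local bounds uniform over all finite sets, hence holomorphic ultralimits.
    At a given [z] the value bound holds for every finite set containing [z], and these sets belong
    to the ultrafilter. *)
Lemma bounded_solution : exists2 f : 'I_N -> 'rV[C]_n -> C,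
  forall l, holomorphic (f l) /\ forall z, polydisc z -> cmod (f l z) ^+ 2 <= K ^+ 2 + 1 &
  forall z, polydisc z -> \sum_(l < N) phi l z * f l z = 1.
Proof.
have ex (s : seq 'rV[C]_n) : exists f, solution f /\ forall l,
    (\int[mu]_(x in D) (cmod (tr (f l) x) ^+ 2)%:E <= (K ^+ 2 + 1)%:E)%E /\
    forall z, z \in s -> polydisc z -> cmod (f l z) ^+ 2 <= K ^+ 2 + 1.
  by have [f ? ?] := solution_on_finite_set s; exists f.
have [F hF] := choice ex.
have [U [UU sub]] := ultraFilterLemma (finite_sets_filter_proper _ : ProperFilter (@finite_sets_filter 'rV[C]_n)).
have PU := @ultra_proper _ _ UU.
have K1 : 0 <= K ^+ 2 + 1 by rewrite addr_ge0 ?exprn_ge0 // ltW.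
have lim l : exists f, holomorphic f /\ forall z, polydisc z -> ccvg U (fun s => F s l z) (f z).
  suff lb : forall r : R, r < 1 -> exists B, forall s z, rnorm z <= r -> cmod (F s l z) <= B.
    have [f fh fc] := ultralimit_holomorphic UU (fun s => sa_hol SA ((hF s).1.1 l)) lb.
    by exists f.
  move=> r r1; have [B hB] := sa_loc SA r1; exists (1 + `|B| * (K ^+ 2 + 1)) => s z zr.
  have : cmod (F s l z) ^+ 2 <= `|B| * (K ^+ 2 + 1).
    rewrite -lee_fin; apply: le_trans (hB _ _ ((hF s).1.1 l) zr) _.
    rewrite EFinM; apply: (@le_trans _ _ (`|B|%:E * \int[mu]_(x in D)
      (cmod (tr (F s l) x) ^+ 2)%:E)%E).
      apply: lee_wpmul2r; last by rewrite lee_fin ler_norm.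
      by apply: integral_ge0 => x _; rewrite lee_fin exprn_ge0 ?cmod_ge0.
    by apply: lee_wpmul2l; [rewrite lee_fin|exact: ((hF s).2 l).1].
  by have := cmod_ge0 (F s l z); set x := cmod _ => x0 x2; nra.
have [f hf] := choice lim.
exists f => [l|z zD].
  split=> [|z zD]; first exact: (hf l).1.
  rewrite -[leRHS]sqr_sqrtr // ler_sqr ?nnegrE ?cmod_ge0 ?sqrtr_ge0 //.
  apply: (ccvg_le ((hf l).2 z zD)); apply: sub; exists [:: z] => s sz.
  rewrite -ler_sqr ?nnegrE ?cmod_ge0 ?sqrtr_ge0 // sqr_sqrtr //.
  by apply: ((hF s).2 l).2 => //; apply: sz; rewrite inE.
have h : ccvg U (fun s => \sum_(l < N) phi l z * F s l z) (\sum_(l < N) phi l z * f l z).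
  apply: ccvg_sum => l; apply: ccvgM; first exact: ccvg_cst.
  exact: (hf l).2.
apply: (ccvg_unique h); rewrite (_ : (fun _ => _) = fun=> 1); first exact: ccvg_cst.
by apply/funext => s; exact: (hF s).1.2.
Qed.

End FromConvexPoisson.

Lemma convex_poisson_corona : convex_poisson_property H -> corona_property R n.
Proof.
move=> cpp N c phi dphi; have [K [K0 hK]] := cpp N c phi dphi.
have hK' M (a : 'I_M -> 'rV[C]_n) (theta : 'I_M.+1 -> R) :
    (0 < M)%N -> (forall m, polydisc (a m)) -> (forall m, 0 <= theta m <= 1) ->
    \sum_(m < M.+1) theta m = 1 ->
    exists2 f, solution phi f & (\sum_(l < N) sqnorm H a theta (f l) <= (K ^+ 2)%:E)%E.
  by move=> M0 aD t0 t1; have [f [? ? ?]] := hK M a theta M0 aD t0 t1; exists f.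
have [f fh f1] := bounded_solution K0 hK'.
have K1 : K ^+ 2 + 1 <= (K + 1) ^+ 2 by nra.
exists (K + 1), f; split => //; first exact: addr_gt0.
  move=> l; split; first exact: (fh l).1.
  exists (K + 1) => z zD; rewrite -ler_sqr ?nnegrE ?cmod_ge0 ?addr_ge0 ?(ltW K0) //.
  by apply: le_trans K1; exact: (fh l).2.
move=> z zD; apply/bigmax_leP; split; first exact: exprn_ge0 (addr_ge0 (ltW K0) ler01).
by move=> l _; apply: le_trans K1; exact: (fh l).2.
Qed.

End CoronaEquivalence.

(** * Products of probability spaces *)

Section OpenPreimage.
Context d (T : measurableType d) (R : realType) (n : nat).
Local Notation C := R[i].
Variables (D : set T) (mD : measurable D) (p : T -> 'rV[C]_n).
Hypothesis mp : forall i, cmeas D (fun x => p x ord0 i).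

Definition eps_open (U : set 'rV[C]_n) : Prop :=
  forall z, U z -> exists2 e : R, 0 < e & forall w : 'rV[C]_n,
    (forall i, cmod (w ord0 i - z ord0 i) < e) -> U w.

(* An open set is the union of the rational boxes it contains. *)
Lemma eps_open_preimage U : eps_open U -> measurable (D `&` p @^-1` U).
Proof.
move=> oU; pose Q := ({ffun 'I_n -> rat * rat} * nat)%type.
pose box (q : Q) : set 'rV[C]_n := [set w | forall i,
  `|complex.Re (w ord0 i) - ratr (q.1 i).1| < q.2.+1%:R^-1 /\
  `|complex.Im (w ord0 i) - ratr (q.1 i).2| < q.2.+1%:R^-1].
have mbox q : measurable (D `&` p @^-1` box q).
  have -> : D `&` p @^-1` box q = \bigcap_(i in [set: 'I_n])
     (D `&` (D `&` (fun x => `|complex.Re (p x ord0 i) - ratr (q.1 i).1|) @^-1` `]-oo,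
       q.2.+1%:R^-1[%classic) `&`
      (D `&` (fun x => `|complex.Im (p x ord0 i) - ratr (q.1 i).2|) @^-1` `]-oo,
        q.2.+1%:R^-1[%classic)) `&` D.
    apply/seteqP; split => x.
      move=> [Dx h]; split => // i _; have [h1 h2] := h i.
      by do 2 split => //=; rewrite in_itv /= ?h1 ?h2.
    move=> [h Dx]; split => // i; have [[_ [_ h1]] [_ h2]] := h i I.
    by move: h1 h2; rewrite /= !in_itv.
  apply: measurableI => //; apply: fin_bigcap_measurable; first exact: finite_finset.
  move=> i _; have [mr mi] := mp i.
  have mabs (f : T -> R) (c : R) : measurable_fun D f -> measurable_fun D (fun x => `|f x - c|).
    move=> mf; apply: measurableT_comp => //; apply: measurable_funB => //.
  apply: measurableI; first apply: measurableI => //.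
    exact: mabs.
  exact: mabs.
have -> : D `&` p @^-1` U = \bigcup_q (if `[< box q `<=` U >] then D `&` p @^-1` box q else set0).
  apply/seteqP; split => x.
    move=> [Dx Upx]; have [e e0 he] := oU _ Upx.
    have e4 : 0 < e / 4 by rewrite divr_gt0.
    have [k] := ltr_add_invr e4; rewrite add0r => hk.
    have k0 : 0 < k.+1%:R^-1 :> R by rewrite invr_gt0 ltr0n.
    have rat_near (y : R) : exists q : rat, `|y - ratr q| < k.+1%:R^-1.
      have yk : y < y + k.+1%:R^-1 by rewrite ltrDl.
      have [q] := rat_in_itvoo yk; rewrite in_itv /= => /andP[a b].
      by exists q; rewrite distrC gtr0_norm ?subr_gt0 // ltrBlDl.
    have [qr hqr] := choice (fun i => rat_near (complex.Re (p x ord0 i))).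
    have [qi hqi] := choice (fun i => rat_near (complex.Im (p x ord0 i))).
    pose q : Q := ([ffun i => (qr i, qi i)], k).
    have bx : box q (p x) by move=> i; rewrite /= ffunE /=.
    exists q => //; case: asboolP => // nb; case: nb => w bw; apply: he => i.
    have [w1 w2] := bw i; have [x1 x2] := bx i.
    apply: le_lt_trans (cmod_le_ReIm _) _; rewrite !raddfB /=.
    have -> : complex.Re (w ord0 i) - complex.Re (p x ord0 i) =
      (complex.Re (w ord0 i) - ratr (q.1 i).1) - (complex.Re (p x ord0 i) - ratr (q.1 i).1) by ring.
    have -> : complex.Im (w ord0 i) - complex.Im (p x ord0 i) =
      (complex.Im (w ord0 i) - ratr (q.1 i).2) - (complex.Im (p x ord0 i) - ratr (q.1 i).2) by ring.
    apply: le_lt_trans (lerD (ler_normB _ _) (ler_normB _ _)) _.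
    have -> : e = e / 4 + e / 4 + (e / 4 + e / 4) by field.
    by apply: ltrD; apply: ltrD; apply: lt_trans hk.
  by move=> [q _]; case: asboolP => // bU [Dx bx]; split => //; exact: bU.
apply: countable_bigcupT_measurable; first exact: countableP.
by move=> q; case: asboolP => // _; exact: measurable0.
Qed.

Lemma cmeas_comp (f : 'rV[C]_n -> C) (W : set 'rV[C]_n) : eps_open W ->
  (forall x, D x -> W (p x)) ->
  (forall z, W z -> forall e : R, 0 < e -> exists2 d : R, 0 < d & forall w : 'rV[C]_n,
    (forall i, cmod (w ord0 i - z ord0 i) < d) -> cmod (f w - f z) < e) ->
  cmeas D (fun x => f (p x)).
Proof.
move=> oW DW cf.
have mreal (g : C -> R) : (forall z w, `|g z - g w| <= cmod (z - w)) ->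
    measurable_fun D (fun x => g (f (p x))).
  move=> gl; apply: (measurability _ (RGenOInfty.measurableE R)) => _ [_ [y ->] <-].
  have -> : D `&` (fun x => g (f (p x))) @^-1` `]y, +oo[%classic =
     D `&` p @^-1` (W `&` [set z | y < g (f z)]).
    apply/seteqP; split => x /=; rewrite in_itv /= andbT; first by move=> [Dx]; split => //;
      split => //; exact: DW.
    by move=> [Dx [_]].
  apply: eps_open_preimage => z [Wz yz].
  have e0 : 0 < g (f z) - y by rewrite subr_gt0.
  have [d1 d10 h1] := oW _ Wz; have [d2 d20 h2] := cf _ Wz _ e0.
  exists (Num.min d1 d2); first by rewrite lt_min d10.
  move=> w hw; split; first by apply: h1 => i; apply: lt_le_trans (hw i) _; rewrite ge_min lexx.
  have h2' i : cmod (w ord0 i - z ord0 i) < d2.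
    by apply: lt_le_trans (hw i) _; rewrite ge_min lexx orbT.
  have := h2 w h2'.
  by move=> /(le_lt_trans (gl _ _)); rewrite ltr_norml => /andP[h3 h4]; rewrite /=; lra.
split; apply: mreal => z w; rewrite -raddfB; [exact: Re_le_cmod|exact: Im_le_cmod].
Qed.

Lemma eps_open_polydisc : eps_open (@polydisc R n).
Proof.
move=> z /polydisc_rnorm zD; exists (1 - rnorm z); first by rewrite subr_gt0.
move=> w h i; have := coord_le_rnorm z i; have := h i.
have := cmodD (w ord0 i - z ord0 i) (z ord0 i); rewrite subrK; lra.
Qed.

Lemma cmeas_holomorphic (f : 'rV[C]_n -> C) : holomorphic f ->
  (forall x, D x -> polydisc (p x)) -> cmeas D (fun x => f (p x)).
Proof.
move=> hf Dp; apply: (cmeas_comp eps_open_polydisc Dp) => z /hf.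
exact: continuous_rV_eps.
Qed.

End OpenPreimage.

Lemma integrable_bounded d (T : measurableType d) (R : realType) (mu : {measure set T -> \bar R})
  (D : set T) (g : T -> R) (B : R) : measurable D -> (mu D < +oo)%E -> measurable_fun D g ->
  (forall x, D x -> `|g x| <= B) -> mu.-integrable D (EFin \o g).
Proof.
move=> mD fD mg gB; apply: (@le_integrable _ _ _ _ _ mD _ (EFin \o cst B)).
- exact/measurable_EFinP.
- by move=> x Dx /=; rewrite lee_fin (le_trans (gB _ Dx)) // ler_norm.
apply/integrableP; split; first exact/measurable_EFinP.
by rewrite /= integral_cst // lte_mul_pinfty.
Qed.

Section TupleIntegral.
Context d (T : measurableType d) (R : realType) (P : probability T R).
Local Open Scope ereal_scope.

Lemma measurable_consl n (x : T) :
  measurable_fun setT (fun t : n.-tuple T => tuple_cons (x, t)).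
Proof. exact: (measurableT_comp (@measurable_tuple_cons _ T n) (pair1_measurable x)). Qed.

Lemma ge0_integral_prob_powerS n (F : n.+1.-tuple T -> \bar R) :
  measurable_fun setT F -> (forall t, 0 <= F t) ->
  \int[prob_power P n.+1]_t F t =
  \int[P]_x \int[prob_power P n]_t F (tuple_cons (x, t)).
Proof.
move=> mF F0; rewrite /prob_power -/prob_power.
rewrite (ge0_integral_pushforward (@measurable_tuple_cons _ T n)) //.
rewrite preimage_setT (fubini_tonelli1 (F \o @tuple_cons _ T n)) //.
  exact: (measurableT_comp mF (@measurable_tuple_cons _ T n)).
by move=> x; exact: F0.
Qed.

Lemma measurable_prob_power_inner n (F : n.+1.-tuple T -> \bar R) :
  measurable_fun setT F -> (forall t, 0 <= F t) ->
  measurable_fun setT (fun x => \int[prob_power P n]_t F (tuple_cons (x, t))).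
Proof.
move=> mF F0; apply: (measurable_fun_fubini_tonelli_F (F \o @tuple_cons _ T n)) => //.
  exact: (measurableT_comp mF (@measurable_tuple_cons _ T n)).
by move=> x; exact: F0.
Qed.

Lemma integral_prob_power0 (F : 0.-tuple T -> \bar R) :
  measurable_fun setT F -> \int[prob_power P 0]_t F t = F [tuple].
Proof. by move=> mF; rewrite integral_dirac // diracT mul1e. Qed.

Lemma cint_prob_powerS n (F : n.+1.-tuple T -> R[i]) (B : R) :
  cmeas setT F -> (forall t, (cmod (F t) <= B)%R) ->
  cmeas setT (fun x => cint (prob_power P n) setT (fun t => F (tuple_cons (x, t)))) /\
  cint (prob_power P n.+1) setT F =
  cint P setT (fun x => cint (prob_power P n) setT (fun t => F (tuple_cons (x, t)))).
Proof.
move=> [mr mi] FB.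
have key (g : n.+1.-tuple T -> R) : measurable_fun setT g -> (forall t, (`|g t| <= B)%R) ->
   measurable_fun setT (fun x => (\int[prob_power P n]_(t in setT) g (tuple_cons (x, t)))%R) /\
   (\int[prob_power P n.+1]_(t in setT) g t)%R =
   (\int[P]_(x in setT) (\int[prob_power P n]_(t in setT) g (tuple_cons (x, t))))%R.
  move=> mg gB.
  have mh : measurable_fun setT (g \o @tuple_cons _ T n).
    exact: (measurableT_comp mg (@measurable_tuple_cons _ T n)).
  have ih : (P \x prob_power P n).-integrable setT (EFin \o (g \o @tuple_cons _ T n)).
    apply: (@integrable_bounded _ _ _ _ _ _ B) => //; first by rewrite (_ : _ [set: _] = 1)
      ?ltry //; exact: probability_setT.
    by move=> x _; exact: gB.
  have inner x : (prob_power P n).-integrable setT (EFin \o (fun t => g (tuple_cons (x, t)))).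
    apply: (@integrable_bounded _ _ _ _ _ _ B) => //; first by rewrite (_ : _ [set: _] = 1)
      ?ltry //; exact: probability_setT.
    exact: (measurableT_comp mg (measurable_consl x)).
  have fE x : (\int[prob_power P n]_(t in setT) g (tuple_cons (x, t)))%:E =
     \int[prob_power P n]_t (g (tuple_cons (x, t)))%:E.
    by rewrite /Rintegral fineK //; exact: (integrable_fin_num _ (inner x)).
  split.
    apply/measurable_EFinP; rewrite /comp; under eq_fun do rewrite fE.
    exact: (measurable_fubini_F ih).
  rewrite /Rintegral; congr fine; under [RHS]eq_integral do rewrite fE.
  rewrite /prob_power -/prob_power.
  rewrite (integral_pushforward (@measurable_tuple_cons _ T n)) //=.
  - by rewrite preimage_setT -(integral12_prod_meas1 ih).
  - exact/measurable_EFinP.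
have [m1 e1] := key _ mr (fun t => le_trans (Re_le_cmod _) (FB t)).
have [m2 e2] := key _ mi (fun t => le_trans (Im_le_cmod _) (FB t)).
by split; [split|rewrite /cint e1 e2].
Qed.

End TupleIntegral.

(** * Translations of the line and periodic integrands *)

Section Translation.
Variable R : realType.
Local Notation line := (measurableTypeR R).
Local Notation leb := (@lebesgue_measure R).
Local Open Scope ereal_scope.

Lemma measurable_translation (s : R) : measurable_fun setT (fun x : line => (x + s)%R : line).
Proof. by apply: measurable_funD => //; exact: measurable_cst. Qed.

Lemma integral_translation (s : R) (f : line -> \bar R) :
  measurable_fun setT f -> (forall x, 0 <= f x) ->
  \int[leb]_x f (x + s)%R = \int[leb]_x f x.
Proof.
move=> mf f0; have mT := measurable_translation s.
rewrite [RHS](eq_measure_integral (pushforward leb (fun x : line => (x + s)%R : line))).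
  by rewrite (ge0_integral_pushforward mT) //.
move=> A mA _; apply: lebesgue_measure_unique => //= X [[a b] _ <-] /=.
rewrite /pushforward (_ : _ @^-1` _ = `](a - s)%R, (b - s)%R]%classic); last first.
  by apply/seteqP; split => x /=; rewrite !in_itv /= ltrBlDr lerBrDr.
rewrite !lebesgue_measure_itv /= !lte_fin ltrD2r; case: ifP => // _.
by rewrite -!EFinB; congr EFin; ring.
Qed.

Lemma angle_integral (f : line -> \bar R) : measurable_fun setT f ->
  \int[angle_prob R]_x f x = \int[leb]_(x in `[0%R, 1%R]) f x.
Proof.
move=> mf; rewrite integralE [RHS]integralE !integral_uniform //.
- by rewrite subr0 invr1 !mul1e.
- exact: measurable_funeneg.
- exact: measurable_funepos.
Qed.

Lemma integral_itv_shift (a b u : R) (g : line -> \bar R) : measurable_fun setT g ->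
  (forall x, 0 <= g x) ->
  \int[leb]_(x in `[a, b[) g (x + u)%R = \int[leb]_(x in `[(a + u)%R, (b + u)%R[) g x.
Proof.
move=> mg g0; rewrite integral_mkcond [RHS]integral_mkcond.
rewrite -[RHS](integral_translation u).
- by apply: eq_integral => x _; rewrite !patchE !mem_setE !in_itv /= lerD2r ltrD2r.
- by apply/(measurable_restrictT _ _).1 => //; exact: measurable_funTS.
- by move=> x; rewrite patchE; case: ifP.
Qed.

Lemma integral_itv_split (a b c : R) (g : line -> \bar R) : measurable_fun setT g ->
  (forall x, 0 <= g x) -> (a <= b)%R -> (b <= c)%R ->
  \int[leb]_(x in `[a, c[) g x = \int[leb]_(x in `[a, b[) g x + \int[leb]_(x in `[b, c[) g x.
Proof.
move=> mg g0 ab bc.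
rewrite (@itv_bndbnd_setU _ _ (BLeft a) (BLeft b) (BLeft c)) ?bnd_simp //.
rewrite ge0_integral_setU //.
- exact: measurable_funTS.
- apply/disj_setPS => y [/=]; rewrite !in_itv /= => /andP[_ yb] /andP[yb' _].
  by move: (lt_le_trans yb yb'); rewrite ltxx.
Qed.

(** The shifted interval from [s] to [1 + s] is cut at 1, and its upper part is moved back by one
    period. *)
Lemma angle_integral_periodic (s : R) (f : line -> \bar R) : measurable_fun setT f ->
  (forall x, 0 <= f x) -> (forall x, f (x + 1)%R = f x) -> (0 <= s <= 1)%R ->
  \int[angle_prob R]_x f (x + s)%R = \int[angle_prob R]_x f x.
Proof.
move=> mf f0 f1 /andP[s0 s1].
have mfS (D : set line) (u : R) : measurable_fun D (fun x => f (x + u)%R).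
  by apply: measurable_funTS; apply: (measurableT_comp mf); exact: measurable_translation.
have mfT (D : set line) : measurable_fun D f by exact: measurable_funTS.
rewrite !angle_integral // -!integral_itv_bndo_bndc //.
rewrite integral_itv_shift // add0r (@integral_itv_split _ 1%R)
  // ?lerDl // [RHS](@integral_itv_split _ s) // addeC; congr (_ + _).
transitivity (\int[leb]_(x in `[0%R, s[) f (x + 1)%R); last by apply: eq_integral.
by rewrite integral_itv_shift // add0r [in RHS]addrC.
all: by [exact: mfT|exact: mfS].
Qed.

End Translation.

(** * The Bergman space *)

Section DiscMean.
Variable R : realType.
Local Notation C := R[i].
Local Notation line := (measurableTypeR R).
Local Notation plane := (line * line)%type.
Local Notation leb := (@lebesgue_measure R).

Lemma rcont_cmeas (u : line -> C) : (forall t, rcont u t) -> cmeas setT u.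
Proof.
move=> cu; split; apply: continuous_measurable_fun => t.
  by have /rcontP := cu t; exact: cvg_Re.
by have /rcontP := cu t; exact: cvg_Im.
Qed.

(* Cauchy's formula for [g ^+ 2] bounds [|g a|^2] without any use of the Cauchy-Schwarz
   inequality. *)
Lemma circle_sub_mean (g : C -> C) (a b : C) (p s : R) : s < p -> cmod (a - b) <= s ->
  (forall z, cmod (z - b) <= p -> cdiff g z) ->
  ((cmod (g a) ^+ 2)%:E <=
    (p / (p - s))%:E * \int[angle_prob R]_t (cmod (g (b + p%:C * expi t)) ^+ 2)%:E)%E.
Proof.
move=> sp ab dg; pose F z := g z * g z.
have p0 : 0 < p by apply: le_lt_trans sp; apply: le_trans ab; exact: cmod_ge0.
have ps : 0 < p - s by rewrite subr_gt0.
have dF z : cmod (z - b) <= p -> cdiff F z by move=> h; apply: cdiffM; exact: dg.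
have abp : cmod (a - b) < p by exact: le_lt_trans ab sp.
have cu t : rcont (fun t => g (b + p%:C * expi t)) t by apply: circle_rcont (ltW p0) dg.
have cF t : rcont (fun t => F (b + p%:C * expi t)) t by apply: circle_rcont (ltW p0) dF.
have mm : measurable_fun setT (fun t : line => cmod (g (b + p%:C * expi t)) ^+ 2).
  by apply: cmeas_cmod2; exact: rcont_cmeas.
have lb t : p - s <= cmod (b + p%:C * expi t - a).
  have -> : b + p%:C * expi t - a = p%:C * expi t - (a - b) by ring.
  have := cmodB_ge (p%:C * expi t) (a - b).
  rewrite cmodM cmod_expi cmod_real mulr1 (gtr0_norm p0); lra.
have nz t : b + p%:C * expi t - a != 0.
  by rewrite -cmod_eq0 gt_eqF // (lt_le_trans _ (lb t)).
have cK : seg_cont 0 1 (fun t => F (b + p%:C * expi t) *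
           (p%:C * expi t / (b + p%:C * expi t - a))).
  move=> t _; apply: rcontM; first exact: cF.
  apply: rcontM; first by exact: rcont_circle.
  apply: rcontV => //; apply: rcontB; last exact: rcont_cst.
  by apply: rcontD; [exact: rcont_cst|exact: rcont_circle].
rewrite angle_integral; last exact/measurable_EFinP.
have -> : cmod (g a) ^+ 2 = cmod (F a) by rewrite cmodM.
rewrite (cauchy_circle abp dF).
have mI : measurable (`[0, 1] : set line) by [].
apply: le_trans (le_cmod_cint mI (seg_cintegrable cK)) _.
rewrite -ge0_integralZl //.
- apply: ge0_le_integral => //.
  + by move=> x _; rewrite lee_fin cmod_ge0.
  + by apply/measurable_EFinP; apply: cmeas_cmod; exact: cintegrable_cmeas (seg_cintegrable cK).
  + by apply: measurable_funeM; apply/measurable_EFinP; exact: measurable_funTS.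
  move=> t _; rewrite -EFinM lee_fin !cmodM -expr2 mulrC ler_wpM2r ?exprn_ge0 ?cmod_ge0 //.
  rewrite cmod_expi cmod_real mulr1 (gtr0_norm p0) cmodV; apply: ler_wpM2l; first exact: ltW.
  by rewrite lef_pV2 ?posrE // (lt_le_trans _ (lb t)).
- by apply/measurable_EFinP; exact: measurable_funTS.
- by move=> x _; rewrite lee_fin exprn_ge0 ?cmod_ge0.
- by rewrite lee_fin divr_ge0 // ltW.
Qed.

Lemma plane_translation (s t : R) (G : plane -> \bar R) : measurable_fun setT G ->
  (forall p, 0 <= G p)%E ->
  (\int[leb \x leb]_p G ((p.1 : R) + s, (p.2 : R) + t)%R = \int[leb \x leb]_p G p)%E.
Proof.
move=> mG G0.
have mT : measurable_fun setT (fun p : plane => ((p.1 : R) + s, (p.2 : R) + t)%R : plane).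
  by apply: measurable_fun_pair;
    [exact: (measurableT_comp (measurable_translation s) measurable_fst)|
     exact: (measurableT_comp (measurable_translation t) measurable_snd)].
rewrite (fubini_tonelli1 (fun p : plane => G ((p.1 : R) + s, (p.2 : R) + t)%R)
  (measurableT_comp mG mT) (fun=> G0 _)).
rewrite (fubini_tonelli1 G mG G0) /fubini_F /=.
rewrite -[RHS](integral_translation s); last 2 first.
- exact: measurable_fun_fubini_tonelli_F.
- by move=> x; apply: integral_ge0 => y _.
apply: eq_integral => x _.
rewrite (integral_translation t (f := fun y => G ((x : R) + s, y)%R)) //.
exact: (measurableT_comp mG (pair1_measurable _)).
Qed.

Lemma plane_sigma_finite : sigma_finite setT (leb \x leb)%E.
Proof.
have mI (c d : R) : measurable (`[c, d] : set line) by [].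
exists (fun n => `[- n%:R : R, n%:R]%classic `*` `[- n%:R : R, n%:R]%classic).
  apply/esym/seteqP; split => // -[x y] _.
  have M0 : 0 <= Num.max `|x : R| `|y : R| by rewrite le_max normr_ge0.
  have hn := archi_boundP M0; set n := Num.bound _ in hn.
  by exists n => //=; rewrite !in_itv /= -!ler_norml; move: hn; rewrite gt_max =>
    /andP[/ltW ? /ltW ?].
move=> n; split; first exact: measurableX.
rewrite (product_measure1E _ _ (mI _ _) (mI _ _)).
have h : (leb (`[(- n%:R : R)%R, (n%:R : R)%R]%classic : set line)
  < +oo)%E by rewrite lebesgue_measure_itv /=; case: ifP => // _; rewrite -EFinB ltry.
by rewrite lte_mul_pinfty // ge0_fin_numE.
Qed.
(** Carries the sigma-finite structure that Tonelli's theorem between plane and circle asks for. *)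
Definition plane_measure : {sigma_finite_measure set plane -> \bar R} :=
  HB.pack (leb \x leb)%E (Measure_isSigmaFinite.Build _ _ _ (leb \x leb)%E plane_sigma_finite).

Definition cplx (p : plane) : C := (p.1 : R) +i* (p.2 : R).

(** Squares inside and around the disc show that its area is positive and finite, which turns
    [mnormalize] into multiplication by a constant. *)
Lemma disc_area : exists2 A : R, 0 < A & (leb \x leb)%E (@unit_disc R) = A%:E.
Proof.
have mD := @measurable_unit_disc R.
have mI (a b : R) : measurable (`[a, b] : set line) by [].
have lI (a b : R) : a <= b -> (leb (`[a, b]%classic : set line) = (b - a)%:E).
  by rewrite lebesgue_measure_itv /= lte_fin le_eqVlt => /orP[/eqP ->|->]; rewrite ?ltxx ?subrr.
have le4 : ((leb \x leb)%E (@unit_disc R) <= (2 * 2)%:E)%E.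
  have <- : (leb \x leb)%E (`[(-1 : R), (1 : R)]%classic `*` `[(-1 : R), (1 : R)]%classic)
    = (2 * 2)%:E.
    apply: etrans (product_measure1E _ _ (mI _ _) (mI _ _)) _.
    have I11 : (-1 : R) <= 1 by lra.
    by apply: etrans (congr2 mule (lI _ _ I11) (lI _ _ I11)) _; rewrite -EFinM; congr EFin; ring.
  apply: le_measure; rewrite ?inE //; first exact: measurableX.
  move=> p; rewrite /unit_disc /= => h; rewrite !in_itv /= -!ler_norml.
  split; [have := Re_le_cmod (cplx p)|have := Im_le_cmod (cplx p)] => /=; rewrite /cplx /=; lra.
have ge1 : ((1 / 2 * (1 / 2) : R)%:E <= (leb \x leb)%E (@unit_disc R))%E.
  have <- : (leb \x leb)%E (`[0, 1 / 2]%classic `*` `[0, 1 / 2]%classic) = (1 / 2 * (1 / 2) : R)%:E.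
    apply: etrans (product_measure1E _ _ (mI _ _) (mI _ _)) _.
    have I02 : (0 : R) <= 1 / 2 by lra.
    by apply: etrans (congr2 mule (lI _ _ I02) (lI _ _ I02)) _; rewrite -EFinM; congr EFin; ring.
  apply: le_measure; rewrite ?inE //; first exact: measurableX.
  move=> [x y] /=; rewrite /unit_disc /= !in_itv /= => -[/andP[x0 x1] /andP[y0 y1]].
  rewrite -[ltRHS]sqrtr1 ltr_sqrt //; nra.
have fN : (leb \x leb)%E (@unit_disc R) \is a fin_num.
  by rewrite ge0_fin_numE // (le_lt_trans le4) ?ltry.
exists (fine ((leb \x leb)%E (@unit_disc R))); last by rewrite fineK.
by rewrite -lte_fin fineK // (lt_le_trans _ ge1) // lte_fin mulr_gt0 ?divr_gt0.
Qed.

Lemma disc_integral : exists2 A : R, 0 < A & forall F : plane -> \bar R,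
  measurable_fun (@unit_disc R) F -> (forall p, 0 <= F p)%E ->
  (\int[leb \x leb]_(p in @unit_disc R) F p =
    A%:E * \int[disc_prob R]_(p in @unit_disc R) F p)%E.
Proof.
have [A A0 EA] := disc_area; exists A => // F mF F0.
have Ai : 0 <= A^-1 by rewrite invr_ge0 ltW.
have -> : (\int[disc_prob R]_(p in @unit_disc R) F p =
   \int[mscale (NngNum Ai) (leb \x leb)]_(p in @unit_disc R) F p)%E.
  apply: eq_measure_integral => X mX XD.
  rewrite /disc_prob /= /mnormalize /= /mrestr setTI EA.
  rewrite eqe gt_eqF //= setIidl // /mscale /= muleC //.
have mD := @measurable_unit_disc R.
rewrite [X in (_ * X)%E]ge0_integral_mscale //= muleA -EFinM divff ?mul1e // gt_eqF //.
Qed.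

(** Instead of polar coordinates: the circle inequality with a fixed radius [p] is averaged over the
    centres [a + q], with [q] in a small square. After exchanging integrals, each angle contributes
    a translate of the area integral. *)
Lemma disc_local (r : R) : r < 1 -> exists2 K : R, 0 <= K & forall (g : C -> C) (a : C),
  (forall z, cmod z < 1 -> cdiff g z) ->
  measurable_fun (@unit_disc R) (fun p => cmod (g (cplx p)) ^+ 2) -> cmod a <= r ->
  ((cmod (g a) ^+ 2)%:E <=
    K%:E * \int[disc_prob R]_(p in @unit_disc R) (cmod (g (cplx p)) ^+ 2)%:E)%E.
Proof.
move=> r1; have [A A0 EA] := disc_integral.
(* [q] in the square of side [h = p / 4] has modulus at most [p / 2], so the discs of radius [p]
   about [a + q] stay in the unit disc, and the constant of [circle_sub_mean] is
   [p / (p - p / 2) = 2]. *)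
pose p := (1 - r) / 2; have p0 : 0 < p by rewrite divr_gt0 // subr_gt0.
pose h := p / 4; have h0 : 0 < h by rewrite divr_gt0.
exists (2 * A / h ^+ 2); first by apply: divr_ge0;
  [apply: mulr_ge0 => //; exact: ltW|apply: exprn_ge0; exact: ltW].
move=> g a dg mg ar; have mD := @measurable_unit_disc R.
pose G : plane -> \bar R := (fun q => (cmod (g (cplx q)) ^+ 2)%:E) \_ (@unit_disc R).
have mG : measurable_fun setT G.
  by apply/(measurable_restrictT _ _).1 => //; apply/measurable_EFinP.
have G0 q : (0 <= G q)%E by rewrite /G patchE; case: ifP => // _;
  rewrite lee_fin exprn_ge0 ?cmod_ge0.
pose u (t : R) : R := complex.Re (a + p%:C * expi t).
pose v (t : R) : R := complex.Im (a + p%:C * expi t).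
have [mu mv] : cmeas setT (fun t : line => a + p%:C * expi t).
  by apply: rcont_cmeas => t; apply: rcontD; [exact: rcont_cst|exact: rcont_circle].
pose Phi (x : plane * line) : \bar R := G (((x.1.1 : R) + u x.2)%R, ((x.1.2 : R) + v x.2)%R).
have mPhi : measurable_fun setT Phi.
  apply: (measurableT_comp mG); apply: measurable_fun_pair; apply: measurable_funD.
  - exact: (measurableT_comp measurable_fst measurable_fst).
  - exact: (measurableT_comp mu measurable_snd).
  - exact: (measurableT_comp measurable_snd measurable_fst).
  - exact: (measurableT_comp mv measurable_snd).
have mI (c d : R) : measurable (`[c, d] : set line) by [].
pose Q : set plane := `[0, h]%classic `*` `[0, h]%classic.
have mQ : measurable Q by exact: measurableX.
have Qarea : (leb \x leb)%E Q = (h ^+ 2)%:E.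
  apply: etrans (product_measure1E _ _ (mI _ _) (mI _ _)) _.
  have hI : leb (`[0, h]%classic : set line) = h%:E.
    by rewrite lebesgue_measure_itv /= lte_fin h0 sube0.
  by apply: etrans (congr2 mule hI hI) _; rewrite -EFinM.
have mean q : Q q -> ((cmod (g a) ^+ 2)%:E <= 2%:E * \int[angle_prob R]_t Phi (q, t))%E.
  move=> [] /=; rewrite !in_itv /= => /andP[q10 q1h] /andP[q20 q2h].
  have qh : cmod (cplx q) <= p / 2.
    apply: le_trans (cmod_le_ReIm _) _; rewrite /cplx /= !ger0_norm //.
    by apply: le_trans (lerD q1h q2h) _; rewrite /h; lra.
  have ins z : cmod (z - (a + cplx q)) <= p -> cmod z < 1.
    move=> hz; have -> : z = (z - (a + cplx q)) + (a + cplx q) by ring.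
    have := cmodD (z - (a + cplx q)) (a + cplx q); have := cmodD a (cplx q).
    by move: ar qh hz r1; rewrite /p; lra.
  have aq : cmod (a - (a + cplx q)) <= p / 2.
    by rewrite opprD addrA subrr add0r cmodN.
  have p2 : p / 2 < p by lra.
  apply: le_trans (circle_sub_mean p2 aq (fun z hz => dg z (ins z hz))) _.
  have -> : p / (p - p / 2) = 2.
    have nz : p - p / 2 != 0 by rewrite gt_eqF // subr_gt0.
    by apply: (mulIf nz); rewrite divfK //; lra.
  apply: lee_wpmul2l; first by rewrite lee_fin.
  rewrite le_eqVlt; apply/orP; left; apply/eqP; apply: eq_integral => t _.
  have inD : cmod (a + cplx q + p%:C * expi t) < 1.
    apply: ins; rewrite addrAC subrr add0r cmodM cmod_expi cmod_real mulr1 gtr0_norm //.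
  have cE : a + cplx q + p%:C * expi t = cplx ((q.1 : R) + u t, (q.2 : R) + v t).
    rewrite /u /v; case: (a) => a1 a2; case: (expi t) => e1 e2; rewrite /cplx /=.
    by apply/eqP; rewrite eq_complex /=; apply/andP; split; apply/eqP; ring.
  have inD' : unit_disc ((q.1 : R) + u t, (q.2 : R) + v t)%R by move: inD; rewrite cE.
  by rewrite /Phi /= /G patchE mem_set // cE.
have total : ((h ^+ 2)%:E * (cmod (g a) ^+ 2)%:E <=
    2%:E * (A%:E * \int[disc_prob R]_(q in @unit_disc R) (cmod (g (cplx q)) ^+ 2)%:E))%E.
  rewrite -EA; last 2 first.
  - exact/measurable_EFinP.
  - by move=> q; rewrite lee_fin exprn_ge0 ?cmod_ge0.
  have mI2 : measurable_fun setT (fun q : plane => \int[angle_prob R]_t Phi (q, t))%E.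
    apply: (@measurable_fun_fubini_tonelli_F _ _ _ _ _ (angle_prob R) Phi) => //.
    by move=> x; exact: G0.
  have I20 (q : plane) : (0 <= \int[angle_prob R]_t Phi (q, t))%E.
    by apply: integral_ge0 => t _; exact: G0.
  apply: (@le_trans _ _ (\int[leb \x leb]_(q in Q) (2%:E * \int[angle_prob R]_t Phi (q, t))%E)%E).
    rewrite muleC -Qarea -integral_cst //; apply: ge0_le_integral => //.
    - by move=> q _; rewrite lee_fin exprn_ge0 ?cmod_ge0.
    - by apply: measurable_funeM; exact: measurable_funTS.
  rewrite ge0_integralZl //; last exact: measurable_funTS.
  apply: lee_wpmul2l; first by rewrite lee_fin.
  apply: (@le_trans _ _ (\int[leb \x leb]_q \int[angle_prob R]_t Phi (q, t))%E).
    by apply: ge0_subset_integral.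
  have FT := @fubini_tonelli _ _ _ _ _ plane_measure (angle_prob R) Phi mPhi (fun x => G0 _).
  apply: le_trans (_ : _ <= \int[angle_prob R]_t \int[leb \x leb]_q Phi (q, t))%E _.
    by rewrite le_eqVlt; apply/orP; left; apply/eqP; exact: FT.
  (* At a fixed angle the integral over all centres is a translate of the integral of [G]. *)
  rewrite (eq_integral (fun=> \int[leb \x leb]_q G q)%E); last first.
    by move=> t _; rewrite -[RHS](plane_translation (u t) (v t)).
  rewrite integral_cst // (_ : _ [set: _] = 1%E); last exact: probability_setT.
  by rewrite mule1 [in leRHS]integral_mkcond.
have hh : 0 < h ^+ 2 by rewrite exprn_gt0.
have -> : 2 * A / h ^+ 2 = (h ^+ 2)^-1 * (2 * A) by rewrite mulrC.
have -> : (cmod (g a) ^+ 2)%:E = ((h ^+ 2)^-1%:E * ((h ^+ 2)%:E * (cmod (g a) ^+ 2)%:E))%E.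
  by rewrite -!EFinM mulKf // gt_eqF.
rewrite [X in (_ <= X * _)%E]EFinM -[leRHS]muleA.
apply: lee_wpmul2l; first by rewrite lee_fin invr_ge0 ltW.
by rewrite [X in (_ <= X * _)%E]EFinM -[leRHS]muleA.
Qed.

End DiscMean.

(** * Slices in the first coordinate and local bounds on the polydisc *)

Section Slices.
Variable R : realType.
Local Notation C := R[i].
Local Notation line := (measurableTypeR R).
Local Notation plane := (line * line)%type.

Definition vcons n (x : C) (w : 'rV[C]_n) : 'rV[C]_n.+1 :=
  \row_i (if unlift ord0 i is Some j then w ord0 j else x).

Definition vtail n (z : 'rV[C]_n.+1) : 'rV[C]_n := \row_j z ord0 (lift ord0 j).

Lemma vcons0 n x (w : 'rV[C]_n) : vcons x w ord0 ord0 = x.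
Proof. by rewrite mxE unlift_none. Qed.

Lemma vconsS n x (w : 'rV[C]_n) j : vcons x w ord0 (lift ord0 j) = w ord0 j.
Proof. by rewrite mxE liftK. Qed.

Lemma vcons_eta n (z : 'rV[C]_n.+1) : vcons (z ord0 ord0) (vtail z) = z.
Proof.
apply/rowP => i; case: (unliftP ord0 i) => [j|] ->; last by rewrite vcons0.
by rewrite vconsS mxE.
Qed.

Lemma polydisc_vcons n x (w : 'rV[C]_n) : polydisc (vcons x w) <-> cmod x < 1 /\ polydisc w.
Proof.
split=> [h|[hx hw] i].
  by split=> [|j]; [have := h ord0; rewrite vcons0|have := h (lift ord0 j); rewrite vconsS].
by case: (unliftP ord0 i) => [j|] ->; rewrite ?vcons0 ?vconsS.
Qed.

Lemma cdiff_vcons n (f : 'rV[C]_n.+1 -> C) w x : holomorphic f -> polydisc w -> cmod x < 1 ->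
  cdiff (fun y => f (vcons y w)) x.
Proof.
move=> hf hw hx.
have E y : vcons y w = vcons 0 w + y *: vcons 1 0.
  apply/rowP => i; rewrite mxE; case: (unliftP ord0 i) => [j|] -> /=;
    rewrite [RHS]mxE [X in _ + X]mxE !mxE ?liftK ?unlift_none ?mxE; first by rewrite mulr0 addr0.
  by rewrite mulr1 add0r.
rewrite (_ : (fun y => _) = (fun y => f (vcons 0 w + y *: vcons 1 0))).
  apply: cdiff_slice; rewrite -E; apply: hf; exact/polydisc_vcons.
by apply/funext => y; rewrite E.
Qed.

Lemma vcons_is_linear n : linear (@vcons n 0).
Proof.
move=> c u v; apply/rowP => i; rewrite !mxE.
by case: (unliftP ord0 i) => [j|] _ /=; rewrite ?mxE // mulr0 addr0.
Qed.

Lemma holomorphic_slice n (f : 'rV[C]_n.+1 -> C) x : holomorphic f -> cmod x < 1 ->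
  holomorphic (fun w => f (vcons x w)).
Proof.
move=> hf hx z hz.
have /hf/diff_epsP[L cL hL] : polydisc (vcons x z) by apply/polydisc_vcons.
pose V : {linear 'rV[C]_n -> 'rV[C]_n.+1} :=
  HB.pack (@vcons n 0) (GRing.isLinear.Build _ _ _ _ _ (@vcons_is_linear n)).
have VE v : rnorm (V v) <= rnorm v.
  apply: rnorm_rV_le; first exact: rnorm_ge0.
  move=> i; case: (unliftP ord0 i) => [j|] ->; last by rewrite vcons0 cmod0 rnorm_ge0.
  by rewrite vconsS coord_le_rnorm.
have cV : continuous V by apply: (@linear_le_continuous _ _ _ _ 1) => v; rewrite mul1r.
apply/diff_epsP; exists (L \o V).
  by move=> v; apply: continuous_comp; [exact: cV|exact: cL].
move=> e e0; have [d d0 h] := hL _ e0; exists d => // v vd.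
have -> : vcons x (v + z) = V v + vcons x z.
  have -> : V v = vcons 0 v by [].
  apply/rowP => i; rewrite mxE.
  case: (unliftP ord0 i) => [j|] ->.
    by rewrite [RHS]mxE !vconsS mxE.
  by rewrite [RHS]mxE !vcons0 add0r.
apply: le_trans (h _ (le_lt_trans (VE v) vd)) _.
by apply: ler_wpM2l; [exact: ltW|exact: VE].
Qed.

Lemma disc_point_cons n (x : plane) (t : n.-tuple plane) :
  disc_point (tuple_cons (x, t)) = vcons (cplx x) (disc_point t).
Proof.
apply/rowP => i; rewrite mxE; case: (unliftP ord0 i) => [j|] ->.
  by rewrite vconsS mxE tnthS.
by rewrite vcons0 tnth0.
Qed.

Lemma torus_point_cons n (x : line) (t : n.-tuple line) :
  torus_point (tuple_cons (x, t)) = vcons (expi x) (torus_point t).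
Proof.
apply/rowP => i; rewrite mxE; case: (unliftP ord0 i) => [j|] ->.
  by rewrite vconsS mxE tnthS.
by rewrite vcons0 tnth0.
Qed.

Lemma bergman_dom_cons n (x : plane) (t : n.-tuple plane) :
  bergman_dom (tuple_cons (x, t)) <-> unit_disc x /\ bergman_dom t.
Proof. by rewrite /bergman_dom /= disc_point_cons; exact: polydisc_vcons. Qed.

Lemma cmeas_disc_point n (D : set (n.-tuple plane)) i :
  cmeas D (fun p => disc_point p ord0 i).
Proof.
have m : measurable_fun D (fun p : n.-tuple plane => tnth p i).
  by apply: measurable_funTS; exact: measurable_tnth.
split; under eq_fun do rewrite mxE.
  exact: (measurableT_comp measurable_fst m).
exact: (measurableT_comp measurable_snd m).
Qed.

Lemma measurable_bergman_dom n : measurable (@bergman_dom R n).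
Proof.
rewrite (_ : @bergman_dom R n = setT `&` (@disc_point R n) @^-1` (@polydisc R n));
  last by rewrite setTI.
by apply: (eps_open_preimage measurableT (cmeas_disc_point _) (@eps_open_polydisc R n)).
Qed.

Lemma cmeas_bergman n (f : 'rV[C]_n -> C) : holomorphic f ->
  cmeas (@bergman_dom R n) (fun p => f (disc_point p)).
Proof.
by move=> hf; apply: (@cmeas_holomorphic _ _ R n _ (@measurable_bergman_dom n) (@disc_point R n)
  (cmeas_disc_point _) f hf).
Qed.

(** [disc_local] in the first coordinate and induction in the others. For [n = 0] there is a single
    point and the inequality is an equality. *)
Lemma polydisc_local (r : R) n : r < 1 -> exists2 K : R, 0 <= K &
  forall (f : 'rV[C]_n -> C) z, holomorphic f -> rnorm z <= r ->
  ((cmod (f z) ^+ 2)%:E <= K%:E * \int[prob_power (disc_prob R) n]_(p in @bergman_dom R n)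
     (cmod (f (disc_point p)) ^+ 2)%:E)%E.
Proof.
move=> r1; elim: n => [|n [K K0 IH]].
  exists 1 => // f z hf _; rewrite mul1e integral_mkcond.
  have mb := @measurable_bergman_dom 0%N.
  rewrite integral_prob_power0; last first.
    by apply/(measurable_restrictT _ _).1 => //; apply/measurable_EFinP;
      exact: (cmeas_cmod2 (cmeas_bergman hf)).
  rewrite patchE mem_set; last by move=> [].
  by rewrite (_ : disc_point _ = z) //; apply/rowP => -[].
have [K1 K10 H1] := disc_local r1.
exists (K1 * K); first exact: mulr_ge0.
move=> f z hf zr.
have r0 := le_trans (rnorm_ge0 z) zr.
have zr0 : cmod (z ord0 ord0) <= r := le_trans (coord_le_rnorm _ _) zr.
have wr : rnorm (vtail z) <= r.
  by apply: rnorm_rV_le => // i; rewrite mxE; apply: le_trans (coord_le_rnorm _ _) zr.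
have wD : polydisc (vtail z) by apply: rnorm_polydisc; exact: le_lt_trans wr r1.
have mb := @measurable_bergman_dom n.+1; have mbn := @measurable_bergman_dom n.
have md := @measurable_unit_disc R.
pose F := (fun p => (cmod (f (disc_point p)) ^+ 2)%:E) \_ (@bergman_dom R n.+1).
have mF : measurable_fun setT F.
  by apply/(measurable_restrictT _ _).1 => //; apply/measurable_EFinP;
    exact: (cmeas_cmod2 (cmeas_bergman hf)).
have F0 p : (0 <= F p)%E by rewrite /F patchE; case: ifP => // _;
  rewrite lee_fin exprn_ge0 ?cmod_ge0.
rewrite [in leRHS]integral_mkcond ge0_integral_prob_powerS //.
pose J (x : plane) := (\int[prob_power (disc_prob R) n]_t F (tuple_cons (x, t)))%E.
have mJ : measurable_fun setT J by exact: measurable_prob_power_inner.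
have J0 x : (0 <= J x)%E by apply: integral_ge0 => t _.
have HJ x : unit_disc x -> ((cmod (f (vcons (cplx x) (vtail z))) ^+ 2)%:E <= K%:E * J x)%E.
  move=> hx; apply: le_trans (IH (fun w => f (vcons (cplx x) w)) _ _ wr) _.
    exact: holomorphic_slice.
  apply: lee_wpmul2l; first by rewrite lee_fin.
  rewrite le_eqVlt; apply/orP; left; apply/eqP; rewrite integral_mkcond.
  apply: eq_integral => t _; rewrite /F !patchE disc_point_cons.
  have [h|h] := boolP (t \in _).
    by rewrite mem_set //; apply/bergman_dom_cons; split => //; exact: set_mem.
  rewrite memNset // => /bergman_dom_cons[_ /mem_set]; exact/negP.
have dg y : cmod y < 1 -> cdiff (fun y => f (vcons y (vtail z))) y.
  by move=> hy; exact: cdiff_vcons.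
have mg : measurable_fun (@unit_disc R) (fun p => cmod (f (vcons (cplx p) (vtail z))) ^+ 2).
  apply: cmeas_cmod2.
  apply: (cmeas_holomorphic (p := fun x : plane => vcons (cplx x) (vtail z)) md _ hf).
    move=> i; case: (unliftP ord0 i) => [j|] ->.
      by rewrite (_ : (fun x => _) = fun=> vtail z ord0 j);
        [exact: cmeas_cst|apply/funext => x; rewrite vconsS].
    split; under eq_fun do rewrite vcons0; apply: measurable_funTS;
      [exact: measurable_fst|exact: measurable_snd].
  by move=> x hx; apply/polydisc_vcons.
have := H1 _ _ dg mg zr0; rewrite vcons_eta => /le_trans; apply.
rewrite EFinM -muleA; apply: lee_wpmul2l; first by rewrite lee_fin.
rewrite -ge0_integralZl //; last by move=> x _; exact: J0.
apply: (@le_trans _ _ (\int[disc_prob R]_(x in @unit_disc R) (K%:E * J x)%E)%E).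
  apply: (ge0_le_integral _ md).
  - by move=> x _; rewrite lee_fin exprn_ge0 ?cmod_ge0.
  - exact/measurable_EFinP.
  - by apply: measurable_funeM; exact: measurable_funTS.
  - exact: HJ.
apply: (ge0_subset_integral _ md measurableT) => [||//].
- exact: measurable_funeM.
- by move=> x _; rewrite mule_ge0 ?lee_fin.
Qed.

End Slices.

Section HolomorphicAlgebra.
Variables (R : realType) (n : nat).
Local Notation C := R[i].
Implicit Types f g : 'rV[C]_n -> C.

Lemma holomorphicM f g : holomorphic f -> holomorphic g -> holomorphic (fun z => f z * g z).
Proof. by move=> hf hg z zD; exact: (differentiableM (hf z zD) (hg z zD)). Qed.

Lemma holomorphic_lin f g (c : C) : holomorphic f -> holomorphic g ->
  holomorphic (fun z => f z + c * g z).
Proof.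
move=> hf hg z zD.
exact: (differentiableD (hf z zD) (holomorphicM (@holomorphic_cst R n c) hg zD)).
Qed.

End HolomorphicAlgebra.

(** * The Bergman kernel *)

Section BergmanAxioms.
Variables (R : realType) (n : nat).
Local Notation C := R[i].
Local Notation H := (bergman_space R n).
Local Notation mu := (prob_power (disc_prob R) n).
Local Notation D := (@bergman_dom R n).
Local Notation dp := (@disc_point R n).
Implicit Types f g : 'rV[C]_n -> C.

Let mD : measurable D := @measurable_bergman_dom R n.

Let sq f := sqint mu D (fun p => f (dp p)).

Lemma bergman_memE f : bergman_mem f <-> holomorphic f /\ sq f.
Proof.
by split=> [[hf ff]|[hf [_ ff]]]; do 2?split => //; exact: cmeas_bergman.
Qed.

Lemma bergman_lin f g (c : C) : bergman_mem f -> bergman_mem g ->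
  bergman_mem (fun z => f z + c * g z).
Proof.
move=> /bergman_memE[hf sf] /bergman_memE[hg sg]; apply/bergman_memE; split.
  exact: holomorphic_lin.
exact: (sqint_lin mD c sf sg).
Qed.

Lemma bergman_bounded f (B : R) : holomorphic f ->
  (forall z, polydisc z -> cmod (f z) <= B) -> bergman_mem f.
Proof.
move=> hf fB; apply/bergman_memE; split => //.
apply: (@sqint_dom _ _ _ _ _ mD _ (fun=> B ^+ 2)); first exact: cmeas_bergman.
  apply: (@integrable_bounded _ _ _ _ _ _ `|B ^+ 2|) => //.
  by rewrite (le_lt_trans (probability_le1 _ mD)) ?ltry.
by move=> x Dx; rewrite ler_pXn2r ?nnegrE ?cmod_ge0 ?(le_trans (cmod_ge0 _) (fB _ Dx)) ?fB.
Qed.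

Lemma bergman0 : bergman_mem ((fun=> 0) : 'rV[C]_n -> C).
Proof. by apply: (@bergman_bounded _ 0); [exact: holomorphic_cst|move=> z _; rewrite cmod0]. Qed.

Lemma bergman_ext f g : f =1 g -> bergman_mem f -> bergman_mem g.
Proof. by move=> /funext ->. Qed.

Let N f : R := normsq mu D (fun p => f (dp p)).

Lemma bergman_local (r : R) : r < 1 -> exists2 K : R, 0 <= K & forall f z,
  bergman_mem f -> rnorm z <= r -> cmod (f z) ^+ 2 <= K * N f.
Proof.
move=> r1; have [K K0 h] := polydisc_local n r1; exists K => // f z /bergman_memE[hf sf] zr.
by have := h _ _ hf zr; rewrite (normsqE sf) -EFinM lee_fin.
Qed.

(** A minimizing sequence for the square norm under [f a = 1] is Cauchy by the parallelogram law;
    local bounds turn this into pointwise convergence, and Fatou's lemma shows that the limit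
    attains the infimum [d]. The kernel is this minimizer divided by [d]. *)
Lemma bergman_kernel a : polydisc a -> exists k, is_reproducing_kernel H a k.
Proof.
move=> aD.
pose E : set R := [set N f | f in [set f | bergman_mem f /\ f a = 1]].
have hE : has_inf E.
  split; last by exists 0 => _ [f _ <-]; exact: normsq_ge0.
  exists (N (fun=> 1)), (fun=> 1) => //; split => //.
  by apply: (@bergman_bounded _ 1); [exact: holomorphic_cst|move=> z _; rewrite cmod1].
have dE f : bergman_mem f -> f a = 1 -> inf E <= N f.
  by move=> mf fa; apply: (ge_inf hE.2); exists f.
set d := inf E in dE.
have ex i : exists f, [/\ bergman_mem f, f a = 1 & N f < d + i.+1%:R^-1].
  have i0 : 0 < i.+1%:R^-1 :> R by rewrite invr_gt0.
  by have [_ [f [mf fa] <-] h] := inf_adherent i0 hE; exists f; split.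
have [F hF] := choice ex.
have mF i : bergman_mem (F i) by have [] := hF i.
have Fa i : F i a = 1 by have [] := hF i.
have FN i : N (F i) < d + i.+1%:R^-1 by have [] := hF i.
have sF i : sq (F i) by have /bergman_memE[] := mF i.
have invS (i m : nat) : (m <= i)%N -> i.+1%:R^-1 <= m.+1%:R^-1 :> R.
  by move=> mi; rewrite lef_pV2 ?posrE ?ltr0n // ler_nat.
(* The midpoint of [F i] and [F j] still has value 1 at [a], so its square norm is at least [d]. *)
have cauchy i j m : (m <= i)%N -> (m <= j)%N -> N (fun z => F i z - F j z) <= 4 * m.+1%:R^-1.
  move=> mi mj; pose S := normsq mu D (fun p => F i (dp p) + F j (dp p)).
  have par : S + N (fun z => F i z - F j z) = 2 * N (F i) + 2 * N (F j) :=
    parallelogram mD (sF i) (sF j).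
  have mid : bergman_mem (fun z => 2^-1 * (F i z + F j z)).
    apply: bergman_ext (bergman_lin 2^-1 bergman0 (bergman_lin 1 (mF i) (mF j))) => z.
    by rewrite add0r mul1r.
  have := dE _ mid; rewrite !Fa (_ : 1 + 1 = 2) // mulVf ?pnatr_eq0 // => /(_ erefl).
  have -> : N (fun z => 2^-1 * (F i z + F j z)) = 4^-1 * S.
    rewrite /S /N /normsq -RintegralZl //; last exact: (sqint_integrable (sqintD mD (sF i) (sF j))).
    apply: eq_Rintegral => x _; rewrite cmodM exprMn; congr (_ * _).
    have -> : (2^-1 : C) = (2^-1 : R)%:C by rewrite rmorphV ?unitfE ?pnatr_eq0 // rmorph_nat.
    by rewrite cmod_real ger0_norm ?invr_ge0 //; field.
  move: par (FN i) (FN j) (invS _ _ mi) (invS _ _ mj).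
  by move: (N (fun z => _)) (N (F i)) (N (F j)) S (m.+1%:R^-1) (i.+1%:R^-1) (j.+1%:R^-1) => *; lra.
have bF (r : R) : r < 1 -> exists B, forall i z, rnorm z <= r -> cmod (F i z) <= B.
  move=> r1; have [K K0 hK] := bergman_local r1.
  exists (1 + K * (d + 1)) => i z zr; have := hK _ _ (mF i) zr.
  have : K * N (F i) <= K * (d + 1).
    apply: ler_wpM2l => //; apply: le_trans (ltW (FN i)) _; rewrite lerD2l.
    by have := invS i 0 (leq0n _); rewrite invr1.
  by have := cmod_ge0 (F i z); nra.
have [U [UU subU]] := @ultraFilterLemma nat (nbhs \oo) _.
have [f hf Uf] := ultralimit_holomorphic UU (fun i => (mF i).1) bF.
have PU := @ultra_proper _ _ UU.
have fa1 : f a = 1.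
  apply: (ccvg_unique (Uf _ aD)); under eq_fun do rewrite Fa; exact: ccvg_cst.
(* The limit along [U] supplies holomorphy; Fatou's lemma needs convergence of the sequence itself,
   obtained by letting [j] tend along [U] in the Cauchy estimate. *)
have lim z : polydisc z -> ccvg \oo (F ^~ z) (f z).
  move=> zD; have [K K0 hK] := bergman_local (polydisc_rnorm zD).
  move=> e e0.
  have e2 : 0 < e ^+ 2 / (1 + 4 * K) / 4 by rewrite !divr_gt0 ?exprn_gt0 ?ltr_wpDr ?mulr_ge0.
  have [m] := ltr_add_invr e2; rewrite add0r => hm.
  exists m => // i /= mi.
  have le2 : cmod (F i z - f z) ^+ 2 <= 4 * K * m.+1%:R^-1.
    rewrite -cmodX; apply: (@ccvg_le _ _ U _ (fun j => (F i z - F j z) ^+ 2) _ _).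
      rewrite !expr2; apply: ccvgM; apply: ccvgB;
        [exact: ccvg_cst|exact: Uf|exact: ccvg_cst|exact: Uf].
    apply: subU; exists m => // j /= mj; rewrite cmodX.
    have mij : bergman_mem (fun z => F i z - F j z).
      by apply: bergman_ext (bergman_lin (-1) (mF i) (mF j)) => w; rewrite mulN1r.
    apply: le_trans (hK _ _ mij (lexx _)) _; have := cauchy _ _ _ mi mj.
    by move=> /(ler_wpM2l K0) /le_trans; apply; rewrite mulrCA mulrA.
  have lt2 : 4 * K * m.+1%:R^-1 < e ^+ 2.
    have K1 : 0 < 1 + 4 * K by rewrite ltr_wpDr ?mulr_ge0.
    have := hm; rewrite ltr_pdivlMr // ltr_pdivlMr //.
    have x0 : 0 < m.+1%:R^-1 :> R by rewrite invr_gt0.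
    by have := mulr_ge0 K0 (ltW x0); move: (m.+1%:R^-1) x0 => x *; lra.
  rewrite -(@ltr_pXn2r _ 2) ?nnegrE ?cmod_ge0 //; last exact: ltW.
  exact: le_lt_trans le2 lt2.
have lef e : 0 < e -> (\int[mu]_(p in D) (cmod (f (dp p)) ^+ 2)%:E <= (d + e)%:E)%E.
  move=> e0; apply: (@fatou_sq _ _ _ mu D mD (fun i p => F i (dp p))).
  - by move=> i; exact: (sF i).1.
  - exact: cmeas_bergman.
  - by apply: aeW => p Dp; exact: lim.
  have [m] := ltr_add_invr e0; rewrite add0r => hm.
  exists m => // i /= mi; rewrite (normsqE (sF i)) lee_fin; apply: le_trans (ltW (FN i)) _.
  by rewrite lerD2l; apply: le_trans (invS _ _ mi) (ltW hm).
have mf : bergman_mem f.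
  by split => //; apply: le_lt_trans (lef 1 ltr01) _; rewrite ltry.
have [_ sf] := (bergman_memE _).1 mf.
have Nf : N f = d.
  apply/eqP; rewrite eq_le dE // andbT; apply/ler_addgt0Pl => e e0.
  by rewrite addrC -lee_fin -(normsqE sf); exact: lef.
have orth g : bergman_mem g -> g a = 0 -> iprod mu D (fun p => g (dp p)) (fun p => f (dp p)) = 0.
  move=> mg ga; have [_ sg] := (bergman_memE _).1 mg.
  apply: iprod_minimal => // c; rewrite -/(N f) Nf.
  by apply: (dE (fun z => f z + c * g z)); [exact: bergman_lin|rewrite ga mulr0 addr0].
(* Norm 0 would force [f a = 0] by the local bound. *)
have d0 : 0 < d.
  rewrite lt_neqAle -{2}Nf normsq_ge0 andbT eq_sym; apply/eqP => dz.
  have [K K0 hK] := bergman_local (polydisc_rnorm aD).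
  by have := hK _ _ mf (lexx _); rewrite Nf dz mulr0 fa1 cmod1 expr1n ler10.
exists (fun z => (d^-1)%:C * f z); split.
  by apply: bergman_ext (bergman_lin (d^-1)%:C bergman0 mf) => z; rewrite add0r.
move=> g mg; have [_ sg] := (bergman_memE _).1 mg.
(* [g - g(a) f] vanishes at [a], hence is orthogonal to the minimizer, and [<g, f> = g(a) d]. *)
have mh := bergman_lin (- g a) mg mf.
have := orth _ mh; rewrite fa1 mulr1 subrr => /(_ erefl).
rewrite (iprodZDl mD _ sg sf sf) iprod_self -/(N f) Nf mulNr => /eqP; rewrite subr_eq0 => /eqP e.
have -> : inner H g (fun z => (d^-1)%:C * f z) =
   iprod mu D (fun p => g (dp p)) (fun p => (d^-1)%:C * f (dp p)) by [].
rewrite (iprodZr mD _ sg sf) e [X in X * _](_ : _ = (d^-1)%:C); last first.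
  by apply/eqP; rewrite eq_complex /= oppr0 !eqxx.
by rewrite mulrCA -rmorphM mulVf ?gt_eqF // mulr1.
Qed.

Lemma bergman_space_axioms : space_axioms H.
Proof.
split.
- by [].
- exact: probability_le1.
- by move=> f [hf _]; exact: cmeas_bergman.
- by move=> f [].
- move=> f B hf fB; split; first exact: bergman_bounded fB.
  by apply: aeW => p; exact: fB.
- move=> f g c mf mg; split; first exact: bergman_lin.
  exact: aeW.
- by move=> f [].
- move=> r r1; have [K _ h] := polydisc_local n r1; exists K => f z [hf _]; exact: h.
- exact: bergman_kernel.
- move=> a k f aD [[hk _] _] [hf _] fin; split; last exact: aeW.
  split; first exact: holomorphicM.
  by under eq_integral do rewrite cmodM.
Qed.

End BergmanAxioms.

(** * Means over circles *)

Section ContinuousSquareIntegrable.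
Variable R : realType.

Lemma rcont_sqint (a b : R) (u : R -> R[i]) :
  seg_cont a b u -> sqint (@lebesgue_measure R) `[a, b] u.
Proof.
move=> cu; have mI : measurable (`[a, b] : set (measurableTypeR R)) by [].
apply: (@sqint_dom _ _ _ _ _ mI _ (fun t => cmod (u t) ^+ 2)) => //.
  exact: cintegrable_cmeas (seg_cintegrable cu).
have cs : seg_cont a b (fun t => u t * (u t)^*).
  by move=> t ht; apply: rcontM; [|apply: rcont_conj]; exact: cu.
have [+ _] := seg_cintegrable cs; apply: eq_integrable => // t _ /=.
by rewrite mul_conj_cmod.
Qed.

End ContinuousSquareIntegrable.

Section SliceNorm.
Variable R : realType.
Local Notation C := R[i].
Local Notation line := (measurableTypeR R).
Local Notation leb := (@lebesgue_measure R).
Local Notation I01 := (`[(0 : R), 1]%classic : set line).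
Variables (g : C -> C).
Hypothesis dg : forall z, cmod z < 1 -> cdiff g z.

Let gr (r t : R) : C := g (r%:C * expi t).
Let m (r : R) : R := normsq leb I01 (gr r).
Let mI : measurable I01. Proof. by []. Qed.

Lemma slice_rcont (r t : R) : 0 <= r < 1 -> rcont (gr r) t.
Proof.
move=> /andP[r0 r1]; apply: (rcont_comp (u := fun t => r%:C * expi t)).
  by apply: dg; rewrite cmod_circle.
by exact: rcont_circle.
Qed.

Let sq (r : R) : 0 <= r < 1 -> sqint leb I01 (gr r).
Proof. by move=> r01; apply: rcont_sqint => t _; exact: slice_rcont. Qed.

(* The contour integral of [g (l z) * conj (g (p^2 / conj l)) / l] over the circle of
   radius [r] does not depend on [r], and [p^2 / conj l] runs over the reflected circle. *)
Lemma slice_cross (r s p : R) : 0 < r -> r <= p -> p < 1 -> s < 1 -> p ^+ 2 = r * s ->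
  iprod leb I01 (gr r) (gr s) = (m p)%:C.
Proof.
move=> r0 rp p1 s1 prs; have p0 : 0 < p := lt_le_trans r0 rp.
have ps : p <= s by rewrite -(ler_pM2l p0) -expr2 prs; apply: ler_wpM2r => //; nra.
have s0 : 0 < s := lt_le_trans p0 ps.
pose G l := g l * (g ((p ^+ 2)%:C / l)^*)^* / l.
have dG l : r <= cmod l <= p -> cdiff G l.
  move=> /andP[rl lp]; have l0 : l != 0 by rewrite -cmod_eq0 gt_eqF // (lt_le_trans r0).
  have lc : 0 < cmod l := lt_le_trans r0 rl.
  rewrite /G; apply: cdiffM; last by apply: cdiffV; [exact: cdiff_id|].
  apply: cdiffM; first by apply: dg; exact: le_lt_trans lp p1.
  apply: (@cdiff_comp _ (fun l => (p ^+ 2)%:C / l) (fun w => (g w^*)^*)).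
    by apply: cdiffM; [exact: cdiff_cst|apply: cdiffV; [exact: cdiff_id|]].
  apply: cdiff_conj; apply: dg; rewrite cmod_conj cmodM cmodV cmod_real ger0_norm ?sqr_ge0 //.
  rewrite ltr_pdivrMr // mul1r; apply: lt_le_trans rl; rewrite prs -[ltRHS]mulr1.
  by rewrite ltr_pM2l.
have circ (x t : R) : 0 < x -> G (x%:C * expi t) * (x%:C * expi t) = gr x t * (gr (p ^+ 2 / x) t)^*.
  move=> x0; have xe : x%:C * expi t != 0 by rewrite -cmod_eq0 cmod_circle ?gt_eqF // ltW.
  rewrite /G divfK // /gr; congr (_ * (g _)^*).
  have xc : (x%:C : C) != 0 by rewrite -cmod_eq0 cmod_real gtr0_norm ?gt_eqF.
  rewrite invfM -expi_conj mulrA.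
  have -> : (p ^+ 2)%:C / x%:C = (p ^+ 2 / x)%:C :> C by rewrite -fmorphV -rmorphM.
  by case: (expi t) => a b /=; apply/eqP; rewrite eq_complex /=; apply/andP; split; apply/eqP; ring.
have hom : seg_int 0 1 (fun t => G (0 + 0 + (r + (p - r))%:C * expi t)
  * ((r + (p - r))%:C * expi t)) =
   seg_int 0 1 (fun t => G (0 + r%:C * expi t) * (r%:C * expi t)).
  apply: circle_homotopy => u t /andP[u0 u1] _; apply: dG.
  rewrite mulr0 !add0r cmod_circle; last by rewrite addr_ge0 ?(ltW r0) // mulr_ge0 // subr_ge0.
  by apply/andP; split; nra.
rewrite /m -(iprod_self leb I01).
transitivity (seg_int 0 1 (fun t => G (0 + r%:C * expi t) * (r%:C * expi t))).
  apply: eq_cint => t _; rewrite add0r circ // prs mulrAC divff ?mul1r // gt_eqF //.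
rewrite -hom; apply: eq_cint => t _.
by rewrite !add0r addrC subrK circ // expr2 mulfK // gt_eqF.
Qed.

Lemma slice_diff (r s p : R) : 0 < r -> r <= p -> p < 1 -> s < 1 -> p ^+ 2 = r * s ->
  normsq leb I01 (fun t => gr s t - gr r t) = m s + m r - 2 * m p.
Proof.
move=> r0 rp p1 s1 prs; have p0 : 0 < p := lt_le_trans r0 rp.
have ps : p <= s by rewrite -(ler_pM2l p0) -expr2 prs; apply: ler_wpM2r => //; nra.
have hr : sqint leb I01 (gr r) by apply: sq; rewrite (ltW r0) (le_lt_trans rp).
have hs : sqint leb I01 (gr s) by apply: sq; rewrite s1 andbT (le_trans (ltW p0)).
have <- : (fun t => gr s t + -1 * gr r t) = (fun t => gr s t - gr r t).
  by apply/funext => t; rewrite mulN1r.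
by rewrite (normsq_lin mI) // (slice_cross r0 rp p1 s1 prs)
  cmodN cmod1 expr1n mul1r mulN1r raddfN /= /m; ring.
Qed.

(** By [slice_diff] the mean square is convex along geometric sequences of radii. If it were larger
    at [r] than at [s > r], it would grow at least linearly along [s q^k] with [q = r / s]; but
    these radii tend to 0, where continuity of [g] keeps it bounded. *)
Lemma slice_mono (r s : R) : 0 < r -> r <= s -> s < 1 -> m r <= m s.
Proof.
move=> r0 rs s1; rewrite leNgt; apply/negP => lt; have s0 : 0 < s := lt_le_trans r0 rs.
have {rs}rs : r < s by rewrite lt_neqAle rs andbT; apply/eqP => e; move: lt; rewrite e ltxx.
pose q := r / s; have q0 : 0 < q by rewrite divr_gt0.
have q1 : q < 1 by rewrite ltr_pdivrMr // mul1r.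
pose x k := s * q ^+ k.
have x0 k : 0 < x k by rewrite mulr_gt0 ?exprn_gt0.
have xS k : x k.+1 <= x k by rewrite /x exprS mulrCA -[leRHS]mul1r ler_pM2r ?x0 // ltW.
have x1 k : x k < 1.
  by elim: k => [|k IH]; [rewrite /x expr0 mulr1|apply: le_lt_trans (xS k) IH].
have conv k : 2 * m (x k.+1) <= m (x k) + m (x k.+2).
  have e : x k.+1 ^+ 2 = x k.+2 * x k by rewrite /x !exprS; ring.
  have := slice_diff (x0 _) (xS k.+1) (x1 _) (x1 k) e.
  by have := normsq_ge0 leb I01 (fun t => gr (x k) t - gr (x k.+2) t); lra.
pose d := m r - m s; have d0 : 0 < d by rewrite subr_gt0.
have step k : d <= m (x k.+1) - m (x k).
  elim: k => [|k IH]; last by have := conv k; lra.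
  by rewrite /x expr0 expr1 mulr1 /q mulrCA divff ?mulr1 ?gt_eqF.
have low k : m s + k%:R * d <= m (x k).
  elim: k => [|k IH]; first by rewrite mul0r addr0 /x expr0 mulr1.
  by have := step k; rewrite -natr1 mulrDl mul1r; lra.
have c0 : cmod (0 : C) < 1 by rewrite cmod0.
have [e e0 he] := continuous1_eps (dg c0) ltr01.
pose B := (cmod (g 0) + 1) ^+ 2.
have small k : x k < e -> m (x k) <= B.
  move=> xe; rewrite -lee_fin -normsqE; last by apply: sq; rewrite ltW ?x0 ?x1.
  apply: (@le_trans _ _ (\int[leb]_(t in I01) (cst B%:E t))%E).
    apply: ge0_le_integral => //.
    - by move=> t _; rewrite lee_fin exprn_ge0 ?cmod_ge0.
    - by apply/measurable_EFinP; apply: cmeas_cmod2; apply: (sq _).1; rewrite ltW ?x0 ?x1.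
    move=> t _; rewrite lee_fin ler_pXn2r ?nnegrE ?addr_ge0 ?cmod_ge0 //.
    have := he ((x k)%:C * expi t); rewrite subr0 cmod_circle ?(ltW (x0 k)) // => /(_ xe).
    by have := cmodD (g ((x k)%:C * expi t) - g 0) (g 0); rewrite subrK /gr; lra.
  have L1 : leb I01 = 1%E by rewrite lebesgue_measure_itv /= lte_fin ltr01 sube0.
  by rewrite integral_cst // [X in (_ * X)%E](_ : _ = 1%E) ?mule1.
have [N hN] : exists N, forall k, (N <= k)%N -> x k < e.
  have cq : (fun k => x k) @ \oo --> (0 : R).
    rewrite -[X in _ --> X](mulr0 s); apply: cvgMr; apply: cvg_expr.
    by rewrite ger0_norm // ltW.
  have /cvgrPdist_lt/(_ _ e0)[N _ h] := cq.
  by exists N => k /h /=; rewrite sub0r normrN ger0_norm // ltW.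
have B0 : 0 <= Num.max ((B - m s) / d) 0 by rewrite le_max lexx orbT.
have := archi_boundP B0; set K := Num.bound _ => hK.
have := low (maxn K N); have := small _ (hN _ (leq_maxr K N)).
have : K%:R <= (maxn K N)%:R :> R by rewrite ler_nat leq_maxl.
have : (B - m s) / d < K%:R by apply: le_lt_trans hK; rewrite le_max lexx.
rewrite ltr_pdivrMr // => h1 h2 h3 h4.
have : K%:R * d <= (maxn K N)%:R * d by rewrite ler_pM2r.
lra.
Qed.

Lemma slice_increment (r s : R) : 0 < r -> r <= s -> s < 1 ->
  normsq leb I01 (fun t => gr s t - gr r t) + m r <= m s.
Proof.
move=> r0 rs s1; have s0 : 0 < s := lt_le_trans r0 rs.
pose p := Num.sqrt (r * s).
have rs0 : 0 <= r * s by rewrite mulr_ge0 // ltW.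
have p2 : p ^+ 2 = r * s by rewrite sqr_sqrtr.
have rp : r <= p by rewrite -(@ler_pXn2r _ 2) ?nnegrE ?sqrtr_ge0 ?(ltW r0) // p2 expr2 ler_pM2l.
have ps : p <= s by rewrite -(@ler_pXn2r _ 2) ?nnegrE ?sqrtr_ge0 ?(ltW s0) // p2 expr2 ler_pM2r.
rewrite (slice_diff r0 rp (le_lt_trans ps s1) s1 p2).
by have := slice_mono r0 rp (le_lt_trans ps s1); lra.
Qed.

End SliceNorm.

(** * Rotations and the maximal function *)

Section Rotation.
Variable R : realType.
Local Notation C := R[i].
Local Notation line := (measurableTypeR R).
Local Notation P n := (prob_power (angle_prob R) n).
Local Open Scope ereal_scope.

Definition torus_rot n (s : line) (t : n.-tuple line) : n.-tuple line :=
  [tuple (tnth t i + s)%R | i < n].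

Lemma torus_point_rot n s (t : n.-tuple line) :
  torus_point (torus_rot s t) = (expi s *: torus_point t)%R.
Proof. by apply/rowP => i; rewrite !mxE tnth_mktuple addrC; exact: (@expiD R s (tnth t i)). Qed.

Lemma rot_cons n s (x : line) (t : n.-tuple line) :
  torus_rot s (tuple_cons (x, t)) = tuple_cons ((x + s)%R, torus_rot s t).
Proof.
apply: eq_from_tnth => i; case: (unliftP ord0 i) => [j|] ->.
  by rewrite tnth_mktuple !tnthS tnth_mktuple.
by rewrite tnth_mktuple !tnth0.
Qed.

Lemma measurable_rot n : measurable_fun setT (fun x : line * n.-tuple line => torus_rot x.1 x.2).
Proof.
apply/measurable_fun_tnthP => i.
rewrite (_ : _ \o _ = (fun x : line * n.-tuple line => (tnth x.2 i + x.1)%R)).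
  apply: measurable_funD; last exact: measurable_fst.
  exact: (measurableT_comp (measurable_tnth i) measurable_snd).
by apply/funext => x /=; rewrite tnth_mktuple.
Qed.

Lemma measurable_rotl n (s : line) : measurable_fun setT (@torus_rot n s).
Proof. exact: (measurableT_comp (@measurable_rot n) (pair1_measurable s)). Qed.

(** Rotations move the parameters out of [[0, 1]]; functions of the torus point alone do not
    notice. *)
Definition torus_fun n (F : n.-tuple line -> \bar R) : Prop :=
  forall t t', torus_point t = torus_point t' -> F t = F t'.

Lemma rot_invariant n s (F : n.-tuple line -> \bar R) : measurable_fun setT F ->
  (forall t, 0 <= F t) -> torus_fun F -> (0 <= s <= 1)%R ->
  \int[P n]_t F (torus_rot s t) = \int[P n]_t F t.
Proof.
move=> + + + s01; elim: n F => [|n IH] F mF F0 FT.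
  by rewrite !integral_prob_power0 ?(tuple0 (torus_rot _ _)) //;
    exact: (measurableT_comp mF (measurable_rotl _)).
rewrite (ge0_integral_prob_powerS _ mF F0).
rewrite (ge0_integral_prob_powerS _ (measurableT_comp mF (measurable_rotl _)) (fun=> F0 _)).
pose J (x : line) := \int[P n]_t F (tuple_cons (x, t)).
have mJ : measurable_fun setT J by exact: measurable_prob_power_inner.
have J0 x : 0 <= J x by apply: integral_ge0 => t _.
have J1 (x : R) : J (x + 1)%R = J x.
  by apply: eq_integral => t _; apply: FT; rewrite !torus_point_cons expiS.
rewrite -(angle_integral_periodic mJ J0 J1 s01); apply: eq_integral => x _.
under eq_integral do rewrite /= rot_cons.
apply: (IH (fun t => F (tuple_cons ((x + s)%R, t)))) => //.
  exact: (measurableT_comp mF (measurable_consl _)).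
by move=> t t' tt'; apply: FT; rewrite !torus_point_cons tt'.
Qed.

(** Writes a torus integral as an average of circle integrals over the orbits of the diagonal
    rotations. Along an orbit a holomorphic function of [n] variables becomes one of a single
    variable ([torus_slice]). *)
Lemma rot_average n (F : n.-tuple line -> \bar R) : measurable_fun setT F ->
  (forall t, 0 <= F t) -> torus_fun F ->
  \int[P n]_t F t = \int[P n]_t \int[angle_prob R]_s F (torus_rot s t).
Proof.
move=> mF F0 FT.
have mFr : measurable_fun setT (fun x : line * n.-tuple line => F (torus_rot x.1 x.2)).
  exact: (measurableT_comp mF (@measurable_rot n)).
have FR := @fubini_tonelli _ _ _ _ _ (angle_prob R) (P n) _ mFr (fun x => F0 _).
rewrite -[RHS]FR angle_integral; last first.
  by apply: (@measurable_fun_fubini_tonelli_F _ _ _ _ _ (P n) _ mFr) => x; exact: F0.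
rewrite [RHS](eq_integral (fun=> \int[P n]_t F t)); last first.
  by move=> s; rewrite inE /= in_itv /= => s01; rewrite rot_invariant.
rewrite integral_cst //= [X in _ * X](_ : _ = 1) ?mule1 //.
by rewrite lebesgue_measure_itv /= lte_fin ltr01 sube0.
Qed.

End Rotation.

Section SineBound.
Variable R : realType.

(** A weak form of Jordan's inequality. Up to [1 / 4] the mean value theorem applies with
    [cos >= 1 / 2] and [pi >= 2]; beyond, [sin] is at least [sin (pi / 4) >= 1 / 2]. *)
Lemma sin_pi_ge (u : R) : 0 <= u <= 1 / 2 -> u <= sin (pi * u).
Proof.
move=> /andP[u0 u2]; have p2 := @pi_ge2 R; have p0 := @pi_gt0 R.
have c4 : cos (pi / 4) = sin (pi / 4) :> R.
  by rewrite -cosBpihalf -cosN; congr cos; field.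
have s4 : 1 / 2 <= sin (pi / 4) :> R.
  have s0 : 0 < sin (pi / 4) :> R by apply: sin_gt0_pihalf; apply/andP; split; lra.
  by have := cos2Dsin2 (pi / 4 : R); rewrite c4; nra.
have [u4|u4] := leP u (1 / 4); last first.
  apply: (@le_trans _ _ (sin (pi / 4))); first by apply: le_trans s4.
  rewrite leNgt ltr_sin; first by rewrite -leNgt; nra.
  - by rewrite in_itv /=; apply/andP; split; nra.
  - by rewrite in_itv /=; apply/andP; split; lra.
have pu0 : 0 <= pi * u by rewrite mulr_ge0 // ltW.
have ds (x : R) : x \in `]0, (pi * u)[%R -> is_derive x 1 (@sin R) (cos x).
  by move=> _; exact: is_derive_sin.
have [x + e] := MVT_segment pu0 ds (continuous_subspaceT (@continuous_sin R)).
rewrite in_itv /= => /andP[x0 xpu]; move: e; rewrite sin0 !subr0 => ->.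
have xp4 : x <= pi / 4 by apply: le_trans xpu _; nra.
have c12 : 1 / 2 <= cos x.
  apply: le_trans s4 _; rewrite -c4 leNgt ltr_cos; first by rewrite -leNgt.
  - by rewrite in_itv /=; apply/andP; split; lra.
  - by rewrite in_itv /=; apply/andP; split; lra.
apply: (@le_trans _ _ (1 / 2 * (pi * u))); first by nra.
by rewrite ler_wpM2r.
Qed.

End SineBound.

(** * Weak type estimate for radial maximal functions *)

Section MaximalFunction.
Variable R : realType.
Local Notation line := (measurableTypeR R).
Local Notation leb := (@lebesgue_measure R).
Local Open Scope ereal_scope.

Lemma measurable_radial_kernel (d s : R) : (0 < d)%R ->
  measurable_fun setT (fun t : line => (d / (d ^+ 2 + ((t : R) - s) ^+ 2))%R).
Proof.
move=> d0; apply: continuous_measurable_fun => t; apply: cvgM; first exact: cvg_cst.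
apply: cvgV; first by rewrite gt_eqF // ltr_wpDr ?sqr_ge0 ?exprn_gt0.
apply: cvgD; first exact: cvg_cst.
by rewrite !expr2; apply: cvgM; apply: cvgB => //; exact: cvg_cst.
Qed.

Lemma radial_kernel_ge0 (d s t : R) : (0 < d -> 0 <= d / (d ^+ 2 + (t - s) ^+ 2))%R.
Proof. by move=> d0; apply: divr_ge0; [exact: ltW|rewrite addr_ge0 ?sqr_ge0]. Qed.

(* Splitting the ball into dyadic rings gives the geometric sum [2 + 4 + 2 + 1 + ...]. *)
Lemma radial_kernel_bound (G : R -> R) (s c d : R) (k : nat) : measurable_fun setT G ->
  (forall t, 0 <= G t)%R -> (0 < d)%R ->
  (forall x : R, (0 < x)%R -> \int[leb]_(t in ball s x) (G t)%:E <= (2 * x * c)%:E) ->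
  \int[leb]_(t in ball s (2 ^+ k * d)%R) (d / (d ^+ 2 + (t - s) ^+ 2) * G t)%:E <=
    ((10 - 8 / 2 ^+ k) * c)%:E.
Proof.
move=> mG G0 d0 hG.
have c0 : (0 <= c)%R.
  have := hG 1%R ltr01; rewrite mulr1 => h.
  have : 0 <= (2 * c)%:E by apply: le_trans h; apply: integral_ge0 => t _; rewrite lee_fin.
  by rewrite lee_fin pmulr_rge0.
have mK : measurable_fun setT (fun t : line => (d / (d ^+ 2 + ((t : R) - s) ^+ 2) * G t)%R).
  by apply: measurable_funM => //; exact: measurable_radial_kernel.
have K0 t : (0 <= d / (d ^+ 2 + (t - s) ^+ 2) * G t)%R.
  by apply: mulr_ge0 => //; exact: radial_kernel_ge0.
have mE (D : set line) : measurable_fun D (fun t : line =>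
  (d / (d ^+ 2 + ((t : R) - s) ^+ 2) * G t)%:E).
  by apply/measurable_EFinP; exact: measurable_funTS.
have mGD (D : set line) : measurable_fun D (fun t : line => (G t)%:E).
  by apply/measurable_EFinP; exact: measurable_funTS.
have mb (x : R) : measurable (ball s x : set line) by exact: measurable_ball.
have ring_bound (D : set line) (x y : R) : measurable D -> (0 < y)%R -> D `<=` ball s y ->
    (forall t, D t -> (d / (d ^+ 2 + ((t : R) - s) ^+ 2) <= x)%R) -> (0 <= x)%R ->
    \int[leb]_(t in D) (d / (d ^+ 2 + (t - s) ^+ 2) * G t)%:E <= (x * (2 * y * c))%:E.
  move=> mD y0 Dy hx x0; apply: (@le_trans _ _ (\int[leb]_(t in D) (x%:E * (G t)%:E))).
    apply: ge0_le_integral => //.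
    - by move=> t _; rewrite lee_fin.
    - by apply: measurable_funeM; exact: mGD.
    by move=> t Dt; rewrite -EFinM lee_fin; apply: ler_wpM2r => //; exact: hx.
  rewrite ge0_integralZl //; last by move=> t _; rewrite lee_fin.
  rewrite EFinM; apply: lee_wpmul2l; first by rewrite lee_fin.
  apply: le_trans (hG _ y0); apply: ge0_subset_integral => //.
  by move=> t _; rewrite lee_fin.
elim: k => [|k IH].
  rewrite expr0 divr1 mul1r.
  have -> : ((10 - 8) * c = d^-1 * (2 * d * c))%R by field; rewrite gt_eqF.
  apply: ring_bound => //; last by rewrite invr_ge0 ltW.
  move=> t _; rewrite ler_pdivrMr; last by rewrite ltr_wpDr ?sqr_ge0 ?exprn_gt0.
  by rewrite mulrDr expr2 mulKf ?gt_eqF // lerDl mulr_ge0 ?sqr_ge0 // invr_ge0 ltW.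
have p0 : (0 < 2 ^+ k :> R)%R by rewrite exprn_gt0.
have kk : (2 ^+ k * d <= 2 ^+ k.+1 * d)%R.
  by rewrite ler_pM2r // exprS; lra.
have mdiff : measurable (ball s (2 ^+ k.+1 * d)%R `\` ball s (2 ^+ k * d)%R : set line)
  by exact: measurableD.
rewrite -(@setDUK _ (ball s (2 ^+ k * d)%R) (ball s (2 ^+ k.+1 * d)%R)); last exact: le_ball.
rewrite ge0_integral_setU //; last 2 first.
- by move=> t _; rewrite lee_fin.
- by apply/disj_setPS => t [h1 [_ h2]].
have -> : ((10 - 8 / 2 ^+ k.+1) * c = (10 - 8 / 2 ^+ k) * c +
   (d / (2 ^+ k * d) ^+ 2) * (2 * (2 ^+ k.+1 * d) * c))%R.
  by rewrite exprS; field; rewrite !gt_eqF.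
rewrite EFinD; apply: leeD => //; apply: ring_bound => //.
- by rewrite mulr_gt0 ?exprn_gt0.
- move=> t [_ nb]; rewrite ler_pM2l // lef_pV2 ?posrE ?exprn_gt0 ?mulr_gt0 //; last first.
    by rewrite ltr_wpDr ?sqr_ge0 ?exprn_gt0.
  apply: ler_wpDl; first exact: sqr_ge0.
  rewrite -[leRHS]real_normK ?num_real // ler_pXn2r ?nnegrE ?mulr_ge0 ?(ltW p0) ?(ltW d0) //.
  by rewrite leNgt; apply/negP => h; apply: nb; rewrite /ball /= distrC.
- by apply: divr_ge0; [exact: ltW|exact: sqr_ge0].
Qed.

End MaximalFunction.

Section SliceMaximal.
Variable R : realType.
Local Notation C := R[i].
Local Notation line := (measurableTypeR R).
Local Notation leb := (@lebesgue_measure R).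

Lemma cmod2_circle (p r u : R) :
  cmod (p%:C * expi u - r%:C : C) ^+ 2 = (p - r) ^+ 2 + 4 * p * r * sin (pi * u) ^+ 2.
Proof.
rewrite cmod_sqr /expi /=.
have -> : 2 * pi * u = pi * u + pi * u by ring.
rewrite cosD sinD; have := cos2Dsin2 (pi * u); move: (cos _) (sin _) => c s h.
have c2 : c ^+ 2 = 1 - s ^+ 2 by rewrite -h; ring.
transitivity (p ^+ 2 * (c ^+ 2 + s ^+ 2) ^+ 2 - 2 * p * r * (c ^+ 2 - s ^+ 2) + r ^+ 2).
  by ring.
by rewrite c2; ring.
Qed.

(** The numerator is at most [2 (p - r)]. In the denominator [4 p r >= 1], since both radii exceed
    [1 / 2], and [sin (pi u)^2 >= u^2]. *)
Lemma poisson_kernel_le (p r u : R) : 1 / 2 < r -> r < p -> p < 1 -> `|u| <= 1 / 2 ->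
  (p ^+ 2 - r ^+ 2) / cmod (p%:C * expi u - r%:C : C) ^+ 2 <=
  2 * ((p - r) / ((p - r) ^+ 2 + u ^+ 2)).
Proof.
move=> r2 rp p1 u2; have d0 : 0 < p - r by rewrite subr_gt0.
have s0 : u ^+ 2 <= sin (pi * u) ^+ 2.
  have h : `|u| <= sin (pi * `|u|) by apply: sin_pi_ge; rewrite normr_ge0.
  have : `|u| ^+ 2 <= sin (pi * `|u|) ^+ 2 by rewrite ler_pXn2r ?nnegrE // (le_trans _ h).
  rewrite real_normK ?num_real //; case: (ger0P u) => // _.
  by rewrite mulrN sinN sqrrN.
have e0 : 0 < (p - r) ^+ 2 + u ^+ 2 by rewrite ltr_wpDr ?sqr_ge0 ?exprn_gt0.
have le : (p - r) ^+ 2 + u ^+ 2 <= cmod (p%:C * expi u - r%:C : C) ^+ 2.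
  rewrite cmod2_circle lerD2l; apply: le_trans s0 _.
  have : 1 <= 4 * p * r by nra.
  by have := sqr_ge0 (sin (pi * u)); move: (_ ^+ 2) => x; nra.
apply: (@le_trans _ _ ((p ^+ 2 - r ^+ 2) / ((p - r) ^+ 2 + u ^+ 2))).
  apply: ler_wpM2l; first by nra.
  by rewrite lef_pV2 ?posrE // (lt_le_trans e0).
rewrite mulrA; apply: ler_wpM2r; first by rewrite invr_ge0 ltW.
by nra.
Qed.

Variable g : C -> C.
Hypothesis dg : forall z, cmod z < 1 -> cdiff g z.
Variable p : R.
Hypothesis p1 : p < 1.
Hypothesis p2 : 1 / 2 < p.

Let G (t : line) : R := cmod (g (p%:C * expi t)).

Let p0 : 0 < p. Proof. by apply: lt_trans p2; rewrite divr_gt0. Qed.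

Let G0 t : 0 <= G t. Proof. exact: cmod_ge0. Qed.

Let Gper t : G (t + 1) = G t. Proof. by rewrite /G expiS. Qed.

Let cG : cmeas setT (fun t : line => g (p%:C * expi t)).
Proof. by apply: rcont_cmeas => t; apply: (slice_rcont dg); rewrite p1 andbT ltW. Qed.

Let mG : measurable_fun setT G. Proof. exact: (cmeas_cmod cG). Qed.

Lemma poisson_slice_le (r : R) (s : line) : 1 / 2 < r -> r < p ->
  ((cmod (g (r%:C * expi s)))%:E <=
   \int[leb]_(t in `[((s : R) - 1 / 2)%R, ((s : R) + 1 / 2)%R[)
     (2 * ((p - r) / ((p - r) ^+ 2 + ((t : R) - s) ^+ 2) * G t))%:E)%E.
Proof.
move=> r2 rp; pose gs z := g (z * expi s).
have dgs z : cmod z <= p -> cdiff gs z.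
  move=> zp; apply: (@cdiff_comp _ (fun z => z * expi s)).
    by apply: cdiffM; [exact: cdiff_id|exact: cdiff_cst].
  by apply: dg; rewrite cmodM cmod_expi mulr1 (le_lt_trans zp).
have rr : cmod (r%:C : C) = r by rewrite cmod_real ger0_norm //; lra.
have rp' : cmod (r%:C : C) < p by rewrite rr.
pose k (x : R) : R := (p ^+ 2 - r ^+ 2) / cmod (p%:C * expi x - r%:C) ^+ 2.
have d0 : 0 < p - r by rewrite subr_gt0.
have nz x : 0 < cmod (p%:C * expi x - r%:C : C) ^+ 2.
  rewrite cmod2_circle ltr_wpDr ?exprn_gt0 // mulr_ge0 ?sqr_ge0 //; nra.
have k0 x : 0 <= k x by apply: divr_ge0; [nra|exact: ltW].
have kper x : k (x + 1) = k x by rewrite /k expiS.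
have ck t : rcont (fun x => (k x)%:C) t.
  rewrite (_ : (fun x => _) = (fun x => (p ^+ 2 - r ^+ 2)%:C *
     ((p%:C * expi x - r%:C) * (p%:C * expi x - r%:C)^*)^-1)); last first.
    by apply/funext => x; rewrite mul_conj_cmod -fmorphV -rmorphM.
  have c1 : rcont (fun x => p%:C * expi x - r%:C) t.
    apply: rcontB; last exact: rcont_cst.
    by exact: rcont_circle.
  apply: rcontM; first exact: rcont_cst.
  apply: rcontV; first by apply: rcontM => //; exact: rcont_conj.
  by rewrite mul_conj_cmod -cmod_eq0 cmod_real normr_eq0 gt_eqF.
have mk : measurable_fun setT (k : line -> R) by have [] := rcont_cmeas ck.
pose psi (x : line) : \bar R := (k x * G (x + s))%:E.
have mpsi : measurable_fun setT psi.
  apply/measurable_EFinP; apply: measurable_funM => //.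
  exact: (measurableT_comp mG (measurable_translation _)).
have psi0 x : (0 <= psi x)%E by rewrite lee_fin mulr_ge0.
have psi1 (x : R) : psi (x + 1) = psi x by rewrite /psi kper addrAC Gper.
have mI : measurable (`[0, 1] : set line) by [].
have gE t : gs (p%:C * expi t) = g (p%:C * expi (t + s)) by rewrite /gs expiD mulrA.
have le1 : ((cmod (g (r%:C * expi s)))%:E <= \int[leb]_(x in `[0%R, 1%R]) psi x)%E.
  have cs : seg_cont 0 1 (fun t => (k t)%:C * gs (p%:C * expi t)).
    move=> t _; apply: rcontM => //.
    apply: (rcont_comp (u := fun t => p%:C * expi t)).
      by apply: dgs; rewrite cmod_circle // ltW.
    by exact: rcont_circle.
  have -> : g (r%:C * expi s) = seg_int 0 1 (fun t => (k t)%:C * gs (p%:C * expi t)).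
    by have := poisson_circle rp' dgs; rewrite rr.
  apply: le_trans (le_cmod_cint mI (seg_cintegrable cs)) _.
  rewrite le_eqVlt; apply/orP; left; apply/eqP; apply: eq_integral => t _.
  by rewrite cmodM cmod_real ger0_norm // gE.
apply: le_trans le1 _.
(* Periodicity moves the interval of integration to the one centred at 0, where the kernel bound
   holds; a translation by [s] follows. *)
rewrite -angle_integral // -(@angle_integral_periodic _ (1 / 2)) //; last by apply/andP; split; lra.
have mpsi' (x : R) : measurable_fun setT (fun t : line => psi ((t : R) + x)%R).
  exact: (measurableT_comp mpsi (measurable_translation _)).
rewrite (angle_integral (mpsi' (1 / 2))) -integral_itv_bndo_bndc;
  last exact: (measurable_funTS (mpsi' _)).
rewrite (eq_integral (fun t : line => psi (t - 1 / 2)%R)); last first.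
  by move=> t _; rewrite -[RHS]psi1 -addrA; congr (psi (_ + _)); lra.
rewrite (integral_itv_shift _ _ (- (1 / 2)) mpsi) // add0r.
have -> : 1 - 1 / 2 = 1 / 2 :> R by lra.
pose Psi (t : line) : \bar R := (k ((t : R) - s) * G t)%:E.
have mPsi : measurable_fun setT Psi.
  apply/measurable_EFinP; apply: measurable_funM => //.
  exact: (measurableT_comp mk (measurable_translation _)).
rewrite (eq_integral (fun t : line => Psi (t + s)%R)); last first.
  by move=> t _; rewrite /Psi /psi addrK.
rewrite (integral_itv_shift _ _ s mPsi); last by move=> x; rewrite lee_fin mulr_ge0.
rewrite [(_ + s)%R]addrC [(1 / 2 + s)%R]addrC.
apply: ge0_le_integral => //.
- by move=> t _; rewrite lee_fin mulr_ge0.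
- exact: measurable_funTS.
- apply/measurable_EFinP; apply: measurable_funM; first exact: measurable_cst.
  apply: measurable_funM; last exact: measurable_funTS.
  by apply: measurable_funTS; exact: measurable_radial_kernel.
move=> t; rewrite /= in_itv /= => /andP[t1 t2]; rewrite lee_fin mulrA; apply: ler_wpM2r => //.
by apply: poisson_kernel_le => //; rewrite ler_norml; apply/andP; split; lra.
Qed.

(** Three periods contain every window of half-length [1 / 2] about a point of [[0, 1]]. Cutting [G]
    off makes it integrable on the line, as the maximal inequality requires. *)
Let Gm : R -> R := G \_ `[(-1)%R, 2%R[%classic.

Let mGm : measurable_fun setT Gm.
Proof. by apply/(measurable_restrictT _ _).1 => //; exact: measurable_funTS. Qed.

Let Gm0 t : 0 <= Gm t.
Proof. by rewrite /Gm patchE; case: ifP. Qed.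

Let norm_Gm : (\int[leb]_t (Gm t)%:E = 3%:E * \int[angle_prob R]_t (G t)%:E)%E.
Proof.
have mGE : measurable_fun setT (fun t : line => (G t)%:E) by exact/measurable_EFinP.
have GE0 t : (0 <= (G t)%:E)%E by rewrite lee_fin.
rewrite angle_integral // -integral_itv_bndo_bndc; last exact: measurable_funTS.
transitivity (\int[leb]_(t in `[(-1)%R, 2%R[) (G t)%:E)%E.
  rewrite [RHS]integral_mkcond; apply: eq_integral => t _.
  by rewrite /Gm !patchE; case: ifP.
rewrite (@integral_itv_split _ _ 0) // ?lerN10 // (@integral_itv_split _ 0 1) //;
  last by rewrite ler1n.
have sh (u : R) : (forall t, G (t + u) = G t) ->
    (\int[leb]_(t in `[u, (1 + u)%R[) (G t)%:E = \int[leb]_(t in `[0%R, 1%R[) (G t)%:E)%E.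
  by move=> h; rewrite -[u in `[u, _[]add0r -(integral_itv_shift _ _ _ mGE) //;
    under eq_integral do rewrite h.
have -> : (\int[leb]_(t in `[(-1)%R, 0%R[) (G t)%:E = \int[leb]_(t in `[0%R, 1%R[) (G t)%:E)%E.
  by rewrite -(sh (-1)) ?subrr // => t; rewrite -[LHS]Gper subrK.
have -> : (\int[leb]_(t in `[1%R, 2%R[) (G t)%:E = \int[leb]_(t in `[0%R, 1%R[) (G t)%:E)%E.
  by rewrite -(sh 1).
rewrite -(_ : 1 + (1 + 1) = 3%:E :> \bar R)%E; last by rewrite -!EFinD; congr EFin; ring.
have I0 : (0 <= \int[leb]_(t in `[0%R, 1%R[) (G t)%:E)%E by exact: integral_ge0.
by rewrite ge0_muleDl // ?adde_ge0 // ge0_muleDl // !mul1e.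
Qed.

Let loc_Gm : locally_integrable setT Gm.
Proof.
apply: open_integrable_locally; first exact: openT.
apply/integrableP; split; first exact/measurable_EFinP.
rewrite (eq_integral (fun t : line => (Gm t)%:E)); last by move=> t _; rewrite /= ger0_norm.
rewrite norm_Gm lte_mul_pinfty //.
have cs : seg_cont 0 1 (fun t => g (p%:C * expi t)).
  by move=> t _; apply: (slice_rcont dg); rewrite p1 andbT ltW.
have mI : measurable (`[0, 1] : set line) by [].
have /integrableP[_] := cintegrable_cmod mI (seg_cintegrable cs).
under eq_integral do rewrite abse_EFin ger0_norm ?cmod_ge0 //.
by rewrite angle_integral //; exact/measurable_EFinP.
Qed.

(** If the maximal function of [Gm] at [s] is at most [c = l / 20], the kernel bounds give at most
    [2 * 10 * c = l] at every admissible radius. So [S] lies where it exceeds [c], and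
    [180 = 3 * 20 * 3] collects the maximal inequality, [1 / c] and the three periods. *)
Lemma slice_maximal (l : R) (S : set line) : 0 < l -> measurable S ->
  (forall s, S s -> 0 <= (s : R) <= 1 /\ exists2 r : R, 1 / 2 < r < p & l
    < cmod (g (r%:C * expi s))) ->
  (leb S <= (180 / l)%:E * \int[angle_prob R]_t (cmod (g (p%:C * expi t)))%:E)%E.
Proof.
move=> l0 mS hS; pose c := l / 20; have c0 : 0 < c by rewrite divr_gt0.
have SHL : S `<=` [set x | (HL_maximal Gm x > c%:E)%E].
  move=> s /hS[/andP[s0 s1] [r /andP[r2 rp] lr]] /=; rewrite ltNge; apply/negP => hc.
  have d0 : 0 < p - r by rewrite subr_gt0.
  have hG (x : R) : 0 < x -> (\int[leb]_(t in ball (s : R) x) (Gm t)%:E <= (2 * x * c)%:E)%E.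
    move=> x0; have bE : (leb (ball (s : R) x) = (2 * x)%:E).
      by rewrite lebesgue_measure_ball ?ltW // mulr2n; congr EFin; ring.
    have avg : (iavg Gm (ball (s : R) x) <= c%:E)%E.
      by apply: le_trans hc; apply: ereal_sup_ubound; exists x => //=; rewrite in_itv /= x0.
    rewrite EFinM -lee_pdivrMl ?mulr_gt0 //; apply: le_trans avg.
    rewrite /iavg bE inver gt_eqF ?mulr_gt0 //.
    by under [X in (_ <= _ * X)%E]eq_integral do rewrite gee0_abs ?lee_fin //.
  (* Enough dyadic rings for the ball of radius [2 ^+ k * (p - r)] to cover the window. *)
  pose k := Num.bound (p - r)^-1.
  have dk : 1 < 2 ^+ k * (p - r).
    rewrite -ltr_pdivrMr // mul1r; have := archi_boundP (ltW (_ : 0 < (p - r)^-1)).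
    rewrite invr_gt0 => /(_ d0) /lt_le_trans; apply; rewrite -/k.
    by rewrite -natrX ler_nat ltnW // ltn_expl.
  have rk := radial_kernel_bound k mGm Gm0 d0 hG.
  have := poisson_slice_le s r2 rp.
  rewrite leNgt => /negP; apply; apply: le_lt_trans (_ : (_ <= (2 * (10 * c))%:E)%E) _; last first.
    by rewrite lte_fin (le_lt_trans _ lr) // /c; lra.
  have mK := measurable_radial_kernel s d0; have K0 t := radial_kernel_ge0 s t d0.
  under eq_integral do rewrite EFinM.
  rewrite ge0_integralZl //; last 2 first.
  - by apply/measurable_EFinP; apply: measurable_funTS; apply: measurable_funM.
  - by move=> t _; rewrite lee_fin mulr_ge0.
  rewrite EFinM; apply: lee_wpmul2l; first by rewrite lee_fin.
  apply: le_trans (_ : (_ <= ((10 - 8 / 2 ^+ k) * c)%:E)%E) _; last first.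
    by rewrite lee_fin ler_pM2r // gerBl divr_ge0 ?exprn_ge0.
  apply: le_trans rk.
  apply: (@le_trans _ _ (\int[leb]_(t in `[((s : R) - 1 / 2)%R, ((s : R) + 1 / 2)%R[)
     ((p - r) / ((p - r) ^+ 2 + ((t : R) - s) ^+ 2) * Gm t)%:E)%E).
    rewrite le_eqVlt; apply/orP; left; apply/eqP; apply: eq_integral => t.
    rewrite inE /= in_itv /= => /andP[t1 t2]; rewrite /Gm patchE mem_set //= in_itv /=.
    by apply/andP; split; lra.
  apply: ge0_subset_integral => //.
  - exact: measurable_ball.
  - by apply/measurable_EFinP; apply: measurable_funTS; apply: measurable_funM.
  - by move=> t _; rewrite lee_fin mulr_ge0.
  move=> t /=; rewrite in_itv /= => /andP[t1 t2]; rewrite /ball /=.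
  by apply: lt_trans dk; rewrite ltr_norml; apply/andP; split; lra.
apply: (@le_trans _ _ (leb [set x | (HL_maximal Gm x > c%:E)%E])).
  apply: le_measure => //; rewrite ?inE //.
  rewrite -[X in measurable X]setTI; apply: emeasurable_fun_o_infty => //.
  exact: (measurable_HL_maximal loc_Gm).
apply: le_trans (maximal_inequality loc_Gm c0) _.
rewrite [X in (_ * X <= _)%E](_ : _ = \int[leb]_t (Gm t)%:E)%E; last first.
  by apply: eq_integral => t _; rewrite gee0_abs // lee_fin.
rewrite norm_Gm muleA -EFinM /c (_ : 3 / (l / 20) * 3 = 180 / l) //.
by field; rewrite gt_eqF.
Qed.

End SliceMaximal.

(** * Holomorphic functions along the orbits of the torus *)

Section TorusFunctions.
Variables (R : realType) (n : nat).
Local Notation C := R[i].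
Local Notation line := (measurableTypeR R).
Local Notation P := (prob_power (angle_prob R) n).
Local Notation tp := (@torus_point R n).
Implicit Types f : 'rV[C]_n -> C.

Lemma torus_coord t i : tp t ord0 i = expi (tnth t i).
Proof. by rewrite mxE. Qed.

Lemma cmeas_torus (c : C) i : cmeas setT (fun t => (c *: tp t) ord0 i).
Proof.
rewrite (_ : (fun t => _) = (fun t => c * expi (tnth t i))); last first.
  by apply/funext => t; rewrite mxE torus_coord.
apply: cmeasM; first exact: cmeas_cst.
have [m1 m2] := rcont_cmeas (@rcont_expi R).
by split; [apply: (measurableT_comp m1)|apply: (measurableT_comp m2)]; exact: measurable_tnth.
Qed.

Lemma torus_polydisc (c : C) t : cmod c < 1 -> polydisc (c *: tp t).
Proof. by move=> c1 i; rewrite mxE torus_coord cmodM cmod_expi mulr1. Qed.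

Lemma cmod_lt1_real (r : R) : 0 <= r < 1 -> cmod (r%:C : C) < 1.
Proof. by move=> /andP[r0 r1]; rewrite cmod_real ger0_norm. Qed.

Lemma cmeas_radial f (r : R) : holomorphic f -> 0 <= r < 1 ->
  cmeas setT (fun t => f (r%:C *: tp t)).
Proof.
move=> hf r1; apply: (@cmeas_holomorphic _ _ R n _ measurableT (fun t => r%:C *: tp t) _ f hf).
  exact: cmeas_torus.
by move=> t _; apply: torus_polydisc; exact: cmod_lt1_real.
Qed.

Lemma torus_slice f t : holomorphic f -> forall z, cmod z < 1 -> cdiff (fun z => f (z *: tp t)) z.
Proof.
move=> hf z z1; rewrite (_ : (fun z => _) = (fun z => f (0 + z *: tp t))); last first.
  by apply/funext => w; rewrite add0r.
by apply: cdiff_slice; rewrite add0r; apply: hf; exact: torus_polydisc.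
Qed.

Lemma scale_torus_rot s t (r : C) : r *: tp (torus_rot s t) = (r * expi s) *: tp t.
Proof. by rewrite torus_point_rot scalerA. Qed.

Lemma torus_funP (G : 'rV[C]_n -> \bar R) : torus_fun (fun t => G (tp t)).
Proof. by move=> t t' ->. Qed.

Local Open Scope ereal_scope.

Lemma measurable_rot_average (F : n.-tuple line -> \bar R) : measurable_fun setT F ->
  (forall t, 0 <= F t) -> measurable_fun setT (fun t => \int[angle_prob R]_s F (torus_rot s t)).
Proof.
move=> mF F0; have mFr := measurableT_comp mF (@measurable_rot R n).
by apply: (@measurable_fun_fubini_tonelli_G _ _ _ _ _ (angle_prob R) _ mFr) => x; exact: F0.
Qed.

(** [slice_increment] on each orbit, averaged by [rot_average]. The additive form avoids subtracting
    integrals that may be infinite. *)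
Lemma radial_increment f (r s : R) : holomorphic f -> (0 < r)%R -> (r <= s)%R -> (s < 1)%R ->
  \int[P]_t (cmod (f (s%:C *: tp t) - f (r%:C *: tp t))%R ^+ 2)%:E +
  \int[P]_t (cmod (f (r%:C *: tp t)) ^+ 2)%:E <=
  \int[P]_t (cmod (f (s%:C *: tp t)) ^+ 2)%:E.
Proof.
move=> hf r0 rs s1.
have hr : (0 <= r < 1)%R by rewrite ltW //= (le_lt_trans rs).
have hs : (0 <= s < 1)%R by rewrite s1 andbT (le_trans (ltW r0)).
have m1 := cmeas_radial hf hr; have m2 := cmeas_radial hf hs.
pose F1 z := (f (s%:C *: z) - f (r%:C *: z))%R; pose F2 z := f (r%:C *: z); pose F3 z :=
  f (s%:C *: z).
have mF1 : cmeas setT (fun t => F1 (tp t)) by exact: cmeasB.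
have E0 (G : 'rV[C]_n -> C) t : 0 <= (cmod (G (tp t)) ^+ 2)%:E by rewrite lee_fin sqr_ge0.
have mE (G : 'rV[C]_n -> C) : cmeas setT (fun t => G (tp t)) ->
    measurable_fun setT (fun t => (cmod (G (tp t)) ^+ 2)%:E).
  by move=> mG; apply/measurable_EFinP; exact: cmeas_cmod2.
pose A (G : 'rV[C]_n -> C) t := \int[angle_prob R]_u (cmod (G (tp (torus_rot u t))) ^+ 2)%:E.
have A0 G t : 0 <= A G t by apply: integral_ge0 => u _; exact: E0.
have mA G : cmeas setT (fun t => G (tp t)) -> measurable_fun setT (A G).
  by move=> mG; apply: (measurable_rot_average (mE _ mG)) => t; exact: E0.
have avg G : cmeas setT (fun t => G (tp t)) ->
    \int[P]_t (cmod (G (tp t)) ^+ 2)%:E = \int[P]_t A G t.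
  move=> mG; apply: (rot_average (mE _ mG)) => [t|]; first exact: E0.
  by move=> t t' tt'; rewrite tt'.
rewrite (avg F1) // (avg F2) // (avg F3) // -ge0_integralD //; last 2 first.
- exact: mA.
- exact: mA.
apply: ge0_le_integral => //.
- by move=> t _; exact: adde_ge0.
- by apply: emeasurable_funD; exact: mA.
- exact: mA.
move=> t _; have dg := torus_slice t hf.
have := slice_increment dg r0 rs s1.
have cu (x : R) u : (0 <= x < 1)%R -> rcont (fun u => f ((x%:C * expi u) *: tp t)) u.
  by move=> hx; exact: (slice_rcont dg).
have aE (U : R -> C) : (forall u, rcont U u) ->
   \int[angle_prob R]_u (cmod (U u) ^+ 2)%:E = (normsq lebesgue_measure `[0%R, 1%R] U)%:E.
  move=> cU; rewrite angle_integral; last by apply/measurable_EFinP; apply: cmeas_cmod2;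
    exact: rcont_cmeas.
  by rewrite normsqE //; apply: rcont_sqint => u _.
have A1 : A F1 t = (normsq lebesgue_measure `[0%R, 1%R]
    (fun u => f ((s%:C * expi u) *: tp t) - f ((r%:C * expi u) *: tp t))%R)%:E.
  rewrite -aE; last by move=> u; apply: rcontB; exact: cu.
  by apply: eq_integral => u _; rewrite /F1 !scale_torus_rot.
have A2 : A F2 t = (normsq lebesgue_measure `[0%R, 1%R] (fun u =>
  f ((r%:C * expi u) *: tp t))%R)%:E.
  rewrite -aE; last by move=> u; exact: cu.
  by apply: eq_integral => u _; rewrite /F2 scale_torus_rot.
have A3 : A F3 t = (normsq lebesgue_measure `[0%R, 1%R] (fun u =>
  f ((s%:C * expi u) *: tp t))%R)%:E.
  rewrite -aE; last by move=> u; exact: cu.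
  by apply: eq_integral => u _; rewrite /F3 scale_torus_rot.
by rewrite A1 A2 A3 -EFinD lee_fin.
Qed.

Local Close Scope ereal_scope.

(** A superlevel set of the radial maximal function over the radii in [X]. The union over [r] is
    uncountable but open ([eps_open_radial]), hence measurable on the torus; the polydisc condition
    keeps the argument where [f] is holomorphic. *)
Definition radial_exceeds (X : set R) f (l : R) : set 'rV[C]_n :=
  [set z | exists r : R, [/\ X r, polydisc (r%:C *: z) & l < cmod (f (r%:C *: z))]].

Lemma eps_open_radial X f l : holomorphic f -> eps_open (radial_exceeds X f l).
Proof.
move=> hf z [r [Xr Dz lz]].
have [d1 d10 h1] := eps_open_polydisc Dz.
have e0 : 0 < cmod (f (r%:C *: z)) - l by rewrite subr_gt0.
have [d2 d20 h2] := continuous_rV_eps (hf _ Dz) e0.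
have r0 : 0 < `|r| + 1 by rewrite ltr_wpDl.
have m0 : 0 < Num.min d1 d2 by rewrite lt_min d10.
exists (Num.min d1 d2 / (`|r| + 1)); first by rewrite divr_gt0.
move=> w hw.
have near i : cmod ((r%:C *: w) ord0 i - (r%:C *: z) ord0 i) < Num.min d1 d2.
  rewrite !mxE -mulrBr cmodM cmod_real; have := hw i; rewrite ltr_pdivlMr //.
  by have := cmod_ge0 (w ord0 i - z ord0 i); move: (cmod _) (Num.min _ _) => c m; lra.
have n1 i : cmod ((r%:C *: w) ord0 i - (r%:C *: z) ord0 i) < d1.
  by apply: lt_le_trans (near i) _; rewrite ge_min lexx.
have n2 i : cmod ((r%:C *: w) ord0 i - (r%:C *: z) ord0 i) < d2.
  by apply: lt_le_trans (near i) _; rewrite ge_min lexx orbT.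
exists r; split => //; first exact: h1.
have := cmodB_ge (f (r%:C *: z)) (f (r%:C *: z) - f (r%:C *: w)).
by rewrite subKr cmodBC; have := h2 _ n2; lra.
Qed.

Lemma measurable_radial X f l : holomorphic f ->
  measurable [set t | radial_exceeds X f l (tp t)].
Proof.
move=> hf; rewrite (_ : [set t | _] = setT `&` tp @^-1` radial_exceeds X f l);
  last by rewrite setTI.
have hc i : cmeas setT (fun t => tp t ord0 i).
  by have := cmeas_torus 1 i; under [X in cmeas _ X -> _]eq_fun do rewrite scale1r.
exact: (eps_open_preimage measurableT hc (eps_open_radial hf)).
Qed.

(** The indicator of the set is averaged over orbits as well, so the claim reduces to
    [slice_maximal] on the orbit of each [t]. *)
Lemma hardy_maximal f (p l : R) : holomorphic f -> 1 / 2 < p -> p < 1 -> 0 < l ->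
  (P [set t | radial_exceeds [set r : R | 1 / 2 < r < p]%R f l (tp t)] <=
   (180 / l)%:E * \int[P]_t (cmod (f (p%:C *: tp t)))%:E)%E.
Proof.
move=> hf p2 p1 l0; set S := [set t | _].
have mS : measurable S by exact: measurable_radial.
have hp : 0 <= p < 1 by rewrite p1 andbT; lra.
have mf : measurable_fun setT (fun t => (cmod (f (p%:C *: tp t)))%:E).
  by apply/measurable_EFinP; apply: cmeas_cmod; exact: cmeas_radial.
have f0 t : (0 <= (cmod (f (p%:C *: tp t)))%:E)%E by rewrite lee_fin cmod_ge0.
have m1 : measurable_fun setT (fun t => (\1_S t : R)%:E) by exact/measurable_EFinP.
have i0 t : (0 <= (\1_S t : R)%:E)%E by rewrite lee_fin.
have ST : torus_fun (fun t => (\1_S t : R)%:E).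
  move=> t t' tt'; rewrite !indicE; suff -> : (t \in S) = (t' \in S) by [].
  by apply/idP/idP; rewrite !inE /S /= tt'.
have -> : P S = (\int[P]_t (\1_S t : R)%:E)%E by rewrite integral_indic // setIT.
rewrite (rot_average m1 i0 ST) (rot_average mf f0);
  last exact: (@torus_funP (fun z => (cmod (f (p%:C *: z)))%:E)).
have mA := measurable_rot_average mf f0.
have l1 : (0 <= (180 / l)%:E)%E by rewrite lee_fin divr_ge0 // ltW.
have A0 t : (0 <= \int[angle_prob R]_s (cmod (f (p%:C *: tp (torus_rot s t))))%:E)%E.
  by apply: integral_ge0 => u _; exact: f0.
rewrite -ge0_integralZl //.
apply: ge0_le_integral => //.
- by move=> t _; apply: integral_ge0 => u _.
- exact: (measurable_rot_average m1 i0).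
- exact: measurable_funeM.
move=> t _; have dg := torus_slice t hf.
have mr : measurable_fun setT (fun u : line => torus_rot u t).
  exact: (measurableT_comp (@measurable_rot R n) (pair2_measurable t)).
pose St : set line := `[(0 : R), 1]%classic `&` (fun u => torus_rot u t) @^-1` S.
have mSt : measurable St.
  by apply: measurableI => //; rewrite -[X in measurable X]setTI; exact: mr.
rewrite angle_integral; last exact: (measurableT_comp m1 mr).
have -> : (\int[lebesgue_measure]_(u in `[0%R, 1%R])
  (\1_S (torus_rot u t) : R)%:E = lebesgue_measure St)%E.
  rewrite (eq_integral (fun u : line => (\1_((fun u => torus_rot u t) @^-1` S) u : R)%:E)) //.
  by rewrite integral_indic // 1?setIC // -[X in measurable X]setTI; exact: mr.
have hSt (u : line) : St u -> 0 <= (u : R) <= 1 /\ exists2 r : R, 1 / 2 < r < p &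
    l < cmod (f ((r%:C * expi u) *: tp t)).
  move=> [] /=; rewrite in_itv /= => u01 [r [rp _ lr]]; split => //.
  by exists r; [exact: rp|move: lr; rewrite scale_torus_rot].
have := slice_maximal dg p1 p2 l0 mSt hSt.
by rewrite (eq_integral _ _ (fun u _ => congr1 (fun z => (cmod (f z))%:E) (scale_torus_rot _ _ _))).
Qed.

End TorusFunctions.

(** * The Hardy space *)

(** The chain [X <= J - I <= S - K < e], carried out in the reals. *)
Lemma fin_increment (R : realType) (S I J K X : \bar R) (a b c x e : R) : S \is a fin_num ->
  I = a%:E -> J = b%:E -> K = c%:E -> X = x%:E ->
  (S - e%:E < K -> J <= S -> K <= I -> X + I <= J -> X <= e%:E)%E.
Proof.
move=> Sfin -> -> -> ->; rewrite -(fineK Sfin).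
by rewrite -EFinB -EFinD lte_fin !lee_fin; lra.
Qed.

Section HardyCauchy.
Variables (R : realType) (n : nat).
Local Notation C := R[i].
Local Notation line := (measurableTypeR R).
Local Notation P := (prob_power (angle_prob R) n).
Local Notation tp := (@torus_point R n).
Implicit Types f : 'rV[C]_n -> C.

Lemma holomorphic_dilate f (k : R) : holomorphic f -> 0 <= k <= 1 ->
  holomorphic (fun z => f (k%:C *: z)).
Proof.
move=> hf /andP[k0 k1] z hz.
have hkz : polydisc (k%:C *: z).
  move=> i; rewrite mxE cmodM cmod_real ger0_norm //; have := hz i.
  by have := cmod_ge0 (z ord0 i); nra.
apply: (@differentiable_comp _ _ _ _ (fun z : 'rV[C]_n => k%:C *: z) f) => //.
exact: hf.
Qed.

(** For [k < 1] the dilate of [f] is continuous up to the torus, so the oscillation of [f] along a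
    radius is controlled by the maximal function of the gap. *)
Definition dilation_gap (k : R) f : 'rV[C]_n -> C := fun z => f z - f (k%:C *: z).

Lemma holomorphic_gap f (k : R) : holomorphic f -> 0 <= k <= 1 -> holomorphic (dilation_gap k f).
Proof.
move=> hf k01; have := holomorphic_lin (-1) hf (holomorphic_dilate hf k01).
by rewrite /dilation_gap; under eq_fun do rewrite mulN1r.
Qed.

Let fr f (r : R) (t : n.-tuple line) : C := f (r%:C *: tp t).

Lemma hardy_sqint f (r : R) : hardy_mem f -> 0 < r < 1 -> sqint P setT (fr f r).
Proof.
move=> [hf fin] r01; split.
  by apply: cmeas_radial => //; case/andP: r01 => /ltW -> ->.
by apply: le_lt_trans fin; apply: ereal_sup_ubound; exists r.
Qed.

Lemma radial_mono f (r s : R) : holomorphic f -> 0 < r -> r <= s -> s < 1 ->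
  (\int[P]_t (cmod (fr f r t) ^+ 2)%:E <= \int[P]_t (cmod (fr f s t) ^+ 2)%:E)%E.
Proof.
move=> hf r0 rs s1; apply: le_trans (radial_increment hf r0 rs s1).
by apply: leeDr; apply: integral_ge0 => t _; rewrite lee_fin sqr_ge0.
Qed.

Lemma hardy_cauchy f (e : R) : hardy_mem f -> 0 < e -> exists2 p : R, 0 < p < 1 &
  forall r s : R, p < r -> r <= s -> s < 1 ->
  (\int[P]_t (cmod (fr f s t - fr f r t) ^+ 2)%:E <= e%:E)%E.
Proof.
move=> mf e0; have [hf fin] := mf; set S := ereal_sup _ in fin.
have ub (r : R) : 0 < r < 1 -> (\int[P]_t (cmod (fr f r t) ^+ 2)%:E <= S)%E.
  by move=> r01; apply: ereal_sup_ubound; exists r => //; rewrite /= in_itv.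
have h01 : 0 < (1 / 2 : R) < 1.
  by apply/andP; split; lra.
have Sfin : S \is a fin_num.
  rewrite ge0_fin_numE //; apply: le_trans (ub _ h01).
  by apply: integral_ge0 => t _; rewrite lee_fin sqr_ge0.
have [_ [p p01 <-] hp] := ub_ereal_sup_adherent e0 Sfin.
have {}p01 : 0 < p < 1 by move: p01; rewrite /= in_itv.
exists p => // r s pr rs s1; have /andP[p0 _] := p01.
have r0 := lt_trans p0 pr; have s0 := lt_le_trans r0 rs.
have hi := radial_increment hf r0 rs s1.
have hm := radial_mono hf p0 (ltW pr) (le_lt_trans rs s1).
have sr : sqint P setT (fr f r) by apply: hardy_sqint => //; rewrite r0 (le_lt_trans rs).
have ss : sqint P setT (fr f s) by apply: hardy_sqint => //; rewrite s0.
have sp : sqint P setT (fr f p) by exact: hardy_sqint.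
have sd := sqintB measurableT ss sr.
have hs : (\int[P]_t (cmod (fr f s t) ^+ 2)%:E <= S)%E by apply: ub; rewrite s0.
exact: (fin_increment Sfin (normsqE sr) (normsqE ss) (normsqE sp) (normsqE sd) hp hs hm hi).
Qed.

(** The gap is holomorphic, so its means increase with the radius. [hardy_cauchy] bounds it at a
    radius [s >= p] with [k * s > q], hence also at [p]. *)
Lemma hardy_gap f (e : R) : hardy_mem f -> 0 < e -> exists2 k : R, 0 < k < 1 &
  forall p : R, 0 < p < 1 -> (\int[P]_t (cmod (fr (dilation_gap k f) p t) ^+ 2)%:E <= e%:E)%E.
Proof.
move=> mf e0; have [q /andP[q0 q1] hq] := hardy_cauchy mf e0.
pose k := (1 + q) / 2; have k0 : 0 < k by rewrite divr_gt0 ?addr_gt0.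
have qk : q < k by rewrite /k; lra.
have k1 : k < 1 by rewrite /k; lra.
exists k; first by rewrite k0.
move=> p /andP[p0 p1]; pose s := Num.max p ((q / k + 1) / 2).
have qk1 : q / k < 1 by rewrite ltr_pdivrMr // mul1r.
have ps : p <= s by rewrite le_max lexx.
have s1 : s < 1 by rewrite gt_max p1; lra.
have s0 := lt_le_trans p0 ps.
have qks : q < k * s.
  have : q / k < s by apply: (@lt_le_trans _ _ ((q / k + 1) / 2)); [lra|rewrite le_max lexx orbT].
  by rewrite ltr_pdivrMr // mulrC.
have k01 : 0 <= k <= 1 by rewrite !ltW.
apply: le_trans (radial_mono (holomorphic_gap mf.1 k01) p0 ps s1) _.
apply: le_trans (hq _ _ qks _ s1); last by rewrite -[leRHS]mul1r ler_pM2r // ltW.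
rewrite le_eqVlt; apply/orP; left; apply/eqP; apply: eq_integral => t _.
by rewrite /fr /dilation_gap scalerA -rmorphM.
Qed.

(** [|F| <= |F|^2 / (2 e) + e / 2], integrated against a probability. *)
Lemma integral_le_sqrt (F : n.-tuple line -> C) (e : R) : 0 < e -> cmeas setT F ->
  (\int[P]_t (cmod (F t) ^+ 2)%:E <= (e ^+ 2)%:E)%E -> (\int[P]_t (cmod (F t))%:E <= e%:E)%E.
Proof.
move=> e0 mF h; have mF2 := cmeas_cmod2 mF; have mF1 := cmeas_cmod mF.
have e2 : 0 <= (2 * e)^-1 by rewrite invr_ge0 mulr_ge0 // ltW.
apply: (@le_trans _ _ (\int[P]_t ((2 * e)^-1%:E * (cmod (F t) ^+ 2)%:E + (e / 2)%:E))%E).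
  apply: ge0_le_integral => //.
  - by move=> t _; rewrite lee_fin cmod_ge0.
  - exact/measurable_EFinP.
  - by apply: emeasurable_funD => //; apply: measurable_funeM; exact/measurable_EFinP.
  move=> t _; rewrite -EFinM -EFinD lee_fin.
  have -> : (2 * e)^-1 * cmod (F t) ^+ 2 + e / 2 = cmod (F t) + (2 * e)^-1 * (cmod (F t) - e) ^+ 2.
    by field; rewrite gt_eqF.
  by rewrite lerDl mulr_ge0 ?sqr_ge0.
rewrite ge0_integralD //; last 3 first.
- by move=> t _; rewrite -EFinM lee_fin mulr_ge0 ?sqr_ge0.
- by apply: measurable_funeM; exact/measurable_EFinP.
- by move=> t _; rewrite lee_fin divr_ge0 // ltW.
rewrite ge0_integralZl //; last 2 first.
- exact/measurable_EFinP.
- by move=> t _; rewrite lee_fin sqr_ge0.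
rewrite integral_cst // [X in (_ + _ * X)%E](_ : _ = 1%E) ?mule1; last exact: probability_setT.
apply: (@le_trans _ _ ((2 * e)^-1%:E * (e ^+ 2)%:E + (e / 2)%:E)%E).
  by apply: leeD => //; apply: lee_wpmul2l => //; rewrite lee_fin.
by rewrite -EFinM -EFinD lee_fin; rewrite le_eqVlt; apply/orP; left; apply/eqP; field;
  rewrite gt_eqF.
Qed.

(** The weak type bound at radius [q j] has a constant independent of [j], so it passes to the
    increasing union over [j]; [d] is chosen so that [180 / l * d = e]. *)
Lemma hardy_gap_small f (l e : R) : hardy_mem f -> 0 < l -> 0 < e ->
  exists2 k : R, 0 < k < 1 &
  (P [set t | radial_exceeds [set r : R | 1 / 2 < r < 1]%R (dilation_gap k f) l (tp t)] <= e%:E)%E.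
Proof.
move=> mf l0 e0; pose d := e * l / 180; have d0 : 0 < d by rewrite divr_gt0 ?mulr_gt0.
have d2 : 0 < d ^+ 2 by rewrite exprn_gt0.
have [k k01 hk] := hardy_gap mf d2; exists k => //.
have /andP[k0 k1] := k01.
have hg : holomorphic (dilation_gap k f) by apply: holomorphic_gap mf.1 _; rewrite !ltW.
(* The shift by 3 keeps [q j] above [1 / 2], as [hardy_maximal] requires. *)
pose q (j : nat) : R := 1 - j.+3%:R^-1.
have q2 j : 1 / 2 < q j.
  by rewrite /q ltrBrDr -ltrBrDl; apply: (@le_lt_trans _ _ (3^-1));
    [rewrite lef_pV2 ?posrE // ler_nat|lra].
have q1 j : q j < 1 by rewrite /q gtrBl invr_gt0.
pose F j := [set t | radial_exceeds [set r : R | 1 / 2 < r < q j]%R (dilation_gap k f) l (tp t)].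
have mF j : measurable (F j) by exact: measurable_radial.
have Fb j : (P (F j) <= e%:E)%E.
  apply: le_trans (hardy_maximal hg (q2 j) (q1 j) l0) _.
  have q01 : 0 < q j < 1 by rewrite q1 andbT (lt_trans _ (q2 j)) // divr_gt0.
  have := integral_le_sqrt d0 _ (hk _ q01).
  have mq : cmeas setT (fr (dilation_gap k f) (q j)).
    by apply: cmeas_radial => //; case/andP: q01 => /ltW -> ->.
  move=> /(_ mq) h; apply: (@le_trans _ _ ((180 / l)%:E * d%:E)%E).
    by apply: lee_wpmul2l; [rewrite lee_fin divr_ge0 // ltW|exact: h].
  by rewrite -EFinM lee_fin /d; rewrite le_eqVlt; apply/orP; left; apply/eqP; field; rewrite gt_eqF.
have nF : nondecreasing_seq F.
  move=> i j ij; apply/subsetPset => t [r [/= /andP[r1 r2] Dr lr]]; exists r; split => //=.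
  rewrite r1 (lt_le_trans r2) // /q lerD2l lerN2 lef_pV2 ?posrE // ler_nat.
  by rewrite !ltnS.
have mU : measurable (\bigcup_j F j) by exact: bigcupT_measurable.
have cv : P \o F @ \oo --> P (\bigcup_j F j) := nondecreasing_cvg_mu mF mU nF.
have UE : [set t | radial_exceeds [set r : R | 1 / 2 < r < 1]%R (dilation_gap k f)
  l (tp t)] = \bigcup_j F j.
  apply/seteqP; split => t.
    move=> [r [/= /andP[r1 r2] Dr lr]].
    have r10 : 0 < 1 - r by rewrite subr_gt0.
    have [j] := ltr_add_invr r10; rewrite add0r => hj.
    exists j => //; exists r; split => //=; rewrite r1 /= /q ltrBrDr -ltrBrDl.
    by apply: le_lt_trans hj; rewrite lef_pV2 ?posrE // ler_nat; apply: leqW; exact: leqnSn.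
  move=> [j _ [r [/= /andP[r1 r2] Dr lr]]]; exists r; split => //=.
  by rewrite r1 (lt_trans r2).
rewrite UE -(cvg_lim _ cv) //; apply: lime_le; first by apply/cvg_ex; eexists; exact: cv.
exact: nearW.
Qed.

End HardyCauchy.

(** * Radial limits *)

Section RadialLimit.
Variable R : realType.
Local Notation C := R[i].
Implicit Types (u : R -> C) (l : C).

Definition radlim u l : Prop := forall e : R, 0 < e ->
  exists2 p : R, p < 1 & forall r, p < r -> r < 1 -> cmod (u r - l) < e.

Definition rcauchy u : Prop := forall e : R, 0 < e ->
  exists2 p : R, p < 1 & forall r s, p < r -> r < 1 -> p < s -> s < 1 -> cmod (u r - u s) <= e.

Lemma radlimP u l : radlim u l <-> ccvg (1 : R)^'- u l.
Proof.
split=> h e /h.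
  move=> [p p1 hp]; rewrite -nbhs_nearE; apply/nbhs_ballP; exists (1 - p) => /=;
    first by rewrite subr_gt0.
  move=> r; rewrite /ball /= ltr_distlC => /andP[r1 _] r2; apply: hp => //.
  by rewrite subKr in r1.
move=> /nbhs_ballP[d /= d0 hd]; exists (1 - d); first by rewrite gtrBl.
move=> r r1 r2; apply: hd => //; rewrite /ball /= gtr0_norm ?subr_gt0 // ltrBlDr -ltrBlDl //.
Qed.

Lemma rcauchy_radlim u : rcauchy u -> exists l, radlim u l.
Proof.
move=> cu; have [p p1 hp] := cu _ ltr01.
pose q := (p + 1) / 2; have pq : p < q by rewrite /q; lra.
have q1 : q < 1 by rewrite /q; lra.
(* [ultra_ccvg] asks for a globally bounded function, so [u] is replaced by the constant [u q] away
   from the interval on which the Cauchy estimate bounds it. *)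
pose v r := if (p < r) && (r < 1) then u r else u q.
have vB r : cmod (v r) <= cmod (u q) + 1.
  rewrite /v; case: ifP => [/andP[pr r1]|_]; last by rewrite lerDl.
  have := hp r q pr r1 pq q1; have := cmodD (u r - u q) (u q); rewrite subrK; lra.
have [U [UU subU]] := @ultraFilterLemma R (1 : R)^'- _.
have [l hl] := ultra_ccvg UU vB; have PU := @ultra_proper _ _ UU.
exists l => e e0; have e2 : 0 < e / 2 by rewrite divr_gt0.
have [p' p'1 hp'] := cu _ e2.
exists (Num.max p p'); first by rewrite gt_max p1.
move=> r; rewrite gt_max => /andP[pr p'r] r1.
apply: (@le_lt_trans _ _ (e / 2)); last by lra.
apply: (@ccvg_le _ _ U _ (fun s => u r - v s)); first by apply: ccvgB => //; exact: ccvg_cst.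
apply: subU; apply/nbhs_ballP; exists (1 - Num.max p p') => /=.
  by rewrite subr_gt0 gt_max p1.
move=> s; rewrite /ball /= ltr_distlC subKr gt_max => /andP[/andP[ps p's] _] s1.
by rewrite /v ps s1 /=; exact: hp'.
Qed.

Lemma radlim_rcauchy u l : radlim u l -> rcauchy u.
Proof.
move=> h e e0; have e2 : 0 < e / 2 by rewrite divr_gt0.
have [p p1 hp] := h _ e2; exists p => // r s pr r1 ps s1.
have := cmodB (u r - l) (u s - l); rewrite opprB addrA subrK => /le_trans; apply.
by have := hp _ pr r1; have := hp _ ps s1; lra.
Qed.

Lemma radlimD_lin u v l m (c : C) : radlim u l -> radlim v m ->
  radlim (fun r => u r + c * v r) (l + c * m).
Proof.
move=> /radlimP hu /radlimP hv; apply/radlimP.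
by apply: ccvgD => //; apply: ccvgM => //; exact: ccvg_cst.
Qed.

Lemma radlimM u v l m : radlim u l -> radlim v m -> radlim (fun r => u r * v r) (l * m).
Proof. by move=> /radlimP hu /radlimP hv; apply/radlimP; exact: ccvgM. Qed.

Lemma radlim_seq u l : radlim u l -> ccvg \oo (fun j : nat => u (1 - j.+2%:R^-1)) l.
Proof.
move=> h e /h[p p1 hp]; have p0 : 0 < 1 - p by rewrite subr_gt0.
have [N] := ltr_add_invr p0; rewrite add0r => hN.
exists N => // j /= Nj; apply: hp; last by rewrite gtrBl invr_gt0.
rewrite ltrBrDr -ltrBrDl; apply: le_lt_trans hN.
by rewrite lef_pV2 ?posrE // ler_nat ltnS ltnW.
Qed.

Lemma cmeas_ccvg d (T : measurableType d) (D : set T) (F : nat -> T -> C) (G : T -> C) :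
  (forall j, cmeas D (F j)) -> (forall x, D x -> ccvg \oo (F ^~ x) (G x)) -> cmeas D G.
Proof.
move=> mF FG; split.
  apply: (@measurable_fun_cvg _ _ _ D (fun j x => complex.Re (F j x))) => [j|x Dx].
    exact: (mF j).1.
  by have /ccvgP := FG x Dx; exact: cvg_Re.
apply: (@measurable_fun_cvg _ _ _ D (fun j x => complex.Im (F j x))) => [j|x Dx].
  exact: (mF j).2.
by have /ccvgP := FG x Dx; exact: cvg_Im.
Qed.

End RadialLimit.

(** * Existence and measurability of boundary values *)

Section BoundaryValue.
Variables (R : realType) (n : nat).
Local Notation C := R[i].
Local Notation line := (measurableTypeR R).
Local Notation P := (prob_power (angle_prob R) n).
Local Notation tp := (@torus_point R n).
Implicit Types f : 'rV[C]_n -> C.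

Definition ray f (t : n.-tuple line) (r : R) : C := f (r%:C *: tp t).

Lemma boundary_valueP f t l : radlim (ray f t) l -> boundary_value f t = l.
Proof.
move=> /radlimP/ccvgP h; apply: cvg_lim h.
exact: norm_hausdorff.
Qed.

(** Without a limit, [lim] returns the default point, which is 0. This makes the boundary value a
    limit of measurable functions at every [t]. *)
Lemma boundary_value0 f t : ~ rcauchy (ray f t) -> boundary_value f t = 0.
Proof.
move=> h; apply: dvgP => /cvg_ex[l /ccvgP/radlimP/radlim_rcauchy]; exact: h.
Qed.

(** The Cauchy condition involves uncountably many pairs [x r <= r] of radii, but its failure for a
    given tolerance and threshold is an open condition on the torus point. Only tolerances [k] and
    thresholds [m] have to be countable. *)
Lemma measurable_rcauchy f : holomorphic f -> measurable [set t | rcauchy (ray f t)].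
Proof.
move=> hf; pose p (m : nat) : R := 1 - m.+1%:R^-1.
have p0 m : 0 <= p m by rewrite subr_ge0 invf_le1 // ler1n.
have p1 m : p m < 1 by rewrite gtrBl invr_gt0.
pose U (k m : nat) : set 'rV[C]_n := [set z | exists x : R, 0 <= x <= 1 /\
  radial_exceeds [set r | p m < x * r /\ r < 1] (dilation_gap x f) k.+1%:R^-1 z].
have oU k m : eps_open (U k m).
  move=> z [x [x01 hz]]; have [e e0 he] := eps_open_radial (holomorphic_gap hf x01) hz.
  by exists e; [exact: e0|move=> w hw; exists x; split; [exact: x01|exact: he]].
have hc i : cmeas setT (fun t => tp t ord0 i).
  by have := @cmeas_torus R n 1 i; under [X in cmeas _ X -> _]eq_fun do rewrite scale1r.
rewrite (_ : [set t | _] = \bigcap_k \bigcup_m (setT `\` (setT `&` tp @^-1` U k m))).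
  apply: bigcapT_measurable => k; apply: bigcupT_measurable => m.
  by apply: measurableD => //; exact: (eps_open_preimage measurableT hc (oU k m)).
apply/seteqP; split => t.
  move=> ct k _; have k0 : 0 < k.+1%:R^-1 :> R by rewrite invr_gt0.
  have [q q1 hq] := ct _ k0; have q10 : 0 < 1 - q by rewrite subr_gt0.
  have [m] := ltr_add_invr q10; rewrite add0r => hm.
  exists m => //; split => // -[_ [x [/andP[x0 x1] [r [/= [pr r1] _]]]]].
  have qp : q < p m by rewrite /p ltrBrDr -ltrBrDl.
  have r0 : 0 < r.
    by have := le_lt_trans (p0 m) pr; rewrite ltNge => /negP h; rewrite ltNge; apply/negP => r0;
      apply: h; nra.
  have xr : x * r <= r by rewrite -[leRHS]mul1r ler_pM2r.
  rewrite /dilation_gap scalerA -rmorphM ltNge => /negP; apply; apply: hq => //.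
  - by apply: lt_le_trans xr; exact: lt_trans pr.
  - exact: lt_trans pr.
  - exact: le_lt_trans r1.
move=> h e e0; have [k] := ltr_add_invr e0; rewrite add0r => hk.
have [m _ [_ nU]] := h k I; exists (p m) => //.
have wl (r s : R) : s <= r -> p m < r -> r < 1 -> p m < s -> s < 1 -> cmod (ray f t r - ray f t s)
  <= e.
  move=> sr pr r1 ps s1; rewrite leNgt; apply/negP => lt; apply: nU; split => //=.
  have r0 : 0 < r by exact: le_lt_trans pr.
  exists (s / r); split.
    by rewrite divr_ge0 ?ler_pdivrMr ?mul1r // ltW // (le_lt_trans _ ps).
  have srr : s / r * r = s by rewrite divfK // gt_eqF.
  exists r; split => /=; first by rewrite srr.
    by apply: torus_polydisc; apply: cmod_lt1_real; rewrite ltW.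
  by rewrite /dilation_gap scalerA -rmorphM srr (lt_trans hk).
move=> r s pr r1 ps s1; have [sr|/ltW rs] := leP s r; first exact: wl.
by rewrite cmodBC; exact: wl.
Qed.

Lemma cmeas_boundary_value f : holomorphic f -> cmeas setT (boundary_value f).
Proof.
move=> hf; pose A := [set t | rcauchy (ray f t)].
have mA : measurable A by exact: measurable_rcauchy.
have r01 (j : nat) : 0 <= (1 - j.+2%:R^-1 : R) < 1.
  by rewrite subr_ge0 invf_le1 ?ler1n // gtrBl invr_gt0 ltr0n.
apply: (@cmeas_ccvg _ _ _ _ (fun j t => (\1_A t : R)%:C * ray f t (1 - j.+2%:R^-1))).
  move=> j; apply: cmeasM; last exact: cmeas_radial.
  by split => /=; [exact: measurable_indic|exact: measurable_cst].
move=> t _; have [At|nA] := pselect (A t).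
  rewrite indicE mem_set //; have [l hl] := rcauchy_radlim At.
  rewrite (boundary_valueP hl); under eq_fun do rewrite mul1r.
  exact: radlim_seq.
rewrite indicE memNset // boundary_value0 //; under eq_fun do rewrite mul0r.
exact: ccvg_cst.
Qed.

Lemma negligible_small d (T : measurableType d) (mu : {measure set T -> \bar R}) (N : set T) :
  (forall e : R, 0 < e -> exists S, [/\ measurable S, N `<=` S & (mu S <= e%:E)%E]) ->
  mu.-negligible N.
Proof.
move=> h; have /choice[S hS] : forall j : nat, exists S,
  [/\ measurable S, N `<=` S & (mu S <= j.+1%:R^-1%:E)%E].
  by move=> j; apply: h; rewrite invr_gt0.
have mS j : measurable (S j) by have [] := hS j.
exists (\bigcap_j S j); split; first exact: bigcapT_measurable.
  apply/eqP; rewrite eq_le measure_ge0 andbT; apply/lee_addgt0Pr => e e0; rewrite add0e.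
  have [j] := ltr_add_invr e0; rewrite add0r => hj.
  have [_ _ le] := hS j; apply: (@le_trans _ _ (mu (S j))).
    by apply: le_measure; rewrite ?inE //; [exact: bigcapT_measurable|move=> x; exact].
  by apply: le_trans le _; rewrite lee_fin ltW.
by move=> x Nx j _; have [_ sub _] := hS j; exact: sub.
Qed.

(** Write [l] for [1 / (k + 1)]. Off a set of small measure [f(r t)] is within [l] of [f(x r t)],
    which for [r] near 1 is within [l / 2] of the interior value [f(x t)]. Two radii therefore
    differ by at most [3 l], the tolerance in [N k]. *)
Lemma hardy_ae_rcauchy f : hardy_mem f -> {ae P, forall t, rcauchy (ray f t)}.
Proof.
move=> mf; have [hf _] := mf.
pose N (k : nat) : set (n.-tuple line) := [set t | ~ exists2 p : R, p < 1 &
  forall r s, p < r -> r < 1 -> p < s -> s < 1 -> cmod (ray f t r - ray f t s) <= 3 * k.+1%:R^-1].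
have negN k : P.-negligible (N k).
  apply: negligible_small => e e0; have l0 : 0 < k.+1%:R^-1 :> R by rewrite invr_gt0.
  have [x x01 hx] := hardy_gap_small mf l0 e0; have /andP[x0 x1] := x01.
  eexists; split; [|move=> t|exact: hx].
    by apply: measurable_radial; apply: holomorphic_gap => //; rewrite !ltW.
  move=> Nt; apply: contrapT => nS; apply: Nt.
  have gap r : 1 / 2 < r -> r < 1 -> cmod (ray f t r - ray f t (x * r)) <= k.+1%:R^-1.
    move=> r2 r1; rewrite leNgt; apply/negP => lt; apply: nS; exists r; split => /=.
    - by rewrite r2.
    - by apply: torus_polydisc; apply: cmod_lt1_real; rewrite r1 andbT; lra.
    - by rewrite /dilation_gap scalerA -rmorphM.
  have xc : cmod (x%:C : C) < 1 by apply: cmod_lt1_real; rewrite ltW.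
  have l2 : 0 < k.+1%:R^-1 / 2 :> R by rewrite divr_gt0.
  have [d d0 hd] := continuous1_eps (torus_slice t hf xc) l2.
  exists (Num.max (1 / 2) (1 - d)); first by rewrite gt_max gtrBl d0 andbT; lra.
  have near r : Num.max (1 / 2) (1 - d) < r -> r < 1 ->
     cmod (ray f t r - f (x%:C *: tp t)) <= k.+1%:R^-1 + k.+1%:R^-1 / 2.
    rewrite gt_max => /andP[r2 rd] r1.
    have := cmodD (ray f t r - ray f t (x * r)) (ray f t (x * r) - f (x%:C *: tp t)).
    rewrite addrA subrK => /le_trans; apply; apply: lerD; first exact: gap.
    rewrite /ray ltW //; apply: hd; rewrite -rmorphB cmod_real.
    by rewrite -[X in _ - X]mulr1 -mulrBr normrM gtr0_norm // distrC gtr0_norm; nra.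
  move=> r s pr r1 ps s1; have h1 := near _ pr r1; have h2 := near _ ps s1.
  have := cmodB (ray f t r - f (x%:C *: tp t)) (ray f t s - f (x%:C *: tp t)).
  have -> : ray f t r - f (x%:C *: tp t) - (ray f t s - f (x%:C *: tp t)) = ray f t r - ray f t s.
    by ring.
  move=> /le_trans; apply; apply: le_trans (lerD h1 h2) _.
  by move: (k.+1%:R^-1) => y; lra.
have negU : P.-negligible (\bigcup_k N k) by exact: negligible_bigcup.
apply: negligibleS negU => t /= nc; apply: contrapT => nU; apply: nc => e e0.
have e3 : 0 < e / 3 by rewrite divr_gt0.
have [k] := ltr_add_invr e3; rewrite add0r => hk.
have : ~ N k t by move=> Nk; apply: nU; exists k.
move=> /contrapT[p p1 hp]; exists p => // r s pr r1 ps s1.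
apply: le_trans (hp _ _ pr r1 ps s1) _; move: hk.
by move: (k.+1%:R^-1) => y; lra.
Qed.

End BoundaryValue.

Section TorusLocal.
Variable R : realType.
Local Notation C := R[i].
Local Notation line := (measurableTypeR R).

Lemma scale_vcons n (c x : C) (w : 'rV[C]_n) : c *: vcons x w = vcons (c * x) (c *: w).
Proof.
apply/rowP => i; rewrite mxE; case: (unliftP ord0 i) => [j|] ->.
  by rewrite !vconsS mxE.
by rewrite !vcons0.
Qed.

(** The counterpart of [polydisc_local] on a torus of radius [p]: [circle_sub_mean] in the first
    coordinate and induction in the others. *)
Lemma torus_local (r p : R) n : 0 <= r -> r < p -> p < 1 -> exists2 K : R, 0 <= K &
  forall (f : 'rV[C]_n -> C) z, holomorphic f -> rnorm z <= r ->
  ((cmod (f z) ^+ 2)%:E <= K%:E * \int[prob_power (angle_prob R) n]_t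
     (cmod (f (p%:C *: torus_point t)) ^+ 2)%:E)%E.
Proof.
move=> r0 rp p1; have p01 : 0 <= p < 1 by rewrite p1 (le_trans r0 (ltW rp)).
elim: n => [|n [K K0 IH]].
  exists 1 => // f z hf _; rewrite mul1e integral_prob_power0; last first.
    by apply/measurable_EFinP; apply: cmeas_cmod2; exact: cmeas_radial.
  by rewrite (_ : p%:C *: _ = z) //; apply/rowP => -[].
have K10 : 0 <= p / (p - r) by rewrite divr_ge0 ?subr_ge0 ?(ltW rp) //; case/andP: p01.
exists (p / (p - r) * K); first exact: mulr_ge0.
move=> f z hf zr.
have zr0 : cmod (z ord0 ord0 - 0) <= r by rewrite subr0 (le_trans (coord_le_rnorm _ _) zr).
have wr : rnorm (vtail z) <= r.
  by apply: rnorm_rV_le => // i; rewrite mxE; apply: le_trans (coord_le_rnorm _ _) zr.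
have wD : polydisc (vtail z) by apply: rnorm_polydisc; exact: le_lt_trans wr (lt_trans rp p1).
pose F (t : n.+1.-tuple line) := (cmod (f (p%:C *: torus_point t)) ^+ 2)%:E.
have mF : measurable_fun setT F.
  by apply/measurable_EFinP; apply: cmeas_cmod2; exact: cmeas_radial.
have F0 t : (0 <= F t)%E by rewrite lee_fin sqr_ge0.
rewrite ge0_integral_prob_powerS //.
pose J (x : line) := (\int[prob_power (angle_prob R) n]_t F (tuple_cons (x, t)))%E.
have mJ : measurable_fun setT J by exact: measurable_prob_power_inner.
have J0 x : (0 <= J x)%E by apply: integral_ge0 => t _.
have pe x : cmod (p%:C * expi x) = p by rewrite cmodM cmod_expi mulr1 cmod_real ger0_norm //;
  case/andP: p01.
have HJ x : ((cmod (f (vcons (p%:C * expi x) (vtail z))) ^+ 2)%:E <= K%:E * J x)%E.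
  apply: le_trans (IH (fun w => f (vcons (p%:C * expi x) w)) _ _ wr) _.
    by apply: holomorphic_slice => //; rewrite pe.
  rewrite le_eqVlt; apply/orP; left; apply/eqP; congr (_ * _)%E.
  by apply: eq_integral => t _; rewrite /F torus_point_cons scale_vcons.
have dg y : cmod (y - 0) <= p -> cdiff (fun y => f (vcons y (vtail z))) y.
  by rewrite subr0 => hy; apply: cdiff_vcons => //; exact: le_lt_trans p1.
have := circle_sub_mean rp zr0 dg; rewrite vcons_eta => /le_trans; apply.
rewrite [X in (_ <= X * _)%E]EFinM -[leRHS]muleA; apply: lee_wpmul2l; first by rewrite lee_fin.
rewrite -ge0_integralZl //; last by move=> x _; exact: J0.
apply: ge0_le_integral => //.
- by move=> x _; rewrite lee_fin sqr_ge0.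
- apply/measurable_EFinP; apply: cmeas_cmod2; apply: rcont_cmeas => x.
  apply: circle_rcont dg; by case/andP: p01.
- exact: measurable_funeM.
by move=> x _; rewrite add0r; exact: HJ.
Qed.

End TorusLocal.

Section HardyTrace.
Variables (R : realType) (n : nat).
Local Notation C := R[i].
Local Notation line := (measurableTypeR R).
Local Notation P := (prob_power (angle_prob R) n).
Local Notation tp := (@torus_point R n).
Implicit Types f : 'rV[C]_n -> C.

Let fr f (r : R) (t : n.-tuple line) : C := f (r%:C *: tp t).

(** Fatou's lemma as the outer radius in [hardy_cauchy] tends to 1; almost everywhere convergence
    identifies the L^2 limit of the dilates with the boundary value. *)
Lemma hardy_radial_cvg f (e : R) : hardy_mem f -> 0 < e -> exists2 p : R, 0 < p < 1 &
  forall r : R, p < r -> r < 1 ->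
  (\int[P]_t (cmod (boundary_value f t - fr f r t) ^+ 2)%:E <= e%:E)%E.
Proof.
move=> mf e0; have [hf _] := mf; have [p /andP[p0 p1] hp] := hardy_cauchy mf e0.
exists p; first by rewrite p0.
move=> r pr r1; have r01 : 0 <= r < 1 by rewrite r1 ltW // (lt_trans p0).
pose q (i : nat) : R := 1 - i.+2%:R^-1.
have q01 i : 0 <= q i < 1 by rewrite subr_ge0 invf_le1 ?ler1n // gtrBl invr_gt0 ltr0n.
apply: (@fatou_sq _ _ _ P setT measurableT (fun i t => fr f (q i) t - fr f r t)).
- by move=> i; apply: cmeasB; exact: cmeas_radial.
- by apply: cmeasB; [exact: cmeas_boundary_value|exact: cmeas_radial].
- apply: filterS (hardy_ae_rcauchy mf) => t /rcauchy_radlim[l hl] _.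
  rewrite (boundary_valueP hl); apply: ccvgB; last exact: ccvg_cst.
  exact: (radlim_seq hl).
have r0 : 0 < 1 - r by rewrite subr_gt0.
have [N] := ltr_add_invr r0; rewrite add0r => hN.
exists N => // i /= Ni; apply: hp => //; last by case/andP: (q01 i).
rewrite /q lerBrDr -lerBrDl; apply: le_trans (ltW hN).
by rewrite lef_pV2 ?posrE // ler_nat ltnS ltnW.
Qed.

Lemma hardy_trace_sqint f : hardy_mem f -> sqint P setT (boundary_value f).
Proof.
move=> mf; have [hf _] := mf; have [p /andP[p0 p1] hp] := hardy_radial_cvg mf ltr01.
pose r := (p + 1) / 2; have pr : p < r by rewrite /r; lra.
have r1 : r < 1 by rewrite /r; lra.
have sr : sqint P setT (fr f r) by apply: hardy_sqint => //; rewrite r1 (lt_trans p0).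
have sd : sqint P setT (fun t => boundary_value f t - fr f r t).
  split; first by apply: cmeasB; [exact: cmeas_boundary_value|exact: sr.1].
  by apply: le_lt_trans (hp _ pr r1) _; rewrite ltry.
have := sqintD measurableT sd sr.
by rewrite (_ : (fun t => _) = boundary_value f) //; apply/funext => t; rewrite subrK.
Qed.

Lemma hardy_radial_bounded f (r : R) : hardy_mem f -> r < 1 ->
  exists B : R, forall z, rnorm z <= r -> cmod (f z) <= B.
Proof.
move=> mf r1; have [r0|r0] := leP 0 r; last first.
  by exists 0 => z zr; have := le_lt_trans (le_trans (rnorm_ge0 z) zr) r0; rewrite ltxx.
pose p := (r + 1) / 2; have rp : r < p by rewrite /p; lra.
have p1 : p < 1 by rewrite /p; lra.
have [K K0 hK] := torus_local n r0 rp p1.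
have sp : sqint P setT (fr f p) by apply: hardy_sqint => //; rewrite p1 (le_lt_trans r0).
exists (1 + K * normsq P setT (fr f p)) => z zr.
have := hK _ _ mf.1 zr; rewrite (normsqE sp) -EFinM lee_fin.
by have := cmod_ge0 (f z); have := normsq_ge0 P setT (fr f p); nra.
Qed.

(** [torus_local] bounds [f z] by the mean at radius [p], hence by the mean at a larger radius [s].
    Comparing that dilate with the boundary value costs the factor 2 and an error that vanishes as
    [s] tends to 1. *)
Lemma hardy_local (r : R) : r < 1 -> exists K : R, forall f z, hardy_mem f -> rnorm z <= r ->
  ((cmod (f z) ^+ 2)%:E <= K%:E * \int[P]_t (cmod (boundary_value f t) ^+ 2)%:E)%E.
Proof.
move=> r1; have [r0|r0] := leP 0 r; last first.
  by exists 0 => f z _ zr; have := le_lt_trans (le_trans (rnorm_ge0 z) zr) r0; rewrite ltxx.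
pose p := (r + 1) / 2; have rp : r < p by rewrite /p; lra.
have p1 : p < 1 by rewrite /p; lra.
have [K K0 hK] := torus_local n r0 rp p1.
have arith (e x a b c y : R) : 0 <= x -> x * (2 * K + 1) <= e -> y <= K * a -> a <= b ->
    b <= 2 * c + 2 * x -> y <= 2 * K * c + e.
  clear hK => x0 xe ya ab bc; have := ler_wpM2l K0 (le_trans ab bc); lra.
exists (2 * K) => f z mf zr; have sf := hardy_trace_sqint mf.
rewrite (normsqE sf) -EFinM lee_fin; apply/ler_addgt0Pr => e e0.
(* The error enters with the factor [2 * K]; the summand 1 covers [K = 0]. *)
have e1 : 0 < e / (2 * K + 1) by rewrite divr_gt0 // ltr_wpDl ?mulr_ge0.
have [q /andP[q0 q1] hq] := hardy_radial_cvg mf e1.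
pose s := Num.max p ((q + 1) / 2).
have s1 : s < 1 by rewrite gt_max p1 /=; lra.
have qs : q < s by apply: (@lt_le_trans _ _ ((q + 1) / 2)); [lra|rewrite le_max lexx orbT].
have ps : p <= s by rewrite le_max lexx.
have p0 : 0 < p := le_lt_trans r0 rp.
have ss : sqint P setT (fr f s) by apply: hardy_sqint => //; rewrite s1 (lt_le_trans p0).
have sd := sqintB measurableT sf ss.
have sp : sqint P setT (fr f p) by apply: hardy_sqint => //; rewrite p1 p0.
have h1 : cmod (f z) ^+ 2 <= K * normsq P setT (fr f p).
  by have := hK _ _ mf.1 zr; rewrite (normsqE sp) -EFinM lee_fin.
have normsq_le u v : sqint P setT u -> sqint P setT v ->
    (\int[P]_t (cmod (u t) ^+ 2)%:E <= \int[P]_t (cmod (v t) ^+ 2)%:E)%E ->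
      normsq P setT u <= normsq P setT v.
  by move=> su sv; rewrite (normsqE su) (normsqE sv) lee_fin.
have h2 : normsq P setT (fr f p) <= normsq P setT (fr f s)
  := normsq_le _ _ sp ss (radial_mono mf.1 p0 ps s1).
have h3 : normsq P setT (fun t => boundary_value f t - fr f s t) <= e / (2 * K + 1).
  by rewrite -lee_fin -(normsqE sd); exact: hq.
have h4 : normsq P setT (fr f s) <= 2 * normsq P setT (boundary_value f) +
    2 * normsq P setT (fun t => boundary_value f t - fr f s t).
  have par := parallelogram measurableT sf sd.
  rewrite -par; rewrite (_ : (fun x => _ - (_ - _)) = fr f s); last first.
    by apply/funext => t; rewrite subKr.
  by rewrite lerDr normsq_ge0.
move: h3; rewrite ler_pdivlMr ?ltr_wpDl ?mulr_ge0 // => h3.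
exact: (arith _ _ _ _ _ _ (normsq_ge0 _ _ _) h3 h1 h2 h4).
Qed.

End HardyTrace.

(** * The Szego kernel and Cauchy's formula on the torus *)

Section Szego.
Variable R : realType.
Local Notation C := R[i].
Local Notation line := (measurableTypeR R).

Lemma angle_cint (F : line -> C) : cmeas setT F -> cint (angle_prob R) setT F = seg_int 0 1 F.
Proof.
move=> [mr mi]; rewrite /seg_int /cint /Rintegral; congr (fine _ +i* fine _).
  by apply: angle_integral; exact/measurable_EFinP.
by apply: angle_integral; exact/measurable_EFinP.
Qed.

Definition szego n (a z : 'rV[C]_n) : C := \prod_(i < n) (1 - (a ord0 i)^* * z ord0 i)^-1.

Lemma szego_vcons n (x y : C) (a z : 'rV[C]_n) :
  szego (vcons x a) (vcons y z) = (1 - x^* * y)^-1 * szego a z.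
Proof.
rewrite /szego big_ord_recl !vcons0; congr (_ * _).
by apply: eq_bigr => i _; rewrite !vconsS.
Qed.

Lemma szego_factor_ge (x y : C) : cmod x < 1 -> cmod y <= 1 -> 1 - cmod x <= cmod (1 - x^* * y).
Proof.
move=> x1 y1; have := cmodB_ge 1 (x^* * y); rewrite cmod1 cmodM cmod_conj.
by have := cmod_ge0 x; have := cmod_ge0 y; nra.
Qed.

Lemma szego_factor_neq0 (x y : C) : cmod x < 1 -> cmod y <= 1 -> 1 - x^* * y != 0.
Proof.
move=> x1 y1; rewrite -cmod_eq0 gt_eqF // (lt_le_trans _ (szego_factor_ge x1 y1)) //.
by rewrite subr_gt0.
Qed.

Lemma szego_bound n (a : 'rV[C]_n) : polydisc a -> exists2 B : R, 0 <= B &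
  forall z : 'rV[C]_n, (forall i, cmod (z ord0 i) <= 1) -> cmod (szego a z) <= B.
Proof.
move=> aD; exists (\prod_(i < n) (1 - cmod (a ord0 i))^-1).
  by apply: prodr_ge0 => i _; rewrite invr_ge0 subr_ge0 ltW.
move=> z z1; rewrite /szego.
have -> : cmod (\prod_(i < n) (1 - (a ord0 i)^* * z ord0 i)^-1) =
    \prod_(i < n) cmod (1 - (a ord0 i)^* * z ord0 i)^-1.
  by apply: (big_morph _ (@cmodM R) (cmod1 R)).
apply: ler_prod => i _; rewrite cmod_ge0 cmodV /=.
have h := szego_factor_ge (aD i) (z1 i); have a1 : 0 < 1 - cmod (a ord0 i) by rewrite subr_gt0.
by rewrite lef_pV2 ?posrE // (lt_le_trans a1).
Qed.

Lemma holomorphic_prod n I (s : seq I) (g : I -> 'rV[C]_n -> C) :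
  (forall i, holomorphic (g i)) -> holomorphic (fun z => \prod_(i <- s) g i z).
Proof.
move=> hg; elim: s => [|i s IH].
  by under eq_fun do rewrite big_nil; exact: holomorphic_cst.
by under eq_fun do rewrite big_cons; exact: holomorphicM.
Qed.

Lemma holomorphic_coord n i : holomorphic (fun z : 'rV[C]_n => z ord0 i).
Proof.
move=> z _; apply/diff_epsP.
have lin : linear (fun z : 'rV[C]_n => z ord0 i) by move=> c u v; rewrite !mxE.
pose L : {linear 'rV[C]_n -> C} :=
  HB.pack (fun z : 'rV[C]_n => z ord0 i) (GRing.isLinear.Build _ _ _ _ _ lin).
exists L.
  by apply: (@linear_le_continuous _ _ _ _ 1) => v; rewrite mul1r rnorm_cmod; exact: coord_le_rnorm.
move=> e e0; exists 1 => // v _.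
have -> : (v + z) ord0 i - z ord0 i - L v = 0 by rewrite mxE addrK subrr.
by rewrite rnorm0 mulr_ge0 ?rnorm_ge0 // ltW.
Qed.

Lemma holomorphic_szego n (a : 'rV[C]_n) : polydisc a -> holomorphic (szego a).
Proof.
move=> aD; apply: holomorphic_prod => i z zD.
have h : differentiable (fun z : 'rV[C]_n => 1 - (a ord0 i)^* * z ord0 i) z.
  have := holomorphic_lin (- (a ord0 i)^*) (@holomorphic_cst R n 1) (holomorphic_coord i) zD.
  by under [X in differentiable X _ -> _]eq_fun do rewrite mulNr.
apply: (differentiableV h).
by apply: szego_factor_neq0 => //; rewrite ltW.
Qed.

Lemma szego_conj n (a z : 'rV[C]_n) : (szego a z)^* = szego z a.
Proof.
rewrite /szego rmorph_prod; apply: eq_bigr => i _.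
by rewrite fmorphV /= rmorphB rmorph1 rmorphM /= conjcK mulrC.
Qed.

Lemma cmod_torus n (t : n.-tuple line) i : cmod (torus_point t ord0 i) = 1.
Proof. by rewrite torus_coord cmod_expi. Qed.

Lemma rcont_szego_factor (x : C) u : cmod x < 1 -> rcont (fun u => (1 - x^* * expi u)^-1) u.
Proof.
move=> x1; apply: rcontV.
  by apply: rcontB; [exact: rcont_cst|exact: rcont_circle].
by apply: szego_factor_neq0 => //; rewrite cmod_expi.
Qed.

Lemma cmeas_szego n (a : 'rV[C]_n) : polydisc a -> cmeas setT (fun t => szego a (torus_point t)).
Proof.
move=> aD; apply: cmeas_prod => i.
have [m1 m2] := rcont_cmeas (fun u => rcont_szego_factor u (aD i)).
under [X in cmeas _ X]eq_fun do rewrite torus_coord.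
by split; [apply: (measurableT_comp m1)|apply: (measurableT_comp m2)]; exact: measurable_tnth.
Qed.

(** On the unit circle the Cauchy kernel [e / (e - a)] is the conjugate of the Szego factor, so
    Cauchy's formula in the first coordinate and induction give the claim. The bound on [f]
    justifies iterating the integral. *)
Lemma szego_cauchy n (f : 'rV[C]_n -> C) (r : R) a : 0 < r -> r < 1 -> holomorphic f ->
  polydisc a -> (exists B : R, forall z, rnorm z <= r -> cmod (f z) <= B) ->
  f (r%:C *: a) = cint (prob_power (angle_prob R) n) setT
    (fun t => f (r%:C *: torus_point t) * (szego a (torus_point t))^*).
Proof.
move=> r0 r1; have r01 : 0 <= r < 1 by rewrite r1 ltW.
elim: n f a => [|n IH] f a hf aD [B hB].
  set F := (fun t => _).
  have mF : cmeas setT F.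
    by apply: cmeasM; [exact: cmeas_radial|apply: cmeas_conj; exact: cmeas_szego].
  have -> : cint (prob_power (angle_prob R) 0) setT F = F [tuple].
    rewrite /cint /Rintegral !integral_prob_power0 /=; first by case: (F _).
      by apply/measurable_EFinP; exact: mF.2.
    by apply/measurable_EFinP; exact: mF.1.
  rewrite /F /szego big_ord0 rmorph1 mulr1; congr (f (_ *: _)).
  by apply/rowP => -[].
set F := (fun t => _).
have tr m (t : m.-tuple line) : rnorm (r%:C *: torus_point t) <= r.
  apply: rnorm_rV_le => [|i]; first exact: ltW.
  by rewrite mxE cmodM cmod_torus mulr1 cmod_real gtr0_norm.
have mF : cmeas setT F.
  by apply: cmeasM; [exact: cmeas_radial|apply: cmeas_conj; exact: cmeas_szego].
have [S S0 hS] := szego_bound aD.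
have FB t : cmod (F t) <= B * S.
  rewrite cmodM cmod_conj; apply: ler_pM; rewrite ?cmod_ge0 //; first exact: hB.
  by apply: hS => i; rewrite cmod_torus.
have [_ ->] := @cint_prob_powerS _ _ R (angle_prob R) n F _ mF FB.
pose a0 := a ord0 ord0; pose b := vtail a.
have aE : a = vcons a0 b by rewrite vcons_eta.
have [a0D bD] : cmod a0 < 1 /\ polydisc b by apply/polydisc_vcons; rewrite -aE.
have re x : cmod (r%:C * expi x) < 1 by rewrite cmodM cmod_expi mulr1 cmod_lt1_real.
pose g y := f (vcons (r%:C * y) (r%:C *: b)).
have rbD : polydisc (r%:C *: b).
  move=> i; rewrite mxE cmodM cmod_real gtr0_norm //; have := bD i; have := cmod_ge0 (b ord0 i);
    nra.
have dg y : cmod (y - 0) <= 1 -> cdiff g y.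
  rewrite subr0 => y1; apply: (@cdiff_comp _ (fun y => r%:C * y)
    (fun y => f (vcons y (r%:C *: b)))).
    by apply: cdiffM; [exact: cdiff_cst|exact: cdiff_id].
  apply: cdiff_vcons => //; rewrite cmodM cmod_real gtr0_norm //; have := cmod_ge0 y; nra.
have inner x : cint (prob_power (angle_prob R) n) setT (fun t => F (tuple_cons (x, t))) =
    g (expi x) * ((1 - a0^* * expi x)^-1)^*.
  have hB' : exists B' : R, forall z, rnorm z <= r -> cmod (f (vcons (r%:C * expi x) z)) <= B'.
    exists B => z zr; apply: hB; apply: rnorm_rV_le => [|i]; first exact: ltW.
    case: (unliftP ord0 i) => [j|] ->; first by rewrite vconsS (le_trans (coord_le_rnorm _ _) zr).
    by rewrite vcons0 cmodM cmod_expi mulr1 cmod_real gtr0_norm.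
  rewrite /g (IH (fun w => f (vcons (r%:C * expi x) w)) b (holomorphic_slice hf (re x)) bD hB').
  rewrite mulrC -cintZ //; last first.
    have [S' S'0 hS'] := szego_bound bD; have [B' hB''] := hB'.
    apply: (@cintegrable_bounded _ _ _ _ _ _ (B' * S')) => //.
    - by rewrite (_ : _ [set: _] = 1%E) ?ltry //; exact: probability_setT.
    - apply: cmeasM; last by apply: cmeas_conj; exact: cmeas_szego.
      exact: (cmeas_radial (holomorphic_slice hf (re x)) r01).
    move=> t _; rewrite cmodM cmod_conj; apply: ler_pM; rewrite ?cmod_ge0 //; first exact: hB''.
    by apply: hS' => i; rewrite cmod_torus.
  apply: eq_cint => t _; rewrite /F aE torus_point_cons szego_vcons scale_vcons rmorphM /=.
  by rewrite mulrCA.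
have cg u : rcont (fun x => g (expi x) * ((1 - a0^* * expi x)^-1)^*) u.
  apply: rcontM; last by apply: rcont_conj; exact: rcont_szego_factor.
  by apply: (rcont_comp (u := @expi R)); [apply: dg; rewrite subr0 cmod_expi|exact: rcont_expi].
rewrite (eq_cint (angle_prob R) (fun x _ => inner x)) angle_cint; last exact: rcont_cmeas.
have a01 : cmod (a0 - 0) < 1 by rewrite subr0.
have -> : f (r%:C *: a) = g a0 by rewrite aE scale_vcons.
rewrite (cauchy_circle a01 dg); apply: eq_cint => u _; rewrite add0r !mul1r; congr (_ * _).
have e0 := expi_neq0 u.
rewrite [RHS](_ : _ = (1 - a0 / expi u)^-1); last first.
  by rewrite fmorphV rmorphB rmorph1 rmorphM -expi_conj; congr (1 - _ * _)^-1; exact: conjcK.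
have -> : expi u - a0 = expi u * (1 - a0 / expi u).
  by rewrite mulrBr mulr1 mulrCA divff ?mulr1.
by rewrite invfM mulrA divff ?mul1r.
Qed.

End Szego.

Section HardyAxioms.
Variables (R : realType) (n : nat).
Local Notation C := R[i].
Local Notation line := (measurableTypeR R).
Local Notation H := (hardy_space R n).
Local Notation P := (prob_power (angle_prob R) n).
Local Notation tp := (@torus_point R n).
Implicit Types f g : 'rV[C]_n -> C.

Let fr f (r : R) (t : n.-tuple line) : C := f (r%:C *: tp t).

Lemma radlim_bound (u : R -> C) l (B : R) : radlim u l ->
  (forall r, 0 < r -> r < 1 -> cmod (u r) <= B) -> cmod l <= B.
Proof.
move=> h uB; apply/ler_addgt0Pr => e /h[p p1 hp].
pose r := (Num.max p 0 + 1) / 2.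
have m1 : Num.max p 0 < 1 by rewrite gt_max p1 ltr01.
have mr : Num.max p 0 < r by rewrite /r; lra.
have r1 : r < 1 by rewrite /r; lra.
have [pr r0] : p < r /\ 0 < r by move: mr; rewrite gt_max => /andP[].
have := cmodB (u r) (u r - l); rewrite subKr.
by have := hp _ pr r1; have := uB _ r0 r1; lra.
Qed.

Lemma hardy_bounded f (B : R) : holomorphic f -> (forall z, polydisc z -> cmod (f z) <= B) ->
  hardy_mem f /\ forall t, cmod (boundary_value f t) <= B.
Proof.
move=> hf fB.
have B0 : 0 <= B.
  have z0 : polydisc (0 : 'rV[C]_n) by move=> i; rewrite mxE cmod0.
  exact: le_trans (cmod_ge0 _) (fB _ z0).
have rB (r : R) t : 0 < r -> r < 1 -> cmod (ray f t r) <= B.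
  by move=> r0 r1; apply: fB; apply: torus_polydisc; apply: cmod_lt1_real; rewrite ltW.
split; last first.
  (* The bound holds at every [t]: where there is no radial limit, the default value 0 satisfies it
     as well. *)
  move=> t; have [ct|nct] := pselect (rcauchy (ray f t)); last by rewrite boundary_value0 // cmod0.
  have [l hl] := rcauchy_radlim ct; rewrite (boundary_valueP hl).
  by apply: radlim_bound hl _ => r; exact: rB.
split=> //; apply: (@le_lt_trans _ _ (B ^+ 2)%:E); last by rewrite ltry.
apply: ge_ereal_sup => _ [r + <-]; rewrite /= in_itv /= => /andP[r0 r1].
apply: (@le_trans _ _ (\int[P]_t cst (B ^+ 2)%:E t)%E).
  apply: ge0_le_integral => //.
  - by move=> t _; rewrite lee_fin sqr_ge0.
  - by apply/measurable_EFinP; apply: cmeas_cmod2; apply: cmeas_radial => //; rewrite r1 ltW.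
  by move=> t _; rewrite lee_fin ler_pXn2r ?nnegrE ?cmod_ge0 //; exact: rB.
rewrite integral_cst // [X in (_ * X)%E](_ : _ = 1%E) ?mule1 //; exact: probability_setT.
Qed.

Lemma hardy_memP f : holomorphic f -> hardy_mem f <->
  exists B : R, forall r, 0 < r < 1 -> (\int[P]_t (cmod (fr f r t) ^+ 2)%:E <= B%:E)%E.
Proof.
move=> hf; split=> [[_ fin]|[B hB]].
  set S := ereal_sup _ in fin.
  have ub (r : R) : 0 < r < 1 -> (\int[P]_t (cmod (fr f r t) ^+ 2)%:E <= S)%E.
    by move=> r01; apply: ereal_sup_ubound; exists r.
  have h01 : 0 < (1 / 2 : R) < 1 by apply/andP; split; lra.
  exists (fine S) => r /ub; rewrite fineK // ge0_fin_numE //; apply: le_trans (ub _ h01).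
  by apply: integral_ge0 => t _; rewrite lee_fin sqr_ge0.
split=> //; apply: (@le_lt_trans _ _ B%:E); last by rewrite ltry.
by apply: ge_ereal_sup => _ [r + <-]; rewrite /= in_itv /= => /hB.
Qed.

Lemma hardy_lin f g (c : C) : hardy_mem f -> hardy_mem g -> hardy_mem (fun z => f z + c * g z).
Proof.
move=> mf mg; have [A hA] := (hardy_memP mf.1).1 mf; have [B hB] := (hardy_memP mg.1).1 mg.
apply/hardy_memP; first exact: holomorphic_lin mf.1 mg.1.
exists (2 * A + 2 * cmod c ^+ 2 * B) => r r01.
have sf := hardy_sqint mf r01; have sg := hardy_sqint mg r01.
have h1 := hA _ r01; have h2 := hB _ r01.
rewrite (normsqE (sqint_lin measurableT c sf sg)) lee_fin.
apply: le_trans (normsq_lin_le measurableT c sf sg) _.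
move: h1 h2; rewrite (normsqE sf) (normsqE sg) !lee_fin => h1 h2.
apply: lerD; first by rewrite ler_pM2l.
by apply: ler_wpM2l => //; rewrite mulr_ge0 ?sqr_ge0.
Qed.

Lemma ray_lin f g c t l m : radlim (ray f t) l -> radlim (ray g t) m ->
  boundary_value (fun z => f z + c * g z) t = l + c * m.
Proof. by move=> hl hm; apply: boundary_valueP; exact: (radlimD_lin c hl hm). Qed.

Lemma szego_radlim (a : 'rV[C]_n) t : polydisc a -> radlim (ray (szego a) t) (szego a (tp t)).
Proof.
move=> aD.
have cr : rcont (fun r : R => r%:C : C) 1 by exact: (cder_continuous (cder_id _)).
have h : rcont (fun r => szego a (r%:C *: tp t)) 1.
  rewrite /szego; elim: (index_enum _) => [|i s IH].
    by under [X in rcont X]eq_fun do rewrite big_nil; exact: rcont_cst.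
  under [X in rcont X]eq_fun do rewrite big_cons mxE.
  apply: rcontM => //; apply: rcontV.
    by apply: rcontB; [exact: rcont_cst|apply: rcontM;
      [exact: rcont_cst|apply: rcontM => //; exact: rcont_cst]].
  by apply: szego_factor_neq0 => //; rewrite mul1r cmod_torus.
move=> e /h[d d0 hd]; exists (1 - d); first by rewrite gtrBl.
move=> r r1 r2; have := hd r; rewrite scale1r; apply.
by rewrite distrC gtr0_norm ?subr_gt0 // ltrBlDr -ltrBlDl.
Qed.

(** [szego_cauchy] reproduces the dilates of [f]. As [r] tends to 1 the left side converges by
    continuity at [a], the right side because the dilates converge to the boundary value in L^2. *)
Lemma hardy_szego (a : 'rV[C]_n) : polydisc a -> is_reproducing_kernel H a (szego a).
Proof.
move=> aD; have [B B0 hB] := szego_bound aD.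
have [mk _] : hardy_mem (szego a) /\ forall t, cmod (boundary_value (szego a) t) <= B.
  apply: hardy_bounded; first exact: holomorphic_szego.
  by move=> z zD; apply: hB => i; apply: ltW.
split=> // f mf.
pose s t := szego a (tp t).
have bs : boundary_value (szego a) = s.
  by apply/funext => t; apply: boundary_valueP; exact: szego_radlim.
have -> : inner H f (szego a) = iprod P setT (boundary_value f) s by rewrite -bs.
have ss : sqint P setT s by rewrite -bs; exact: hardy_trace_sqint.
have sf := hardy_trace_sqint mf.
apply/eqP; rewrite -subr_eq0; apply/eqP/cmod_small => e e0.
have N0 := normsq_ge0 P setT s; set N := normsq P setT s in N0.
(* With this [x] the error of the inner product is at most [(e / 2 + e) / 2 = 3 e / 4]; the
   remaining [e / 4] is spent on [f(r a) - f(a)]. *)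
pose x := (N + 1) / e; have x0 : 0 < x by rewrite divr_gt0 // ltr_wpDl.
have ex : 0 < e / x / 2 by rewrite divr_gt0 // divr_gt0.
have [p /andP[p0 p1] hp] := hardy_radial_cvg mf ex.
have an := polydisc_rnorm aD.
have dfa : cdiff (fun m => f (0 + m *: a)) 1.
  by apply: cdiff_slice; rewrite add0r scale1r; exact: mf.1.
have e4 : 0 < e / 4 by rewrite divr_gt0.
have [d d0 hd] := continuous1_eps dfa e4.
pose r := (Num.max p (1 - d) + 1) / 2.
have m1 : Num.max p (1 - d) < 1 by rewrite gt_max p1 gtrBl.
have [mr r1] : Num.max p (1 - d) < r /\ r < 1 by have [] := midf_lt m1.
have [pr dr] : p < r /\ 1 - d < r by move: mr; rewrite gt_max => /andP[].
have r0 := lt_trans p0 pr.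
have sr : sqint P setT (fr f r) by apply: hardy_sqint => //; rewrite r0.
have near : cmod (f (r%:C *: a) - f a) < e / 4.
  have := hd r%:C; rewrite !add0r scale1r; apply.
  by rewrite -(rmorphB _ r 1) cmod_real distrC gtr0_norm ?subr_gt0 // ltrBlDr -ltrBlDl.
have rep : f (r%:C *: a) = iprod P setT (fr f r) s.
  by apply: szego_cauchy => //; [exact: mf.1|exact: hardy_radial_bounded].
have sd := sqintB measurableT sf sr.
have hd2 : normsq P setT (fun t => boundary_value f t - fr f r t) <= e / x / 2.
  by have := hp _ pr r1; rewrite (normsqE sd) lee_fin.
have dif : iprod P setT (boundary_value f) s - iprod P setT (fr f r) s =
    iprod P setT (fun t => boundary_value f t - fr f r t) s.
  have := iprodZDl measurableT (-1) sf sr ss; rewrite mulN1r => <-.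
  by under [in RHS]eq_fun do rewrite -mulN1r.
have := iprod_bound measurableT sd ss x0; rewrite -dif -rep -/N => hip.
have hx : (x * normsq P setT (fun t => boundary_value f t - fr f r t) + N / x) / 2 <= 3 * e / 4.
  have h1 : x * normsq P setT (fun t => boundary_value f t - fr f r t) <= e / 2.
    have := ler_wpM2l (ltW x0) hd2; move=> /le_trans; apply.
    by rewrite le_eqVlt; apply/orP; left; apply/eqP; field; rewrite gt_eqF.
  have h2 : N / x <= e.
    rewrite ler_pdivrMr // (_ : e * x = N + 1); first by rewrite lerDl.
    by rewrite /x mulrC divfK // gt_eqF.
  rewrite (_ : 3 * e / 4 = (e / 2 + e) / 2); last by field.
  by rewrite ler_wpM2r ?invr_ge0 // lerD.
have := cmodD (f a - f (r%:C *: a)) (f (r%:C *: a) - iprod P setT (boundary_value f) s).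
rewrite addrA subrK => /le_trans; apply.
rewrite cmodBC [X in _ + X <= _]cmodBC (_ : e = e / 4 + 3 * e / 4); last by field.
by apply: lerD (ltW near) (le_trans hip hx).
Qed.

(** [repro_kernel] is some chosen kernel, so an arbitrary [k] has to be treated: reproducing [k] by
    the Szego kernel at [z], and that kernel by [k], gives [k z = szego a z]. *)
Lemma hardy_kernel_bounded (a : 'rV[C]_n) k : polydisc a -> is_reproducing_kernel H a k ->
  exists2 B : R, 0 <= B & forall z, polydisc z -> cmod (k z) <= B.
Proof.
move=> aD [mk hk]; have [B B0 hB] := szego_bound aD; exists B => // z zD.
have [mz hz] := hardy_szego zD; have [ma _] := hardy_szego aD.
have -> : k z = szego a z.
  rewrite (hz _ mk) -(szego_conj z a) (hk _ mz).
  exact: (iprodC measurableT (hardy_trace_sqint mk) (hardy_trace_sqint mz)).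
by apply: hB => i; exact: ltW.
Qed.

Lemma hardy_space_axioms : space_axioms H.
Proof.
split.
- exact: measurableT.
- by rewrite /=; exact: probability_le1.
- by move=> f [hf _]; exact: cmeas_boundary_value.
- by move=> f [].
- move=> f B hf fB; have [mf h] := hardy_bounded hf fB; split=> //.
  by apply: aeW => t _; exact: h.
- move=> f g c mf mg; split; first exact: hardy_lin.
  apply: filterS2 (hardy_ae_rcauchy mf) (hardy_ae_rcauchy mg) => t.
  move=> /rcauchy_radlim[l hl] /rcauchy_radlim[m hm] _.
  by rewrite /= (boundary_valueP hl) (boundary_valueP hm); exact: ray_lin.
- by move=> f mf; exact: (hardy_trace_sqint mf).2.
- by move=> r; exact: hardy_local.
- by move=> a aD; exists (szego a); exact: hardy_szego.
move=> a k f aD hk mf _; have [B B0 hB] := hardy_kernel_bounded aD hk; have [mk _] := hk.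
split.
  apply/hardy_memP; first exact: holomorphicM mf.1 mk.1.
  have [A hA] := (hardy_memP mf.1).1 mf.
  exists (B ^+ 2 * A) => r r01; rewrite EFinM.
  apply: le_trans (_ : _ <= (B ^+ 2)%:E * \int[P]_t (cmod (fr f r t) ^+ 2)%:E)%E _; last first.
    by apply: lee_wpmul2l; [rewrite lee_fin sqr_ge0|exact: hA].
  have rr : 0 <= r < 1 by case/andP: r01 => /ltW -> ->.
  rewrite -ge0_integralZl //; last 3 first.
  - by apply/measurable_EFinP; apply: cmeas_cmod2; exact: cmeas_radial mf.1 rr.
  - by move=> t _; rewrite lee_fin sqr_ge0.
  - by rewrite lee_fin sqr_ge0.
  apply: ge0_le_integral => //.
  - by move=> t _; rewrite lee_fin sqr_ge0.
  - by apply/measurable_EFinP; apply: cmeas_cmod2; apply: cmeasM; apply: cmeas_radial => //;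
      [exact: mf.1|exact: mk.1].
  - by apply: measurable_funeM; apply/measurable_EFinP; apply: cmeas_cmod2;
      exact: cmeas_radial mf.1 rr.
  move=> t _; rewrite -EFinM lee_fin /fr cmodM exprMn mulrC ler_wpM2r ?sqr_ge0 //.
  rewrite ler_pXn2r ?nnegrE ?cmod_ge0 //; apply: hB; apply: torus_polydisc; exact: cmod_lt1_real.
apply: filterS2 (hardy_ae_rcauchy mf) (hardy_ae_rcauchy mk) => t.
move=> /rcauchy_radlim[l hl] /rcauchy_radlim[m hm] _.
rewrite /= (boundary_valueP hl) (boundary_valueP hm); apply: boundary_valueP; exact: radlimM.
Qed.

End HardyAxioms.

Theorem corollary34 (R : realType) (n : nat) (hn : (0 < n)%N) :
  [<-> corona_property R n;
       convex_poisson_property (hardy_space R n);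
       convex_poisson_property (bergman_space R n)].
Proof.
have SH := hardy_space_axioms R n; have SB := bergman_space_axioms R n.
tfae.
- exact: corona_convex_poisson.
- by move=> /(convex_poisson_corona SH); exact: corona_convex_poisson.
- exact: convex_poisson_corona.
Qed.
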